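(* Let $n\ge1$, let $A$ be a real symmetric positive definite $n\times n$ matrix, and let $h_0>0$, $h\in(0,h_0]$. The semiclassical harmonic oscillator $P(h)=-h^2\Delta+\langle Ax,x\rangle_{\mathbb{R}^n}$ on $L^2(\mathbb{R}^n)$ has purely discrete spectrum, and $$\sigma(P(h))=\{h e_j : j\in\{0,1,2,\dots\}\},$$ where $\{e_j : j\in\{0,1,2,\dots\}\}=\sigma(K)$ is the spectrum of $K=-\Delta+\langle Ax,x\rangle_{\mathbb{R}^n}$ on $L^2(\mathbb{R}^n)$.
   Context: $\langle Ax,x\rangle_{\mathbb{R}^n}=\sum_{i,j=1}^n a_{ij}x_ix_j$. $P(h)$ and $K$ denote the self-adjoint operators on $L^2(\mathbb{R}^n)$ obtained as the closures of the corresponding differential expressions on $C_0^\infty(\mathbb{R}^n)$ (essentially self-adjoint there). Purely discrete spectrum means that every point of the spectrum is an isolated point of the spectrum and an eigenvalue of finite multiplicity. *)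

(* Defs.v *)
From HB Require Import structures.
From mathcomp Require Import all_boot all_order all_algebra.
From mathcomp Require Import complex.
From mathcomp Require Import all_classical all_reals all_analysis.

Set Implicit Arguments.
Unset Strict Implicit.
Unset Printing Implicit Defensive.

Import Order.TTheory GRing.Theory Num.Theory.
Import numFieldNormedType.Exports.

Local Open Scope classical_set_scope.
Local Open Scope ring_scope.
Local Open Scope complex_scope.

Definition rV_display : measure_display -> measure_display.
Proof. exact. Qed.

Section rV_measurable.
Variables (R : realType) (n : nat).

Let coord (i : 'I_n) (x : 'rV[R]_n) : R := x 0 i.

Let rV_set0 : g_sigma_preimage coord set0.
Proof. exact: sigma_algebra0. Qed.

Let rV_setC A : g_sigma_preimage coord A -> g_sigma_preimage coord (~` A).
Proof. exact: sigma_algebraC. Qed.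

Let rV_bigcup (F : _^nat) : (forall i, g_sigma_preimage coord (F i)) ->
  g_sigma_preimage coord (\bigcup_i (F i)).
Proof. exact: sigma_algebra_bigcup. Qed.

(* The sigma-algebra generated by the coordinates, i.e. the Borel sets. *)
HB.instance Definition _ :=
  @isMeasurable.Build (rV_display default_measure_display) 'rV[R]_n
    (g_sigma_preimage coord) rV_set0 rV_setC rV_bigcup.

End rV_measurable.

Section rV_measurable_theory.
Variables (R : realType) (n : nat).

Lemma measurable_coord (i : 'I_n) :
  measurable_fun [set: 'rV[R]_n] (fun x => x 0 i).
Proof.
move=> _ Y mY; rewrite setTI; apply: sub_sigma_algebra => /=.
rewrite -bigcup_seq/=; exists i => /=; first by rewrite mem_index_enum.
by exists Y => //; rewrite setTI.
Qed.

Lemma measurable_fun_rVP d (T : measurableType d) (f : T -> 'rV[R]_n) :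
  measurable_fun setT f <-> forall i, measurable_fun setT (fun t => f t 0 i).
Proof.
split=> [mf i|mf].
  by apply: (measurableT_comp (measurable_coord i)).
apply: (@measurability _ _ _ _ setT f
  (\big[setU/set0]_(i < n) preimage_set_system setT
     (fun x : 'rV[R]_n => x 0 i) measurable)) => //.
move=> _ [A + <-]; rewrite -bigcup_seq => -[i _ [B mB <-]].
by have := mf i measurableT B mB; rewrite !setTI.
Qed.

End rV_measurable_theory.

Section lebesgue_rV.
Variable R : realType.

Definition cons_rV n (p : R * 'rV[R]_n) : 'rV[R]_n.+1 :=
  row_mx (p.1)%:M p.2 : 'rV_(1 + n).

Lemma cons_rV0 n p : @cons_rV n p 0 0 = p.1.
Proof.
have -> : 0 = lshift n (0 : 'I_1) by exact/val_inj.
by rewrite [LHS]row_mxEl mxE eqxx mulr1n.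
Qed.

Lemma cons_rVS n p j : @cons_rV n p 0 (lift ord0 j) = p.2 0 j.
Proof.
have -> : lift ord0 j = rshift 1 j by exact/val_inj.
by rewrite [LHS]row_mxEr.
Qed.

Lemma measurable_cons_rV n : measurable_fun setT (@cons_rV n).
Proof.
apply/measurable_fun_rVP => i; have [j|] := unliftP ord0 i => ->.
  under eq_fun do rewrite cons_rVS.
  exact: measurableT_comp (measurable_coord j) measurable_snd.
under eq_fun do rewrite cons_rV0.
exact: measurable_fst.
Qed.

Definition uncons_rV n (x : 'rV[R]_n.+1) : R * 'rV[R]_n :=
  (x 0 0, \row_j x 0 (lift ord0 j)).

Lemma cons_rVK n : cancel (@cons_rV n) (@uncons_rV n).
Proof.
move=> [a x]; rewrite /uncons_rV cons_rV0; congr pair.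
by apply/rowP => j; rewrite mxE cons_rVS.
Qed.

Lemma measurable_uncons_rV n : measurable_fun setT (@uncons_rV n).
Proof.
apply/measurable_fun_pairP; split; first exact: measurable_coord.
apply/measurable_fun_rVP => i /=.
under eq_fun do rewrite mxE.
exact: measurable_coord.
Qed.

Section cons_measure.
Variables (n : nat) (m : {sigma_finite_measure set 'rV[R]_n -> \bar R}).

Definition cons_measure : set 'rV[R]_n.+1 -> \bar R :=
  pushforward (lebesgue_measure \x m)%E (@cons_rV n).

Let cons_measure0 : cons_measure set0 = 0%E.
Proof. by rewrite /cons_measure /pushforward preimage_set0 measure0. Qed.

Let cons_measure_ge0 A : (0 <= cons_measure A)%E.
Proof. by rewrite /cons_measure /pushforward. Qed.

Let cons_measure_sigma_additive : semi_sigma_additive cons_measure.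
Proof.
have mF (A : set 'rV[R]_n.+1) : measurable A -> measurable (@cons_rV n @^-1` A).
  by move=> mA; rewrite -[X in measurable X]setTI; exact: measurable_cons_rV.
move=> F mFk tF mUF; rewrite /cons_measure /pushforward preimage_bigcup.
apply: measure_semi_sigma_additive; first by move=> k; exact: mF.
- apply/trivIsetP => i j _ _ ij; rewrite -preimage_setI.
  by move/trivIsetP : tF => /(_ _ _ _ _ ij) ->//; rewrite preimage_set0.
- by rewrite -preimage_bigcup; exact: mF.
Qed.

HB.instance Definition _ := isMeasure.Build _ _ _ cons_measure
  cons_measure0 cons_measure_ge0 cons_measure_sigma_additive.

Let cons_measure_sigma_finite : sigma_finite setT cons_measure.
Proof.
have /sigma_finiteP[F [FT ndF Foo]] := sigma_finiteT (@lebesgue_measure R).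
have /sigma_finiteP[G [GT ndG Goo]] := sigma_finiteT m.
exists (fun k => @uncons_rV n @^-1` (F k `*` G k)).
  rewrite -preimage_bigcup (_ : \bigcup_k _ = setT) ?preimage_setT//.
  apply/seteqP; split=> // -[a x] _.
  have [i _ Fia] : (\bigcup_i F i) a by rewrite -FT.
  have [j _ Gjx] : (\bigcup_j G j) x by rewrite -GT.
  exists (maxn i j) => //; split=> /=.
    by move: Fia; exact/subsetPset/ndF/leq_maxl.
  by move: Gjx; exact/subsetPset/ndG/leq_maxr.
move=> k; have [mF Fk] := Foo k; have [mG Gk] := Goo k; split.
  rewrite -[X in measurable X]setTI.
  by apply: measurable_uncons_rV => //; exact: measurableX.
rewrite /cons_measure /pushforward -comp_preimage.
rewrite (_ : _ \o _ = id); last by apply/funext => x /=; rewrite cons_rVK.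
by rewrite preimage_id product_measure1E// lte_mul_pinfty// ge0_fin_numE.
Qed.

HB.instance Definition _ := Measure_isSigmaFinite.Build _ _ _
  cons_measure cons_measure_sigma_finite.

End cons_measure.

(* Lebesgue measure on R^n: lambda_(n+1) is lambda_1 x lambda_n carried over to
   'rV_n.+1 by (a, x) |-> (a, x_0, ..., x_(n-1)). *)
Fixpoint lebesgue_rV n : {sigma_finite_measure set 'rV[R]_n -> \bar R} :=
  if n is k.+1 then cons_measure (lebesgue_rV k) else \d_(0 : 'rV[R]_0).

End lebesgue_rV.

Section L2.
Variables (R : realType) (n : nat).
Implicit Types u v f g : 'rV[R]_n -> R[i].

Definition L2norm u : \bar R :=
  Lnorm (lebesgue_rV R n) 2%:E (fun x => (ComplexField.Normc.normc (u x))%:E).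

(* Elements of L^2(R^n; C) are handled through representatives: functions that
   agree almost everywhere (aeeq) stand for the same element. *)
Definition L2 : set ('rV[R]_n -> R[i]) :=
  [set u | [/\ measurable_fun setT (fun x => complex.Re (u x)),
               measurable_fun setT (fun x => complex.Im (u x)) &
               (L2norm u < +oo)%E]].

Definition aeeq u v : Prop := {ae lebesgue_rV R n, forall x, u x = v x}.

(* A (possibly unbounded) operator on L^2 is given by its graph:
   [T u f] reads "u is in the domain of T and T u = f". *)
Definition operator := ('rV[R]_n -> R[i]) -> ('rV[R]_n -> R[i]) -> Prop.
Implicit Type T : operator.

(* The operator whose graph is the closure in L^2 x L^2 of the graph of P with
   domain D. *)
Definition operator_closure (D : set ('rV[R]_n -> R[i]))
    (P : ('rV[R]_n -> R[i]) -> 'rV[R]_n -> R[i]) : operator :=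
  fun u f => [/\ L2 u, L2 f &
    exists phi : nat -> 'rV[R]_n -> R[i],
      [/\ forall k, D (phi k),
          (fun k => L2norm (fun x => phi k x - u x)) @ \oo --> 0%E &
          (fun k => L2norm (fun x => P (phi k) x - f x)) @ \oo --> 0%E]].

(* The graph of T - z. *)
Definition op_shift T (z : R[i]) : operator :=
  fun u g => T u (fun x => g x + z * u x).

(* T - z is a bijection of the domain of T onto L^2 with bounded inverse. *)
Definition resolvent_set T : set R[i] :=
  [set z |
    [/\ forall u v f, op_shift T z u f -> op_shift T z v f -> aeeq u v,
        forall f, L2 f -> exists u, op_shift T z u f &
        exists C : R, forall u f, op_shift T z u f ->
          (L2norm u <= C%:E * L2norm f)%E]].

Definition spectrum T : set R[i] := ~` resolvent_set T.

Definition eigenspace T (z : R[i]) : set ('rV[R]_n -> R[i]) :=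
  [set u | T u (fun x => z * u x)].

Definition eigenvalue T (z : R[i]) : Prop :=
  exists2 u, eigenspace T z u & ~ aeeq u (fun=> 0).

(* The eigenspace is spanned, modulo null sets, by finitely many functions. *)
Definition finite_multiplicity T (z : R[i]) : Prop :=
  exists (m : nat) (b : 'I_m -> 'rV[R]_n -> R[i]),
    (forall k, eigenspace T z (b k)) /\
    forall u, eigenspace T z u -> exists c : 'I_m -> R[i],
      aeeq u (fun x => \sum_(k < m) c k * b k x).

Definition purely_discrete_spectrum T : Prop :=
  forall z, spectrum T z ->
    (* the topology on R[i] is carried by its copy (R[i])^o *)
    [/\ isolated (spectrum T : set (R[i])^o) z,
        eigenvalue T z & finite_multiplicity T z].

End L2.

Section schrodinger.
Variables (R : realType) (n : nat).

Definition partial (i : 'I_n) (g : 'rV[R]_n -> R) (x : 'rV[R]_n) : R :=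
  'D_(delta_mx 0 i) g x.

(* Every iterated partial derivative is continuous and has all its first-order
   partial derivatives at each point. *)
Definition smooth (g : 'rV[R]_n -> R) : Prop :=
  forall s : seq 'I_n, continuous (foldr partial g s) /\
    forall (i : 'I_n) x, derivable (foldr partial g s) x (delta_mx 0 i).

Definition Cc_smooth : set ('rV[R]_n -> R[i]) :=
  [set f | [/\ smooth (fun x => complex.Re (f x)),
               smooth (fun x => complex.Im (f x)) &
               compact (closure [set x | f x != 0])]].

Definition laplacian (f : 'rV[R]_n -> R[i]) (x : 'rV[R]_n) : R[i] :=
  \sum_(i < n)
    (partial i (partial i (fun y => complex.Re (f y))) x +i*
     partial i (partial i (fun y => complex.Im (f y))) x).

Definition qform (A : 'M[R]_n) (x : 'rV[R]_n) : R :=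
  \sum_(i < n) \sum_(j < n) A i j * x 0 i * x 0 j.

Definition pos_def (A : 'M[R]_n) : Prop := forall x, x != 0 -> 0 < qform A x.

Definition opP (A : 'M[R]_n) (h : R) : operator R n :=
  operator_closure Cc_smooth
    (fun f x => - (h ^+ 2)%:C * laplacian f x + (qform A x)%:C * f x).

Definition opK (A : 'M[R]_n) : operator R n :=
  operator_closure Cc_smooth
    (fun f x => - laplacian f x + (qform A x)%:C * f x).

End schrodinger.

(* Main.v *)
Require Import Defs.
From mathcomp Require Import all_boot all_order all_algebra.
From mathcomp Require Import complex.
From mathcomp Require Import all_classical all_reals all_analysis.
From mathcomp Require Import measurable_realfun.
From mathcomp Require Import ring lra.
Set Implicit Arguments.
Unset Strict Implicit.
Unset Printing Implicit Defensive.
Import Order.TTheory GRing.Theory Num.Theory.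
Import numFieldNormedType.Exports.
Local Open Scope classical_set_scope.
Local Open Scope ring_scope.
Local Open Scope complex_scope.

(** The quadratic form is diagonalized by an orthogonal change of coordinates
    y = V x, with eigenvalues w_k^2.  In these coordinates the Hermite functions
    psi_a (a polynomial in each y_k times the Gaussian G) are eigenfunctions of
    -h^2 Delta + <Ax, x> with eigenvalues h sum_k w_k (2 a_k + 1), so a rescaling
    by h relates P(h) and K, and only finitely many of these eigenvalues lie below
    a given level.  The psi_a lie in the domain of the closure from C_0^oo (by
    smooth cutoffs), are orthogonal (by symmetry and separation of variables) and
    complete: if u is orthogonal to all of them, then u G has vanishing moments
    against all polynomials, which forces u = 0.  A closed operator that is
    diagonal in a complete orthogonal system, with real eigenvalues tending to
    infinity, has exactly these eigenvalues as its spectrum, which is purely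
    discrete. *)

(** * Real symmetric matrices *)

(** Self-adjointness is never invoked. The closure is compared with the diagonal operator from both
    sides: finite combinations of eigenfunctions lie in its domain, and symmetry on test functions,
    passed to the limit, forces <Tu, psi_a> = lambda_a <u, psi_a> for every u in the domain. With
    completeness this determines the resolvent coefficient by coefficient. The psi_a and lambda_a
    are real, so all estimates are made on real and imaginary parts with the real inner product.
    Different multi-indices may have the same energy, and then symmetry of the full operator cannot
    separate their eigenfunctions; orthogonality therefore uses the second derivative along a single
    y_k. The psi_a are not normalized, but their norms must be nonzero for every energy to be
    attained. Completeness uses no Fourier transform: u G is integrable against functions of
    exponential growth, so sine series can be integrated against it term by term. This is why decay
    is measured against exponentials of the l^1 norm and not against polynomials. *)

Section real_symmetric.
Variable R : rcfType.
Local Notation rc := (@real_complex R).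

Lemma dot_eq0 n (u : 'rV[R]_n) : u *m u^T = 0 -> u = 0.
Proof.
move=> /matrixP/(_ 0 0); rewrite !mxE => /eqP; rewrite psumr_eq0.
  move=> /allP h; apply/rowP => i; rewrite mxE.
  have := h i (mem_index_enum _); rewrite mxE/= mulf_eq0 => /orP[]/eqP//.
by move=> i _; rewrite mxE -expr2 sqr_ge0.
Qed.

Lemma dot_ge0 n (u : 'rV[R]_n) : 0 <= (u *m u^T) 0 0.
Proof. by rewrite mxE sumr_ge0// => i _; rewrite mxE -expr2 sqr_ge0. Qed.

Lemma dotC_eq0 n (u : 'rV[R[i]]_n) : (u *m (map_mx Num.conj u)^T) 0 0 = 0 -> u = 0.
Proof.
rewrite mxE => /eqP; rewrite psumr_eq0.
  move=> /allP h; apply/rowP => i; rewrite mxE.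
  have := h i (mem_index_enum _); rewrite !mxE/= mulf_eq0 conjC_eq0 => /orP[]/eqP//.
by move=> i _; rewrite !mxE mul_conjC_ge0.
Qed.

(** The number w A w^* equals a |w|^2 when A acts on w, and conj(a) |w|^2 when it acts on w^*, while
    |w|^2 is nonzero. *)
Lemma symmetric_eigenvalue_real n (A : 'M[R]_n) (w : 'rV[R[i]]_n) a : A^T = A ->
  w != 0 -> w *m map_mx rc A = a *: w -> a \is Num.real.
Proof.
move=> sA w0 wA; rewrite CrealE.
have conjA : map_mx Num.conj (map_mx rc A) = map_mx rc A.
  apply/matrixP => i j; rewrite !mxE; apply/eqP; rewrite -CrealE.
  by apply/complex_realP; exists (A i j).
set s := (w *m (map_mx Num.conj w)^T) 0 0.
have s0 : s != 0 by apply: contra w0 => /eqP/dotC_eq0 ->.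
apply/eqP; apply: (mulIf s0).
have E1 : (w *m map_mx rc A *m (map_mx Num.conj w)^T) 0 0 = a * s.
  by rewrite wA -scalemxAl mxE.
have E2 : (w *m map_mx rc A *m (map_mx Num.conj w)^T) 0 0 = a^* * s.
  rewrite -mulmxA.
  have -> : map_mx rc A *m (map_mx Num.conj w)^T = a^* *: (map_mx Num.conj w)^T.
    rewrite -[map_mx rc A]trmxK -trmx_mul map_trmx sA -{1}conjA -map_mxM wA.
    by rewrite -linearZ/= map_mxZ.
  by rewrite -scalemxAr mxE.
by rewrite -E1 -E2.
Qed.

Lemma eigenvalue_rc n (C : 'M[R]_n) (x : R) :
  eigenvalue (map_mx rc C) (rc x) = eigenvalue C x.
Proof. by rewrite !eigenvalue_root_char -map_char_poly fmorph_root. Qed.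

(** [C] is the matrix of [A] on the invariant row space of [B]. Its complex eigenvalues are
    eigenvalues of [A], hence real, and a real eigenvalue of the real matrix [C] has a real
    eigenvector. *)
Lemma symmetric_invariant_eigenvector k n (A : 'M[R]_n) (B : 'M[R]_(k, n)) (C : 'M[R]_k) :
  (0 < k)%N -> A^T = A -> row_free B -> B *m A = C *m B ->
  exists (x : R) (v : 'rV[R]_k), v *m B != 0 /\ v *m B *m A = x *: (v *m B).
Proof.
move=> k0 sA fB BA.
have [a /eigenvalueP[v vC v0]] := eigenvalue_closed (map_mx rc C) k0.
have fB' : row_free (map_mx rc B) by rewrite row_free_map.
have w0 : v *m map_mx rc B != 0.
  by apply: contra v0 => /eqP vB; apply/eqP/(row_free_inj fB'); rewrite vB mul0mx.
have wA : v *m map_mx rc B *m map_mx rc A = a *: (v *m map_mx rc B).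
  by rewrite -mulmxA -map_mxM BA map_mxM mulmxA vC scalemxAl.
have /complex_realP[x ax] := symmetric_eigenvalue_real sA w0 wA.
have : eigenvalue C x by rewrite -eigenvalue_rc -ax; apply/eigenvalueP; exists v.
move=> /eigenvalueP[u uC u0]; exists x, u; split.
  by apply: contra u0 => /eqP uB; apply/eqP/(row_free_inj fB); rewrite uB mul0mx.
by rewrite -mulmxA BA mulmxA uC scalemxAl.
Qed.

(** Induction on the number m of orthonormal eigenvectors, the rows of [W]. Their orthogonal
    complement [kermx W^T] is stable under the symmetric [A] and has rank n - m > 0, so it contains
    one more eigenvector, which is then normalized. *)
Lemma symmetric_partial_diag n (A : 'M[R]_n) m : A^T = A -> (m <= n)%N ->
  exists (W : 'M[R]_(m, n)) (d : 'rV[R]_m), W *m W^T = 1%:M /\ W *m A = diag_mx d *m W.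
Proof.
move=> sA; elim: m => [|m IH] mn.
  by exists 0, 0; split; [apply/matrixP => -[]|rewrite mul0mx mulmx0].
have [W [d [WW WA]]] := IH (ltnW mn).
pose K := kermx W^T.
have rW : \rank W^T = m.
  rewrite mxrank_tr; apply/eqP; rewrite eqn_leq rank_leq_row/=.
  by rewrite -[m in (m <= _)%N](mxrank1 R) -WW mxrankM_maxl.
have rK : (0 < \rank K)%N by rewrite mxrank_ker rW subn_gt0.
have KW : K *m W^T = 0 by rewrite mulmx_ker.
have KA : (row_base K *m A <= row_base K)%MS.
  rewrite -/(stablemx _ _) stablemx_row_base; apply/sub_kermxP.
  have AW : A *m W^T = W^T *m diag_mx d.
    by rewrite -[A in LHS]sA -trmx_mul WA trmx_mul tr_diag_mx.
  by rewrite -mulmxA AW mulmxA KW mul0mx.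
have [C BA] := submxP KA.
have [x [v [u0 uA]]] := symmetric_invariant_eigenvector rK sA (row_base_free K) BA.
set u := v *m row_base K in u0 uA.
have uW : u *m W^T = 0.
  have : (u <= K)%MS by rewrite -(eq_row_base K) submxMl.
  by move=> /submxP[D ->]; rewrite -mulmxA KW mulmx0.
pose s := (u *m u^T) 0 0.
have s0 : 0 < s.
  rewrite lt_neqAle; apply/andP; split.
    rewrite eq_sym; apply: contra u0 => /eqP s0; apply/eqP/dot_eq0.
    by apply/matrixP => i j; rewrite !ord1 [RHS]mxE -s0.
  exact: dot_ge0.
pose w := (Num.sqrt s)^-1 *: u.
have sq0 : Num.sqrt s != 0 by rewrite gt_eqF// sqrtr_gt0.
rewrite -addn1; exists (col_mx W w), (row_mx d (const_mx x)).
have wW : w *m W^T = 0 by rewrite /w -scalemxAl uW scaler0.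
split.
  rewrite tr_col_mx mul_col_row WW wW.
  rewrite (_ : W *m w^T = 0); last by rewrite -[LHS]trmxK trmx_mul trmxK wW trmx0.
  rewrite scalar_mx_block; congr (block_mx _ _ _ _).
  apply/matrixP => i j; rewrite !ord1 /w linearZ/= -scalemxAl -scalemxAr scalerA.
  rewrite mxE -/s [RHS]mxE eqxx -invfM -expr2 sqr_sqrtr ?ltW// mulVf// gt_eqF//.
rewrite mul_col_mx WA /w -scalemxAl uA diag_mx_row mul_block_col !mul0mx addr0 add0r.
by rewrite diag_const_mx mul_scalar_mx !scalerA mulrC.
Qed.

Lemma symmetric_diag n (A : 'M[R]_n) : A^T = A ->
  exists (V : 'M[R]_n) (d : 'rV[R]_n),
    [/\ V *m V^T = 1%:M, V^T *m V = 1%:M & V *m A = diag_mx d *m V].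
Proof.
move=> sA; have [V [d [VV VA]]] := symmetric_partial_diag sA (leqnn n).
by exists V, d; split => //; exact: mulmx1C.
Qed.

End real_symmetric.

(** * Square-integrable functions *)

Fact ip_key : unit. Proof. exact: tt. Qed.

Section sqint.
Context d (T : measurableType d) (R : realType) (mu : {measure set T -> \bar R}).
Implicit Types u v w : T -> R.

Definition rint u := mu.-integrable setT (EFin \o u).

Definition sqint u := measurable_fun setT u /\ rint (fun x => u x ^+ 2).

(* Locked, because unification between two products would otherwise unfold the integrals. *)
Definition ip : (T -> R) -> (T -> R) -> R :=
  locked_with ip_key (fun u v => \int[mu]_x (u x * v x)).

Lemma ipE u v : ip u v = \int[mu]_x (u x * v x).
Proof. by rewrite /ip unlock. Qed.

Lemma rint_meas u : rint u -> measurable_fun setT u.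
Proof. by move=> /integrableP[/measurable_EFinP]. Qed.

Lemma rintD u v : rint u -> rint v -> rint (fun x => u x + v x).
Proof. by move=> iu iv; exact: (integrableD measurableT iu iv). Qed.

Lemma rintZ c u : rint u -> rint (fun x => c * u x).
Proof. by move=> iu; exact: (integrableZl measurableT c iu). Qed.

Lemma rintB u v : rint u -> rint v -> rint (fun x => u x - v x).
Proof. by move=> iu iv; exact: (integrableB measurableT iu iv). Qed.

Lemma rint_le u v : measurable_fun setT u -> rint v ->
  (forall x, `|u x| <= v x) -> rint u.
Proof.
move=> mu' iv uv; apply: (le_integrable measurableT _ _ iv).
  exact/measurable_EFinP.
by move=> x _ /=; rewrite lee_fin (le_trans (uv x))// ler_norm.
Qed.

Lemma rint_ge0P u : measurable_fun setT u -> (forall x, 0 <= u x) ->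
  (\int[mu]_x (u x)%:E < +oo)%E -> rint u.
Proof.
move=> mu' u0 iu; apply/integrableP; split; first exact/measurable_EFinP.
rewrite (eq_integral (fun x => (u x)%:E))// => x _ /=.
by rewrite ger0_norm.
Qed.

Lemma rint_EFin u : rint u -> (\int[mu]_x (u x)%:E)%E = (\int[mu]_x u x)%:E.
Proof.
by move=> iu; rewrite /Rintegral fineK//; exact: integrable_fin_num iu.
Qed.

Lemma rint0 : rint (fun=> 0).
Proof. exact: integrable0. Qed.

Lemma rint_sum (I : Type) (s : seq I) (f : I -> T -> R) :
  (forall i, rint (f i)) -> rint (fun x => \sum_(i <- s) f i x).
Proof.
move=> fi; elim: s => [|i s IH].
  by under eq_fun do rewrite big_nil; exact: rint0.
by under eq_fun do rewrite big_cons; exact: rintD.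
Qed.

Lemma Rint_sum (I : Type) (s : seq I) (f : I -> T -> R) :
  (forall i, rint (f i)) ->
  \int[mu]_x (\sum_(i <- s) f i x) = \sum_(i <- s) \int[mu]_x f i x.
Proof.
move=> fi; elim: s => [|i s IH].
  by under eq_Rintegral do rewrite big_nil; rewrite big_nil Rintegral_cst// mul0r.
under eq_Rintegral do rewrite big_cons.
by rewrite (RintegralD measurableT (fi i) (rint_sum s fi)) big_cons IH.
Qed.

Lemma sqintM u v : sqint u -> sqint v -> rint (fun x => u x * v x).
Proof.
move=> [mu' iu] [mv iv].
apply: (@rint_le _ (fun x => u x ^+ 2 + v x ^+ 2)).
- exact: measurable_funM.
- exact: rintD.
- move=> x; rewrite ler_norml; apply/andP; split; nra.
Qed.

Lemma sqintD u v : sqint u -> sqint v -> sqint (fun x => u x + v x).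
Proof.
move=> su sv; have iuv := sqintM su sv; case: su => mu' iu; case: sv => mv iv.
split; first exact: measurable_funD.
have -> : (fun x => (u x + v x) ^+ 2) =
  (fun x => u x ^+ 2 + (2 * (u x * v x) + v x ^+ 2)).
  by apply/funext => x; ring.
by apply: rintD => //; apply: rintD => //; exact: rintZ.
Qed.

Lemma sqintZ c u : sqint u -> sqint (fun x => c * u x).
Proof.
move=> [mu' iu]; split; first exact: measurable_funM.
under eq_fun do rewrite exprMn; exact: rintZ.
Qed.

Lemma sqintN u : sqint u -> sqint (fun x => - u x).
Proof. by move=> /(sqintZ (-1)); under eq_fun do rewrite mulN1r. Qed.

Lemma sqintB u v : sqint u -> sqint v -> sqint (fun x => u x - v x).
Proof. by move=> su /sqintN; exact: sqintD. Qed.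

Lemma sqint0 : sqint (fun=> 0).
Proof. by split => //; under eq_fun do rewrite expr0n; exact: rint0. Qed.

Lemma sqint_sum (I : Type) (s : seq I) (f : I -> T -> R) :
  (forall i, sqint (f i)) -> sqint (fun x => \sum_(i <- s) f i x).
Proof.
move=> fi; elim: s => [|i s IH].
  by under eq_fun do rewrite big_nil; exact: sqint0.
by under eq_fun do rewrite big_cons; exact: sqintD.
Qed.

Lemma ipC u v : ip u v = ip v u.
Proof. by rewrite !ipE; under eq_Rintegral do rewrite mulrC. Qed.

Lemma ipDl u v w : sqint u -> sqint v -> sqint w ->
  ip (fun x => u x + v x) w = ip u w + ip v w.
Proof.
move=> su sv sw; rewrite !ipE; under eq_Rintegral do rewrite mulrDl.
by rewrite RintegralD//=; exact: sqintM.
Qed.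

Lemma ipZl c u w : sqint u -> sqint w -> ip (fun x => c * u x) w = c * ip u w.
Proof.
move=> su sw; rewrite !ipE; under eq_Rintegral do rewrite -mulrA.
by rewrite RintegralZl//=; exact: sqintM.
Qed.

Lemma ipBl u v w : sqint u -> sqint v -> sqint w ->
  ip (fun x => u x - v x) w = ip u w - ip v w.
Proof.
move=> su sv sw; rewrite !ipE; under eq_Rintegral do rewrite mulrBl.
by rewrite RintegralB//=; exact: sqintM.
Qed.

Lemma ip_suml (I : Type) (s : seq I) (f : I -> T -> R) w :
  (forall i, sqint (f i)) -> sqint w ->
  ip (fun x => \sum_(i <- s) f i x) w = \sum_(i <- s) ip (f i) w.
Proof.
move=> fi sw; rewrite !ipE; under eq_Rintegral do rewrite mulr_suml.
by rewrite Rint_sum; [apply: eq_bigr => i _; rewrite ipE|move=> i; exact: sqintM].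
Qed.

Lemma ip_ge0 u : 0 <= ip u u.
Proof. by rewrite ipE; apply: Rintegral_ge0 => x _; rewrite -expr2 sqr_ge0. Qed.

Lemma ip0l u : ip (fun=> 0) u = 0.
Proof.
rewrite !ipE; under eq_Rintegral do rewrite mul0r.
by rewrite Rintegral_cst// mul0r.
Qed.

Lemma ipD u v : sqint u -> sqint v ->
  ip (fun x => u x + v x) (fun x => u x + v x) = ip u u + 2 * ip u v + ip v v.
Proof.
move=> su sv; rewrite ipDl//; last exact: sqintD.
rewrite [ip u _]ipC [ip v _]ipC !ipDl// [ip v u]ipC; ring.
Qed.

Lemma ipB u v : sqint u -> sqint v ->
  ip (fun x => u x - v x) (fun x => u x - v x) = ip u u - 2 * ip u v + ip v v.
Proof.
move=> su sv; rewrite ipBl//; last exact: sqintB.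
rewrite [ip u _]ipC [ip v _]ipC !ipBl// [ip v u]ipC; ring.
Qed.

Lemma ipD_le u v : sqint u -> sqint v ->
  ip (fun x => u x + v x) (fun x => u x + v x) <= 2 * ip u u + 2 * ip v v.
Proof.
move=> su sv; have := ip_ge0 (fun x => u x - v x).
rewrite ipB// ipD//; lra.
Qed.

Lemma ip_CS u v : sqint u -> sqint v -> ip u v ^+ 2 <= ip u u * ip v v.
Proof.
move=> su sv.
(* This is the nonnegativity of |a u - b v|^2. The weights will be a = <v, v> and b = <u, v>, unless
   <v, v> = 0. *)
have key a b : 0 <= a ^+ 2 * ip u u - 2 * (a * (b * ip u v)) + b ^+ 2 * ip v v.
  have := ip_ge0 (fun x => a * u x - b * v x).
  rewrite ipB; [|exact: sqintZ..].
  have -> : ip (fun x => a * u x) (fun x => a * u x) = a ^+ 2 * ip u u.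
    rewrite ipZl//; last exact: sqintZ.
    by rewrite ipC ipZl// mulrA.
  have -> : ip (fun x => b * v x) (fun x => b * v x) = b ^+ 2 * ip v v.
    rewrite ipZl//; last exact: sqintZ.
    by rewrite ipC ipZl// mulrA.
  rewrite [ip (fun x => a * u x) _]ipZl//; last exact: sqintZ.
  by rewrite ipC ipZl// [ip v u]ipC.
have uu := ip_ge0 u; have vv := ip_ge0 v.
have [v0|v0] := eqVneq (ip v v) 0.
  rewrite v0 mulr0.
  have [->|uv0] := eqVneq (ip u v) 0; first by rewrite expr0n.
  (* With <v, v> = 0 and this weight, [key] would read -1 >= 0. *)
  have := key 1 ((ip u u + 1) / (2 * ip u v)).
  rewrite v0 mulr0 addr0 expr1n mul1r mul1r.
  have -> : 2 * ((ip u u + 1) / (2 * ip u v) * ip u v) = ip u u + 1 by field.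
  lra.
have := key (ip v v) (ip u v).
have vp : 0 < ip v v by rewrite lt_neqAle eq_sym v0.
have -> : ip v v ^+ 2 * ip u u - 2 * (ip v v * (ip u v * ip u v)) + ip u v ^+ 2 * ip v v
  = ip v v * (ip u u * ip v v - ip u v ^+ 2) by ring.
by rewrite pmulr_rge0// subr_ge0.
Qed.

Lemma ip_eq0 u : sqint u -> ip u u = 0 -> {ae mu, forall x, u x = 0}.
Proof.
move=> [mu' iu] u0.
have : (\int[mu]_x `|(u x ^+ 2)%:E| = 0)%E.
  rewrite (eq_integral (fun x => (u x ^+ 2)%:E)); last first.
    by move=> x _; rewrite gee0_abs// lee_fin sqr_ge0.
  by rewrite rint_EFin//; congr EFin; move: u0; rewrite ipE.
have mu2 : measurable_fun setT (fun x => (u x ^+ 2)%:E).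
  by apply/measurable_EFinP; exact: measurable_funX.
move=> /(ae_eq_integral_abs mu measurableT mu2).
apply: filterS => x /(_ I) /eqP; rewrite eqe sqrf_eq0 => /eqP //.
Qed.

Lemma dct (s : nat -> T -> R) u g : (forall k, measurable_fun setT (s k)) ->
  (forall x, s ^~ x @ \oo --> u x) -> rint g ->
  (forall k x, `|s k x| <= g x) ->
  rint u /\ (fun k => \int[mu]_x s k x) @ \oo --> \int[mu]_x u x.
Proof.
move=> ms su ig sg.
have mu' : measurable_fun setT u by exact: measurable_fun_cvg ms (fun x _ => su x).
have [] := @dominated_convergence _ _ _ mu setT measurableT
  (fun k x => (s k x)%:E) (fun x => (u x)%:E) (fun x => (g x)%:E).
- by move=> k; exact/measurable_EFinP.
- exact/measurable_EFinP.
- by apply/aeW => x _; apply: cvg_EFin; [exact: nearW|exact: su].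
- exact: ig.
- by apply/aeW => x k _; rewrite lee_fin.
move=> iu _ /= cv; split; first exact: iu.
by rewrite rint_EFin// in cv; exact: fine_cvg cv.
Qed.

Lemma ip_cvg (s : nat -> T -> R) u v : (forall k, sqint (s k)) -> sqint u ->
  sqint v -> (fun k => ip (fun x => s k x - u x) (fun x => s k x - u x)) @ \oo --> 0 ->
  (fun k => ip (s k) v) @ \oo --> ip u v.
Proof.
move=> ss su sv h; apply/subr_cvg0/norm_cvg0P.
have h2 : (fun k => Num.sqrt (ip (fun x => s k x - u x) (fun x => s k x - u x) * ip v v))
    @ \oo --> 0.
  rewrite -(sqrtr0 R) -[X in Num.sqrt X](mul0r (ip v v)).
  apply: continuous_cvg; first exact: sqrt_continuous.
  by apply: cvgMl.
apply: (squeeze_cvgr _ (cvg_cst 0) h2); apply: nearW => k.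
rewrite normr_ge0/= -ipBl// -sqrtr_sqr ler_wsqrtr// ip_CS//.
exact: sqintB.
Qed.

(** Fatou's lemma applied to the squares; it turns convergence almost everywhere into a norm
    estimate for the limit. *)
Lemma ip_fatou (s : nat -> T -> R) u M : (forall k, sqint (s k)) ->
  (forall k, ip (s k) (s k) <= M) -> measurable_fun setT u ->
  {ae mu, forall x, s ^~ x @ \oo --> u x} ->
  sqint u /\ ip u u <= M.
Proof.
move=> ss sM mu' su.
have F : (\int[mu]_x (u x ^+ 2)%:E <= M%:E)%E.
  have ms k : measurable_fun setT (fun x => (s k x ^+ 2)%:E).
    by apply/measurable_EFinP; apply: measurable_funX; case: (ss k).
  have := fatou mu measurableT ms.
  have le_einf (w : (\bar R)^nat) m : (forall k, w k <= m)%E -> (limn_einf w <= m)%E.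
    move=> wm; rewrite limn_einf_lim; apply: lime_le; first exact: is_cvg_einfs.
    apply: nearW => k; apply: le_trans (wm k).
    by apply: ereal_inf_lbound; exists k => /=.
  move=> /(_ _)/le_trans; rewrite (@ae_eq_integral _ _ _ _ setT
    (fun x => limn_einf (fun k => (s k x ^+ 2)%:E)))//.
  - apply; first by move=> k x _; rewrite lee_fin sqr_ge0.
    apply: le_einf => k; rewrite rint_EFin ?lee_fin; first by move: (sM k); rewrite ipE.
    by case: (ss k).
  - by apply/measurable_EFinP; exact: measurable_funX.
  - have -> : (fun x => limn_einf (fun k => (s k x ^+ 2)%:E)) =
      (fun x => - limn_esup (fun k => - (s k x ^+ 2)%:E))%E.
      by apply/funext => x; rewrite limn_esupN oppeK.
    apply: measurableT_comp => //; apply: measurable_fun_limn_esup => k.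
    exact: measurableT_comp.
  - apply: filterS su => x su _; symmetry.
    apply: (cvg_limn_einf_sup _).1; apply: cvg_EFin; first exact: nearW.
    rewrite (_ : _ \o _ = (fun k => s k x * s k x)); first exact: cvgM.
    by apply/funext => k /=; rewrite expr2.
have iu : rint (fun x => u x ^+ 2).
  apply: rint_ge0P; [exact: measurable_funX|by move=> x; exact: sqr_ge0|].
  by rewrite (le_lt_trans F)// ltry.
by split; [split|rewrite ipE -lee_fin -rint_EFin].
Qed.

(** The Riesz-Fischer argument. Along a subsequence the consecutive differences d_k have squared
    norm at most 4^-k, so the sum of 2^k d_k^2 is integrable, hence finite almost everywhere; there
    the sum of the |d_k| converges too. Fatou's lemma then gives norm convergence of the whole
    sequence to the pointwise limit of the subsequence. *)
Lemma sqint_complete (s : nat -> T -> R) : (forall k, sqint (s k)) ->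
  (forall e : R, 0 < e -> exists M, forall m n, (M <= m)%N -> (M <= n)%N ->
     ip (fun x => s m x - s n x) (fun x => s m x - s n x) <= e) ->
  exists2 u, sqint u &
    (fun k => ip (fun x => s k x - u x) (fun x => s k x - u x)) @ \oo --> 0.
Proof.
move=> ss cau.
have e0 k : 0 < (4^-1 : R) ^+ k by rewrite exprn_gt0.
have /choice[M MP] := fun k => cau _ (e0 k).
(* Summing the thresholds makes [phi] monotone, at least [M k], and at least [k]. *)
pose phi k := (\sum_(i < k.+1) (M i).+1)%N.
have phiM k : (M k <= phi k)%N.
  by rewrite /phi big_ord_recr/= (leq_trans (leqnSn _))// leq_addl.
have phiS k : (phi k <= phi k.+1)%N by rewrite [phi k.+1]/phi big_ord_recr/= leq_addr.
have phi_ge k : (k <= phi k)%N.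
  elim: k => // k IH; rewrite /phi big_ord_recr/= -/(phi k).
  by rewrite (leq_ltn_trans IH)// -addSnnS leq_addr.
pose dd k x := s (phi k.+1) x - s (phi k) x.
have sd k : sqint (dd k) by exact: sqintB.
have nd k : ip (dd k) (dd k) <= 4^-1 ^+ k.
  by apply: MP => //; exact: leq_trans (phiM k) (phiS k).
pose g k x := (2 ^+ k * dd k x ^+ 2)%:E : \bar R.
have g0 k x : (0 <= g k x)%E by rewrite lee_fin mulr_ge0 ?sqr_ge0// exprn_ge0.
have mg k : measurable_fun setT (g k).
  apply/measurable_EFinP; apply: measurable_funM => //.
  by apply: measurable_funX; case: (sd k).
pose hh x := (\sum_(k <oo) g k x)%E.
have mh : measurable_fun setT hh by exact: ge0_emeasurable_sum.
have ih : mu.-integrable setT hh.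
  apply/integrableP; split => //.
  rewrite (eq_integral hh); last first.
    by move=> x _; rewrite gee0_abs// nneseries_ge0.
  rewrite integral_nneseries//.
  apply: (@le_lt_trans _ _ 2%:E); last by rewrite ltry.
  apply: lime_le; first by apply: is_cvg_nneseries => k _ _; exact: integral_ge0.
  apply: nearW => k.
  apply: (@le_trans _ _ (\sum_(0 <= i < k) ((2^-1 : R) ^+ i)%:E)%E).
    apply: lee_sum => i _.
    rewrite (_ : (\int[mu]_x g i x = (2 ^+ i * ip (dd i) (dd i))%:E)%E).
      rewrite lee_fin (le_trans (ler_wpM2l _ (nd i)))// ?exprn_ge0//.
      by rewrite -exprMn (_ : 2 * 4^-1 = 2^-1 :> R)//; field.
    rewrite ipE -RintegralZl//; last by case: (sd i).
    by rewrite -rint_EFin//; apply: rintZ; case: (sd i).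
  rewrite sumEFin lee_fin.
  rewrite (_ : \sum_(0 <= i < k) (2^-1 : R) ^+ i = 2 - 2 * 2^-1 ^+ k).
    by rewrite gerBl mulr_ge0// exprn_ge0.
  elim: k => [|k IH]; first by rewrite big_geq// expr0 mulr1 subrr.
  by rewrite big_nat_recr//= IH exprS; field.
have hfin := integrable_ae measurableT ih.
pose D := [set x | (hh x < +oo)%E].
have mD : measurable D by rewrite -[D]setTI; exact: emeasurable_fun_infty_o.
have cvD x : D x -> cvgn (fun k => s (phi k) x).
  move=> Dx; suff cs : cvgn (series (fun k => dd k x)).
    have -> : (fun k => s (phi k) x) = (fun k => s (phi 0%N) x + series (dd ^~ x) k).
      by apply/funext => k; rewrite /series/= telescope_sumr// addrC subrK.
    by apply: is_cvgD => //; exact: is_cvg_cst.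
  apply: normed_cvg; apply: nondecreasing_is_cvgn.
    by apply: nondecreasing_series => k _ _ /=; exact: normr_ge0.
  exists (2 + fine (hh x)) => _ [k _ <-]; rewrite /series/=.
  (* The inequality t <= 1 + t^2 at t = 2^i |d_i| bounds |d_i| by 2^-i + 2^i d_i^2; the two sums are
     at most 2 and [hh x]. *)
  apply: (@le_trans _ _ (\sum_(0 <= i < k) ((2^-1 : R) ^+ i + 2 ^+ i * dd i x ^+ 2))).
    apply: ler_sum => i _.
    have p2 : 0 < (2 : R) ^+ i by rewrite exprn_gt0.
    rewrite -[dd i x ^+ 2]real_normK ?num_real// exprVn.
    set a := `|_|; set b := 2 ^+ i in p2 *.
    have bV : b^-1 * b = 1 by rewrite mulVf// gt_eqF.
    have -> : a = b^-1 * (b * a) by rewrite mulrA bV mul1r.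
    have -> : b^-1 + b * (b^-1 * (b * a)) ^+ 2 = b^-1 * (1 + (b * a) ^+ 2).
      by field; rewrite gt_eqF.
    rewrite ler_pM2l ?invr_gt0//.
    have := sqr_ge0 (b * a - 1); have := sqr_ge0 (b * a); nra.
  rewrite big_split/= lerD//.
    rewrite (_ : \sum_(0 <= i < k) (2^-1 : R) ^+ i = 2 - 2 * 2^-1 ^+ k).
      by rewrite gerBl mulr_ge0// exprn_ge0.
    elim: k => [|k IH]; first by rewrite big_geq// expr0 mulr1 subrr.
    by rewrite big_nat_recr//= IH exprS; field.
  have hx : hh x \is a fin_num by rewrite ge0_fin_numE// nneseries_ge0.
  rewrite -lee_fin fineK// -sumEFin. have := @nneseries_lim_ge R (g ^~ x) xpredT 0 k; apply => n _ _; exact: g0.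
(* The indicator of [D] makes the limit exist at every point, so that [u] is measurable. *)
pose u x := limn (fun k => s (phi k) x * \1_D x).
have cu x : (fun k => s (phi k) x * \1_D x) @ \oo --> u x.
  rewrite /u indicE; case: (boolP (x \in D)) => xD.
    by apply: is_cvgMl; apply: cvD; rewrite inE in xD.
  by under eq_fun do rewrite mulr0; exact: is_cvg_cst.
have mu' : measurable_fun setT u.
  apply: measurable_fun_cvg (fun x _ => cu x) => k.
  apply: measurable_funM; first by case: (ss (phi k)).
  exact: measurable_indic.
have aeu : {ae mu, forall x, (fun k => s (phi k) x) @ \oo --> u x}.
  apply: filterS hfin => x /(_ I) fx.
  have Dx : D x by rewrite /D/= -ge0_fin_numE// nneseries_ge0.
  have := cu x; rewrite indicE mem_set//.
  by under eq_fun do rewrite mulr1.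
(* Fatou along the subsequence: [s m - s (phi (k + K))] tends to [s m - u] as k grows. *)
have key e : 0 < e -> exists K, forall m, (K <= m)%N ->
    sqint (fun x => s m x - u x) /\ ip (fun x => s m x - u x) (fun x => s m x - u x) <= e.
  move=> ep; have [K KP] := cau e ep; exists K => m Km.
  apply: (@ip_fatou (fun k x => s m x - s (phi (k + K)%N) x)).
  - by move=> k; exact: sqintB.
  - move=> k; apply: KP => //; apply: leq_trans (phi_ge _); exact: leq_addl.
  - by apply: measurable_funB => //; case: (ss m).
  - apply: filterS aeu => x aeu; apply: cvgB; first exact: cvg_cst.
    by rewrite (cvg_shiftn K (fun k => s (phi k) x)).
have su : sqint u.
  have [K /(_ _ (leqnn K))[h _]] := key _ ltr01.
  have := sqintB (ss K) h; congr sqint.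
  by apply/funext => x /=; rewrite opprB addrC subrK.
exists u => //; apply/cvgrPdist_le => e ep.
have [K KP] := key _ ep; near=> k.
rewrite sub0r normrN ger0_norm ?ip_ge0//.
by apply: (KP _ _).2; near: k; exact: nbhs_infty_ge.
Unshelve. all: by end_near. Qed.

(** * Orthogonal systems and Fourier coefficients *)

Section orthogonal_system.
Variable e : nat -> T -> R.
Hypothesis se : forall j, sqint (e j).
Hypothesis orth : forall i j, i != j -> ip (e i) (e j) = 0.

Definition orthosum (c : nat -> R) k x := \sum_(j < k) c j * e j x.

(** The vectors [e j] are not normalized, and some may be null; the coefficient along a null vector
    is 0, by the value of division by zero. *)
Definition fourier u j := ip u (e j) / ip (e j) (e j).

Lemma sqint_orthosum c k : sqint (orthosum c k).
Proof. by apply: sqint_sum => j; exact: sqintZ. Qed.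

Lemma ip_orthosuml c k u : sqint u -> ip (orthosum c k) u = \sum_(j < k) c j * ip (e j) u.
Proof.
move=> su; rewrite ip_suml//; last by move=> j; exact: sqintZ.
by apply: eq_bigr => j _; rewrite ipZl.
Qed.

Lemma ip_orthosum_e c k j : (j < k)%N -> ip (orthosum c k) (e j) = c j * ip (e j) (e j).
Proof.
move=> jk; rewrite ip_orthosuml// (bigD1 (Ordinal jk))//= big1 ?addr0// => i ij.
by rewrite orth ?mulr0.
Qed.

Lemma ip_orthosumB c m k : (m <= k)%N ->
  ip (fun x => orthosum c k x - orthosum c m x) (fun x => orthosum c k x - orthosum c m x) =
  \sum_(m <= j < k) c j ^+ 2 * ip (e j) (e j).
Proof.
move=> mk.
have E : (fun x => orthosum c k x - orthosum c m x) =
    (fun x => \sum_(j <- index_iota m k) c j * e j x).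
  apply/funext => x; rewrite /orthosum -2!(big_mkord xpredT (fun j => c j * e j x)).
  by rewrite (big_cat_nat (leq0n m) mk)//= addrAC subrr add0r.
have sse j : sqint (fun x => c j * e j x) by exact: sqintZ.
rewrite E ip_suml//; last exact: sqint_sum.
rewrite !big_seq; apply: eq_bigr => j; rewrite mem_index_iota => /andP[mj jk].
rewrite ipZl//; last exact: sqint_sum.
rewrite -E ipC ipBl//; [|exact: sqint_orthosum..].
rewrite ip_orthosum_e// (_ : ip (orthosum c m) (e j) = 0) ?subr0; first by ring.
rewrite ip_orthosuml// big1// => i _; rewrite orth ?mulr0//.
by rewrite neq_ltn (leq_trans (ltn_ord i)).
Qed.

Lemma ip_orthosum2 c k : ip (orthosum c k) (orthosum c k) = \sum_(j < k) c j ^+ 2 * ip (e j) (e j).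
Proof.
rewrite -(big_mkord xpredT (fun j => c j ^+ 2 * ip (e j) (e j))) -ip_orthosumB//.
have -> : orthosum c 0 = (fun=> 0) by apply/funext => x; rewrite /orthosum big_ord0.
by under [in RHS]eq_fun do rewrite subr0.
Qed.

Lemma fourierM u j : sqint u -> fourier u j * ip (e j) (e j) = ip u (e j).
Proof.
move=> su; rewrite /fourier; have [n0|n0] := eqVneq (ip (e j) (e j)) 0.
  have := ip_CS su (se j); rewrite n0 !mulr0 => h; apply/esym/eqP.
  by rewrite -sqrf_eq0 eq_le h sqr_ge0.
by rewrite divfK.
Qed.

Lemma bessel u k : sqint u ->
  \sum_(j < k) fourier u j ^+ 2 * ip (e j) (e j) <= ip u u.
Proof.
move=> su; have so := sqint_orthosum (fourier u) k.
have := ip_ge0 (fun x => u x - orthosum (fourier u) k x).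
rewrite ipB// ip_orthosum2 [ip u (orthosum _ _)]ipC ip_orthosuml//.
have -> : \sum_(j < k) fourier u j * ip (e j) u = \sum_(j < k) fourier u j ^+ 2 * ip (e j) (e j).
  by apply: eq_bigr => j _; rewrite ipC -fourierM//; ring.
lra.
Qed.

(** The squared norm of a difference of partial sums is a block of the series of
    [c j ^+ 2 * ip (e j) (e j)], which converges because it is bounded; so the partial sums are
    Cauchy. Coefficients and the norm bound pass to the limit by continuity of the inner product. *)
Lemma orthosum_cvg (c : nat -> R) (M : R) : (forall k, \sum_(j < k) c j ^+ 2 * ip (e j) (e j) <= M) ->
  exists u, [/\ sqint u,
    (fun k => ip (fun x => orthosum c k x - u x) (fun x => orthosum c k x - u x)) @ \oo --> 0,
    forall j, ip u (e j) = c j * ip (e j) (e j) & ip u u <= M].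
Proof.
move=> cM.
pose a j := c j ^+ 2 * ip (e j) (e j).
have a0 j : 0 <= a j by rewrite mulr_ge0 ?sqr_ge0 ?ip_ge0.
have ca : cvgn (series a).
  apply: nondecreasing_is_cvgn; first by apply: nondecreasing_series.
  by exists M => _ [k _ <-]; rewrite /series/= big_mkord.
have [|u su cu] := sqint_complete (sqint_orthosum c).
  move=> eps ep; have /cauchy_cvgP/cauchy_seriesP/(_ _ ep)[[A B] [[K _ KA] [L _ LB]] AB] := ca.
  have main m n : (maxn K L <= m)%N -> (maxn K L <= n)%N -> (m <= n)%N ->
      ip (fun x => orthosum c n x - orthosum c m x) (fun x => orthosum c n x - orthosum c m x) <= eps.
    rewrite !geq_max => /andP[Km Lm] /andP[Kn Ln] mn.
    rewrite ip_orthosumB//; apply/ltW.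
    have := AB (m, n); rewrite /= => /(_ (conj (KA _ Km) (LB _ Ln))).
    by apply: le_lt_trans; exact: ler_norm.
  exists (maxn K L) => m n Km Kn.
  have [mn|/ltnW nm] := leqP m n; last exact: main.
  have := main _ _ Km Kn mn; congr (_ <= _).
  by rewrite !ipE; apply: eq_Rintegral => x _; ring.
have ue j : ip u (e j) = c j * ip (e j) (e j).
  have h := ip_cvg (sqint_orthosum c) su (se j) cu; rewrite -(cvg_lim (@Rhausdorff R) h).
  apply/cvg_lim; first exact: Rhausdorff.
  apply: cvg_near_cst; near=> k; rewrite ip_orthosum_e//.
  by near: k; exact: nbhs_infty_gt.
exists u; split => //.
suff iuo k : ip (orthosum c k) u <= M.
  have := ip_cvg (sqint_orthosum c) su su cu => h; rewrite -(cvg_lim (@Rhausdorff R) h).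
  by apply: limr_le; [exact: cvgP h|exact: nearW].
rewrite ip_orthosuml//; apply: le_trans (cM k); apply: ler_sum => j _.
by rewrite [ip _ u]ipC ue expr2 mulrA.
Unshelve. all: by end_near. Qed.

End orthogonal_system.

End sqint.

(** * Lebesgue measure on row vectors *)

Section rV_analysis.
Variables (R : realType) (n : nat).
Implicit Types (x : 'rV[R]_n) (f g : 'rV[R]_n -> R).

Lemma rV_norm_le x (e : R) : 0 <= e -> (forall i, `|x 0 i| <= e) -> `|x| <= e.
Proof.
move=> e0 xe; rewrite [`|x|]mx_normrE; apply/bigmax_leP; split => // -[i j] _ /=.
by rewrite ord1.
Qed.

Let grid k x : {ffun 'I_n -> int} := [ffun i => Num.floor (k.+1%:R * x 0 i)].

Let of_grid k (z : {ffun 'I_n -> int}) : 'rV[R]_n := \row_i ((z i)%:~R / k.+1%:R).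

Let measurable_grid k (S : set {ffun 'I_n -> int}) : measurable (grid k @^-1` S).
Proof.
rewrite (_ : grid k @^-1` S = \bigcup_m (if unpickle m is Some z then
    if `[< S z >] then \bigcap_i (fun x : 'rV[R]_n => k.+1%:R * x 0 i) @^-1`
         `[(z i)%:~R, (z i + 1)%:~R[%classic else set0 else set0)).
  apply: bigcupT_measurable => m; case: unpickle => // z; case: asboolP => // _.
  apply: fin_bigcap_measurable => [|i _]; first exact: finite_finset.
  rewrite -[X in measurable X]setTI.
  have : measurable_fun setT (fun x : 'rV[R]_n => k.+1%:R * x 0 i).
    by apply: measurable_funM => //; exact: measurable_coord.
  by apply.
apply/seteqP; split => [x Sx|x [m _]].
  exists (pickle (grid k x)) => //; rewrite pickleK; case: asboolP => // _ i _ /=.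
  by rewrite in_itv/= ffunE floor_itv.
case: unpickle => // z; case: asboolP => // Sz zx.
rewrite /= (_ : grid k x = z)//; apply/ffunP => i; rewrite ffunE; apply: floor_def.
by have := zx i I; rewrite /= in_itv.
Qed.

(** The sigma-algebra is the one generated by the coordinates, so continuity has to be related to
    it: [f] is the pointwise limit of its values at the points rounded down to a grid of mesh
    1/(k+1), and those approximations are constant on countably many measurable cells. *)
Lemma continuous_measurable_rV f : continuous f -> measurable_fun setT f.
Proof.
move=> cf; apply: (@measurable_fun_cvg _ _ _ setT (fun k x => f (of_grid k (grid k x)))).
  move=> k _ B mB; rewrite setTI.
  exact: (measurable_grid k ((f \o of_grid k) @^-1` B)).
move=> x _; apply: continuous_cvg; first exact: (cf x).
apply/cvgrPdist_le => e e0; near=> k.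
have h : k.+1%:R^-1 <= e.
  by apply/ltW; near: k; exact: (near_infty_natSinv_lt (PosNum e0)).
apply: (le_trans _ h); apply: rV_norm_le => // i; rewrite !mxE ffunE.
have kp : 0 < k.+1%:R :> R by rewrite ltr0n.
rewrite -(ler_pM2r kp) mulVf ?gt_eqF// -[X in _ * X]gtr0_norm// -normrM mulrBl divfK ?gt_eqF//.
have /andP[h1 h2] := floor_itv (k.+1%:R * x 0 i).
by rewrite mulrC ger0_norm ?subr_ge0//; rewrite intrD in h2; lra.
Unshelve. all: by end_near. Qed.

(** Unlike the maximum norm, this norm makes [expR (- l1 x)] a product over the coordinates,
    integrable by Tonelli. *)
Definition l1 x : R := \sum_i `|x 0 i|.

Lemma l1_ge0 x : 0 <= l1 x. Proof. by apply: sumr_ge0. Qed.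

Lemma l1D x y : l1 (x + y) <= l1 x + l1 y.
Proof. by rewrite -big_split/=; apply: ler_sum => i _; rewrite mxE ler_normD. Qed.

Lemma l1N x : l1 (- x) = l1 x.
Proof. by apply: eq_bigr => i _; rewrite mxE normrN. Qed.

Lemma l1_coord x i : `|x 0 i| <= l1 x.
Proof. by rewrite /l1 (bigD1 i)//= lerDl sumr_ge0. Qed.

Lemma l1_delta i : l1 (delta_mx 0 i) = 1.
Proof.
rewrite /l1 (bigD1 i)//= mxE !eqxx normr1 big1 ?addr0// => j ji.
by rewrite mxE eqxx (negPf ji) normr0.
Qed.

Lemma l1Z a x : l1 (a *: x) = `|a| * l1 x.
Proof. by rewrite mulr_sumr; apply: eq_bigr => i _; rewrite mxE normrM. Qed.

Lemma measurable_l1 : measurable_fun setT l1.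
Proof.
apply: measurable_sum => i; apply: measurableT_comp => //; exact: measurable_coord.
Qed.

(** Decay faster than every exponential, a property that multiplication by functions of exponential
    growth preserves. *)
Definition rapid f := forall a : R, exists C, forall x, `|f x| <= C * expR (- (a * l1 x)).

Lemma rapidD f g : rapid f -> rapid g -> rapid (fun x => f x + g x).
Proof.
move=> rf rg a; have [C fC] := rf a; have [D gD] := rg a.
by exists (C + D) => x; rewrite mulrDl (le_trans (ler_normD _ _))// lerD.
Qed.

Lemma rapid_mul f g : rapid f -> (exists a C, forall x, `|g x| <= C * expR (a * l1 x)) ->
  rapid (fun x => g x * f x).
Proof.
move=> rf [b [D gD]] a; have [C fC] := rf (a + b); exists (D * C) => x.
rewrite normrM (_ : _ * expR _ = (D * expR (b * l1 x)) * (C * expR (- ((a + b) * l1 x)))).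
  by rewrite ler_pM.
by rewrite mulrACA -expRD; congr (_ * expR _); ring.
Qed.

Lemma rapidZ c f : rapid f -> rapid (fun x => c * f x).
Proof.
move=> rf; apply: rapid_mul => //; exists 0, `|c| => x.
by rewrite mul0r expR0 mulr1.
Qed.

Lemma rapidM f g : rapid f -> rapid g -> rapid (fun x => f x * g x).
Proof.
move=> rf rg; apply: rapid_mul => //; have [C fC] := rf 0; exists 0, C => x.
by have := fC x; rewrite !mul0r oppr0.
Qed.

Lemma rapid_sum (I : Type) (s : seq I) (F : I -> 'rV[R]_n -> R) :
  (forall i, rapid (F i)) -> rapid (fun x => \sum_(i <- s) F i x).
Proof.
move=> rF; elim: s => [|i s IH].
  by under eq_fun do rewrite big_nil; move=> a; exists 0 => x; rewrite normr0 mul0r.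
by under eq_fun do rewrite big_cons; exact: rapidD.
Qed.

End rV_analysis.

(** * Tonelli, translation invariance and integrability of exponentials *)

Section lebesgue_rV_theory.
Variable R : realType.
Local Notation mu n := (lebesgue_rV R n).

(** The translated measure gives the intervals ]a, b] their length, and this characterizes Lebesgue
    measure. *)
Lemma lebesgue_translation (c : R) (f : R -> \bar R) : measurable_fun setT f ->
  (forall x, 0 <= f x)%E ->
  (\int[lebesgue_measure]_x f (x + c)%R = \int[lebesgue_measure]_x f x)%E.
Proof.
move=> mf f0.
have ms : measurable_fun [set: measurableTypeR R] (fun x : measurableTypeR R => x + c : measurableTypeR R).
  exact: measurable_funD.
pose nu : {measure set (measurableTypeR R) -> \bar R} :=
  pushforward lebesgue_measure (fun x : measurableTypeR R => x + c : measurableTypeR R).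
rewrite [RHS](eq_measure_integral (nu ms)); last first.
  move=> A mA _; apply: lebesgue_measure_unique => // _ [[a b] _ <-] /=.
  rewrite /nu /= /pushforward.
  rewrite (_ : _ @^-1` _ = `]a - c, b - c]%classic); last first.
    by apply/seteqP; split => x /=; rewrite !in_itv/= ltrBlDr lerBrDr.
  rewrite !lebesgue_measure_itv/= !lte_fin ltrD2r; case: ifP => // _.
  by rewrite -!EFinD; congr EFin; ring.
by rewrite ge0_integral_pushforward.
Qed.

Lemma integral_cons n (f : 'rV[R]_n.+1 -> \bar R) : measurable_fun setT f ->
  (forall x, 0 <= f x)%E ->
  (\int[mu n.+1]_x f x =
   \int[lebesgue_measure]_a \int[mu n]_y f (cons_rV (a, y)))%E.
Proof.
move=> mf f0; rewrite [LHS]ge0_integral_pushforward//=; last exact: measurable_cons_rV.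
rewrite preimage_setT fubini_tonelli1//.
by apply: measurableT_comp => //; exact: measurable_cons_rV.
Qed.

Lemma cons_rVD n (a b : R) (x y : 'rV[R]_n) :
  cons_rV (a + b, x + y) = cons_rV (a, x) + cons_rV (b, y).
Proof.
apply/rowP => i; have [j|] := unliftP ord0 i => ->; rewrite [in RHS]mxE.
  by rewrite !cons_rVS mxE.
by rewrite !cons_rV0.
Qed.

Lemma cons_rV_surj n (x : 'rV[R]_n.+1) : exists p, x = cons_rV p.
Proof.
exists (uncons_rV x); apply/rowP => i; have [j|] := unliftP ord0 i => ->.
  by rewrite cons_rVS mxE.
by rewrite cons_rV0.
Qed.

Lemma measurable_cons_l n (a : R) : measurable_fun setT (fun y : 'rV[R]_n => cons_rV (a, y)).
Proof. by apply: measurableT_comp => //; exact: measurable_cons_rV. Qed.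

Lemma measurable_shift_rV n (c : 'rV[R]_n) : measurable_fun setT (fun x : 'rV[R]_n => x + c).
Proof.
apply/measurable_fun_rVP => i; under eq_fun do rewrite mxE.
by apply: measurable_funD => //; exact: measurable_coord.
Qed.

Lemma integral_translation n (c : 'rV[R]_n) (f : 'rV[R]_n -> \bar R) :
  measurable_fun setT f -> (forall x, 0 <= f x)%E ->
  (\int[mu n]_x f (x + c)%R = \int[mu n]_x f x)%E.
Proof.
elim: n c f => [|n IH] c f mf f0.
  by apply: eq_integral => x _; rewrite (_ : x + c = x)//; apply/rowP => -[].
have mfc : measurable_fun setT (fun x : 'rV[R]_n.+1 => f (x + c)).
  by apply: measurableT_comp => //; exact: measurable_shift_rV.
rewrite !integral_cons//; have [[a c'] ->] := cons_rV_surj c.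
under eq_integral => b _.
  under eq_integral do rewrite -cons_rVD.
  rewrite (IH c' (fun y => f (cons_rV (b + a, y))))//; last first.
    by apply: measurableT_comp => //; exact: measurable_cons_l.
  over.
rewrite (lebesgue_translation a (f := fun b => \int[mu n]_y f (cons_rV (b, y)))%E)//.
  apply: (@measurable_fun_fubini_tonelli_F _ _ _ _ _ (mu n) (f \o @cons_rV R n)).
    by apply: measurableT_comp => //; exact: measurable_cons_rV.
  by move=> x; exact: f0.
by move=> b; exact: integral_ge0.
Qed.

(** By symmetry this is twice the integral over the half-line, where the integrand is the
    exponential density of rate 1. *)
Lemma integral_exp_norm : (\int[lebesgue_measure]_x (expR (- `|x|) : R)%:E < +oo)%E.
Proof.
have c1 : continuous (fun x : R => expR (- `|x|)).
  move=> x; apply: continuous_comp; last exact: continuous_expR.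
  apply: continuousN; exact: norm_continuous.
rewrite ge0_symfun_integralT//; last by move=> x /=; rewrite normrN.
rewrite lte_mul_pinfty// .
apply: (@le_lt_trans _ _ (\int[lebesgue_measure]_x (exponential_pdf (1 : R) x)%:E)%E); last first.
  by rewrite integral_exponential_pdf// ltry.
rewrite integral_mkcond; apply: ge0_le_integral => //.
- by move=> x _; rewrite patchE; case: ifP => // _; rewrite lee_fin expR_ge0.
- apply/measurable_restrict => //=; first by rewrite -set_itvcy.
  apply/measurable_EFinP; apply: measurable_funTS; exact: continuous_measurable_fun.
- by apply/measurable_EFinP; exact: measurable_exponential_pdf.
- move=> x _; rewrite patchE; case: ifP => [|_]; last by rewrite lee_fin exponential_pdf_ge0.
  rewrite inE/= => x0; rewrite lee_fin /exponential_pdf patchE mem_set/= ?in_itv/= ?x0//.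
  by rewrite mul1r mulN1r ger0_norm.
Qed.

Lemma integral_exp_l1 n : (\int[mu n]_x (expR (- l1 x))%:E < +oo)%E.
Proof.
have m1 k : measurable_fun setT (fun x : 'rV[R]_k => (expR (- l1 x))%:E).
  apply/measurable_EFinP; apply: measurableT_comp => //; apply: measurableT_comp => //.
  exact: measurable_l1.
elim: n => [|n IH].
  by rewrite /= integral_dirac ?ltry//; exact: (m1 0%N).
rewrite integral_cons//.
have E a : (\int[mu n]_y (expR (- l1 (cons_rV (a, y))))%:E =
    (expR (- `|a|))%:E * \int[mu n]_y (expR (- l1 y))%:E)%E.
  rewrite -ge0_integralZl ?lee_fin ?expR_ge0//.
  apply: eq_integral => y _.
  have -> : l1 (cons_rV (a, y)) = `|a| + l1 y.
    rewrite /l1 big_ord_recl cons_rV0; congr (_ + _).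
    by apply: eq_bigr => i _; rewrite cons_rVS.
  by rewrite opprD expRD EFinM.
  exact: m1.
under eq_integral do rewrite E.
rewrite ge0_integralZr//; last 2 first.
- apply/measurable_EFinP; apply: measurableT_comp => //; apply: measurableT_comp => //.
- by apply: integral_ge0 => x _; rewrite lee_fin expR_ge0.
apply: lte_mul_pinfty => //; last first.
- rewrite ge0_fin_numE ?integral_exp_norm//; apply: integral_ge0 => x _; by rewrite lee_fin expR_ge0.
- by apply: integral_ge0 => x _; rewrite lee_fin expR_ge0.
Qed.

Lemma rint_exp_l1 n : rint (mu n) (fun x => expR (- l1 x)).
Proof.
apply: rint_ge0P; last exact: integral_exp_l1.
  by do 2 apply: measurableT_comp => //; exact: measurable_l1.
by move=> x; exact: expR_ge0.
Qed.

Lemma rapid_rint n (f : 'rV[R]_n -> R) : measurable_fun setT f -> rapid f -> rint (mu n) f.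
Proof.
move=> mf rf; have [C fC] := rf 1.
apply: (@rint_le _ _ _ _ _ (fun x => C * expR (- l1 x))) => //; last first.
  by move=> x; have := fC x; rewrite mul1r.
apply: rintZ; exact: rint_exp_l1.
Qed.

Lemma rapid_sqint n (f : 'rV[R]_n -> R) : measurable_fun setT f -> rapid f -> sqint (mu n) f.
Proof.
move=> mf rf; split => //; apply: rapid_rint; first exact: measurable_funX.
by under eq_fun do rewrite expr2; exact: rapidM.
Qed.

Lemma Rint_translation n (c : 'rV[R]_n) f : rint (mu n) f ->
  rint (mu n) (fun x => f (x + c)) /\ \int[mu n]_x f (x + c) = \int[mu n]_x f x.
Proof.
move=> intf; have mf := rint_meas intf.
have mfc : measurable_fun setT (fun x : 'rV[R]_n => f (x + c)).
  by apply: measurableT_comp => //; exact: measurable_shift_rV.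
have mE : measurable_fun setT (EFin \o f) by exact/measurable_EFinP.
split.
  move: intf => /integrableP[_ foo]; apply/integrableP; split; first exact/measurable_EFinP.
  rewrite (integral_translation c (f := fun x => `|(f x)%:E|%E))//.
  exact: measurableT_comp.
have Ep := integral_translation c (measurable_funepos mE) (funepos_ge0 _).
have En := integral_translation c (measurable_funeneg mE) (funeneg_ge0 _).
suff E : (\int[mu n]_x (f (x + c))%:E = \int[mu n]_x (f x)%:E)%E by rewrite /Rintegral E.
rewrite [LHS]integralE [RHS]integralE.
have -> : ((fun x => (f (x + c))%:E)^\+ = fun x => (EFin \o f)^\+ (x + c)%R)%E.
  by apply/funext => x; rewrite !funeposE.
have -> : ((fun x => (f (x + c))%:E)^\- = fun x => (EFin \o f)^\- (x + c)%R)%E.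
  by apply/funext => x; rewrite !funenegE.
by rewrite Ep En.
Qed.

End lebesgue_rV_theory.

(** * Complex square-integrable functions through real and imaginary parts *)

Section L2_complex.
Variables (R : realType) (n : nat).
Local Notation mu := (lebesgue_rV R n).
Local Notation Re := (@complex.Re R).
Local Notation Im := (@complex.Im R).
Implicit Types u v f g : 'rV[R]_n -> R[i].

Definition reF u x := Re (u x).
Definition imF u x := Im (u x).
Definition cplx (a b : 'rV[R]_n -> R) : 'rV[R]_n -> R[i] := fun x => a x +i* b x.

Lemma reF_cplx a b : reF (cplx a b) = a. Proof. by []. Qed.
Lemma imF_cplx a b : imF (cplx a b) = b. Proof. by []. Qed.

Lemma reFB u v : reF (fun x => u x - v x) = (fun x => reF u x - reF v x).
Proof. by apply/funext => x; rewrite /reF; case: (u x) => ? ?; case: (v x). Qed.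

Lemma imFB u v : imF (fun x => u x - v x) = (fun x => imF u x - imF v x).
Proof. by apply/funext => x; rewrite /imF; case: (u x) => ? ?; case: (v x). Qed.

Lemma reFD u v : reF (fun x => u x + v x) = (fun x => reF u x + reF v x).
Proof. by apply/funext => x; rewrite /reF; case: (u x) => ? ?; case: (v x). Qed.

Lemma imFD u v : imF (fun x => u x + v x) = (fun x => imF u x + imF v x).
Proof. by apply/funext => x; rewrite /imF; case: (u x) => ? ?; case: (v x). Qed.

Lemma reFZ (z : R[i]) u : reF (fun x => z * u x) = (fun x => Re z * reF u x - Im z * imF u x).
Proof. by apply/funext => x; rewrite /reF /imF; case: z (u x) => ? ? [? ?]. Qed.

Lemma imFZ (z : R[i]) u : imF (fun x => z * u x) = (fun x => Re z * imF u x + Im z * reF u x).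
Proof. by apply/funext => x; rewrite /reF /imF; case: z (u x) => ? ? [? ?]. Qed.

Lemma L2norm_pow u : (L2norm u = (\int[mu]_x (reF u x ^+ 2 + imF u x ^+ 2)%:E) `^ 2^-1)%E.
Proof.
rewrite /L2norm unlock; congr (poweR _ _).
apply: eq_integral => x _ /=; congr EFin.
rewrite powR_mulrn ?normr_ge0// real_normK ?num_real//.
rewrite /ComplexField.Normc.normc /reF /imF; case: (u x) => a b /=.
by rewrite sqr_sqrtr// addr_ge0// sqr_ge0.
Qed.

Lemma L2normE u : sqint mu (reF u) -> sqint mu (imF u) ->
  L2norm u = (Num.sqrt (ip mu (reF u) (reF u) + ip mu (imF u) (imF u)))%:E.
Proof.
move=> [mr ir] [mi ii]; rewrite L2norm_pow rint_EFin; last exact: rintD.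
rewrite !ipE RintegralD//= powR12_sqrt//.
by apply: addr_ge0; apply: Rintegral_ge0 => x _; exact: sqr_ge0.
Qed.

Lemma L2P u : L2 u <-> sqint mu (reF u) /\ sqint mu (imF u).
Proof.
split=> [[mr mi n2]|[sr si]].
  have h : rint mu (fun x => reF u x ^+ 2 + imF u x ^+ 2).
    apply: rint_ge0P.
    - by apply: measurable_funD; exact: measurable_funX.
    - by move=> x; rewrite addr_ge0// sqr_ge0.
    - move: n2; rewrite L2norm_pow => /(lty_poweRy _); apply.
      by rewrite invr_eq0 pnatr_eq0.
  split; split => //; apply: (rint_le _ h) => [|x].
  - exact: measurable_funX.
  - by rewrite ger0_norm ?sqr_ge0// lerDl sqr_ge0.
  - exact: measurable_funX.
  - by rewrite ger0_norm ?sqr_ge0// lerDr sqr_ge0.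
split; [by case: sr|by case: si|by rewrite L2normE// ltry].
Qed.

Lemma L2norm_cvg0P (s : nat -> 'rV[R]_n -> R[i]) : (forall k, L2 (s k)) ->
  (fun k => L2norm (s k)) @ \oo --> 0%E <->
  (fun k => ip mu (reF (s k)) (reF (s k)) + ip mu (imF (s k)) (imF (s k))) @ \oo --> 0.
Proof.
move=> Ls; rewrite (_ : (fun k => L2norm _) = (fun k =>
  (Num.sqrt (ip mu (reF (s k)) (reF (s k)) + ip mu (imF (s k)) (imF (s k))))%:E)); last first.
  by apply/funext => k; have /L2P[sr si] := Ls k; rewrite L2normE.
split=> h.
- have {}h : (fun k => Num.sqrt (ip mu (reF (s k)) (reF (s k)) + ip mu (imF (s k)) (imF (s k)))) @ \oo --> 0.
    exact: (fine_cvg h).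
  have E : (fun k => ip mu (reF (s k)) (reF (s k)) + ip mu (imF (s k)) (imF (s k))) =
    (fun k => Num.sqrt (ip mu (reF (s k)) (reF (s k)) + ip mu (imF (s k)) (imF (s k))) *
      Num.sqrt (ip mu (reF (s k)) (reF (s k)) + ip mu (imF (s k)) (imF (s k)))).
    by apply/funext => k; rewrite -expr2 sqr_sqrtr// addr_ge0// ip_ge0.
  by rewrite E -(mulr0 0); exact: cvgM.
- apply: cvg_EFin; first exact: nearW.
  rewrite -(sqrtr0 R); apply: continuous_cvg => //; exact: sqrt_continuous.
Qed.

Lemma L2norm_cvg_reim (s : nat -> 'rV[R]_n -> R[i]) : (forall k, L2 (s k)) ->
  (fun k => L2norm (s k)) @ \oo --> 0%E ->
  (fun k => ip mu (reF (s k)) (reF (s k))) @ \oo --> 0 /\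
  (fun k => ip mu (imF (s k)) (imF (s k))) @ \oo --> 0.
Proof.
move=> Ls /(L2norm_cvg0P Ls) h; split; apply: (squeeze_cvgr _ (cvg_cst 0) h); apply: nearW => k.
  by rewrite ip_ge0/= lerDl ip_ge0.
by rewrite ip_ge0/= lerDr ip_ge0.
Qed.

Lemma L2norm_reim_cvg (s : nat -> 'rV[R]_n -> R[i]) : (forall k, L2 (s k)) ->
  (fun k => ip mu (reF (s k)) (reF (s k))) @ \oo --> 0 ->
  (fun k => ip mu (imF (s k)) (imF (s k))) @ \oo --> 0 ->
  (fun k => L2norm (s k)) @ \oo --> 0%E.
Proof. by move=> Ls hr hi; apply/L2norm_cvg0P => //; rewrite -(addr0 0); exact: cvgD. Qed.

Lemma L2B u v : L2 u -> L2 v -> L2 (fun x => u x - v x).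
Proof.
move=> /L2P[ur ui] /L2P[vr vi]; apply/L2P; rewrite reFB imFB.
by split; exact: sqintB.
Qed.

Lemma L2D u v : L2 u -> L2 v -> L2 (fun x => u x + v x).
Proof.
move=> /L2P[ur ui] /L2P[vr vi]; apply/L2P; rewrite reFD imFD.
by split; exact: sqintD.
Qed.

Lemma L2Z (z : R[i]) u : L2 u -> L2 (fun x => z * u x).
Proof.
move=> /L2P[ur ui]; apply/L2P; rewrite reFZ imFZ; split.
  by apply: sqintB; exact: sqintZ.
by apply: sqintD; exact: sqintZ.
Qed.

Lemma aeeqP u v : {ae mu, forall x, reF u x = reF v x} ->
  {ae mu, forall x, imF u x = imF v x} -> aeeq u v.
Proof.
move=> hr hi; apply: filterS2 hr hi => x; rewrite /reF /imF.
by case: (u x) => ? ?; case: (v x) => ? ? /= -> ->.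
Qed.

End L2_complex.

Section L2_limits.
Context d (T : measurableType d) (R : realType) (mu : {measure set T -> \bar R}).
Implicit Types (s t : nat -> T -> R) (u v : T -> R).

Definition sqnorm u := ip mu u u.

Lemma n2Z c u : sqint mu u -> sqnorm (fun x => c * u x) = c ^+ 2 * sqnorm u.
Proof.
by move=> su; rewrite /sqnorm ipZl ?(ipC mu u) ?ipZl//; [ring|exact: sqintZ].
Qed.

Lemma n2_cvgD s t : (forall k, sqint mu (s k)) -> (forall k, sqint mu (t k)) ->
  (fun k => sqnorm (s k)) @ \oo --> 0 -> (fun k => sqnorm (t k)) @ \oo --> 0 ->
  (fun k => sqnorm (fun x => s k x + t k x)) @ \oo --> 0.
Proof.
move=> ss st hs ht.
have h : (fun k => 2 * sqnorm (s k) + 2 * sqnorm (t k)) @ \oo --> 0.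
  have -> : 0 = 2 * 0 + 2 * 0 :> R by rewrite !mulr0 addr0.
  by apply: cvgD; exact: cvgMr.
apply: (squeeze_cvgr _ (cvg_cst 0) h); apply: nearW => k.
by rewrite ip_ge0/=; exact: ipD_le.
Qed.

Lemma n2_cvgZ c s : (forall k, sqint mu (s k)) ->
  (fun k => sqnorm (s k)) @ \oo --> 0 -> (fun k => sqnorm (fun x => c * s k x)) @ \oo --> 0.
Proof.
move=> ss hs; rewrite (_ : (fun k => _) = (fun k => c ^+ 2 * sqnorm (s k))).
  by rewrite -(mulr0 (c ^+ 2)); exact: cvgMr.
by apply/funext => k; exact: n2Z.
Qed.

Lemma n2_ae u v : measurable_fun setT u -> measurable_fun setT v ->
  {ae mu, forall x, u x = v x} -> sqnorm u = sqnorm v.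
Proof.
move=> mu' mv uv; rewrite /sqnorm !ipE /Rintegral; congr fine; apply: ae_eq_integral => //.
- by apply/measurable_EFinP; exact: measurable_funM.
- by apply/measurable_EFinP; exact: measurable_funM.
- by apply: filterS uv => x -> _.
Qed.

End L2_limits.

(** * Closed operators diagonal in a complete orthogonal system *)

Section diagonal_operator.
Variables (R : realType) (n : nat) (T : operator R n).
Variables (psi : nat -> 'rV[R]_n -> R) (lam : nat -> R).
Local Notation mu := (lebesgue_rV R n).
Local Notation Re := (@complex.Re R).
Local Notation Im := (@complex.Im R).
Local Notation osum := (orthosum psi).
Local Notation coef := (fourier mu psi).
Local Notation ip := (ip mu).
Local Notation n2 := (sqnorm mu).

Hypothesis spsi : forall j, sqint mu (psi j).
Hypothesis orth : forall i j, i != j -> ip (psi i) (psi j) = 0.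
Hypothesis complete : forall u, sqint mu u -> (forall j, ip u (psi j) = 0) ->
  {ae mu, forall x, u x = 0}.
(** Below each level only finitely many indices carry a nonzero mode. The conclusion is
    [psi j = fun=> 0] because some natural numbers will enumerate no eigenfunction. *)
Hypothesis lam_oo : forall L, exists M, forall j, (M <= j)%N -> lam j <= L -> psi j = fun=> 0.
Hypothesis T_L2 : forall u f, T u f -> L2 u /\ L2 f.
(** This restricts the graph of [T] from above: with completeness, [T] acts diagonally on its whole
    domain. [T_psi] and [T_closed] fill the graph from below. *)
Hypothesis T_coef : forall u f, T u f -> forall j,
  ip (reF f) (psi j) = lam j * ip (reF u) (psi j) /\
  ip (imF f) (psi j) = lam j * ip (imF u) (psi j).
Hypothesis T_psi : forall (a b : nat -> R) k, T (cplx (osum a k) (osum b k))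
  (cplx (osum (fun j => lam j * a j) k) (osum (fun j => lam j * b j) k)).
Hypothesis T_closed : forall us fs u f, (forall k, T (us k) (fs k)) -> L2 u -> L2 f ->
  (fun k => L2norm (fun x => us k x - u x)) @ \oo --> 0%E ->
  (fun k => L2norm (fun x => fs k x - f x)) @ \oo --> 0%E -> T u f.

Let nz j := n2 (psi j) != 0.

Let dist2 (z : R[i]) j := (lam j - Re z) ^+ 2 + Im z ^+ 2.

Lemma ip_null u j : sqint mu u -> ~~ nz j -> ip u (psi j) = 0.
Proof.
rewrite negbK => su /eqP n0; have := ip_CS su (spsi j).
rewrite -/(n2 (psi j)) n0 mulr0 => h; apply/eqP.
by rewrite -sqrf_eq0 eq_le h sqr_ge0.
Qed.

(** By Bessel's inequality the Fourier series converges to some v with the same coefficients as u;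
    then v - u is orthogonal to the whole system, hence null. *)
Lemma expansion u : sqint mu u ->
  (fun k => n2 (fun x => osum (coef u) k x - u x)) @ \oo --> 0.
Proof.
move=> su; have [v [sv cv vc _]] := orthosum_cvg spsi orth (fun k => bessel spsi orth k su).
have uv : {ae mu, forall x, v x - u x = 0}.
  apply: complete; first exact: sqintB.
  by move=> j; rewrite ipBl// vc fourierM// subrr.
rewrite (_ : (fun k => _) = (fun k => n2 (fun x => osum (coef u) k x - v x)))//.
apply/funext => k; apply: n2_ae.
- by case: (sqintB (sqint_orthosum spsi (coef u) k) su).
- by case: (sqintB (sqint_orthosum spsi (coef u) k) sv).
- by apply: filterS uv => x /eqP; rewrite subr_eq0 => /eqP ->.
Qed.

Lemma dist2_gt0 z j : z <> (lam j)%:C -> 0 < dist2 z j.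
Proof.
move=> zl; rewrite /dist2 lt_neqAle eq_sym addr_ge0 ?sqr_ge0// andbT.
rewrite paddr_eq0 ?sqr_ge0// !sqrf_eq0 subr_eq0; apply/negP => /andP[/eqP E1 /eqP E2].
by apply: zl; case: z E1 E2 => a b /= -> ->.
Qed.

(** All but finitely many nonzero modes have eigenvalue above Re z + 1, hence at distance at least 1
    from z; the remaining finitely many distances have a positive minimum. *)
Lemma dist2_bound z : exists2 e, 0 < e &
  forall j, nz j -> z <> (lam j)%:C -> e <= dist2 z j.
Proof.
have [M MP] := lam_oo (Re z + 1).
have [e e0 eP] : exists2 e : R, 0 < e & forall j, (j < M)%N -> z <> (lam j)%:C -> e <= dist2 z j.
  elim: M {MP} => [|M [e e0 eP]]; first by exists 1.
  have [E|/eqP NE] := eqVneq z (lam M)%:C.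
    exists e => // j; rewrite ltnS leq_eqVlt => /predU1P[->//|]; exact: eP.
  exists (Num.min e (dist2 z M)); first by rewrite lt_min e0 dist2_gt0.
  move=> j; rewrite ltnS leq_eqVlt => /predU1P[-> _|jM zj]; first by rewrite ge_min lexx orbT.
  by rewrite ge_min eP.
exists (Num.min e 1); first by rewrite lt_min e0 ltr01.
move=> j nzj zj; have [Mj|jM] := leqP M j; last by rewrite ge_min eP.
rewrite ge_min; apply/orP; right.
have : ~~ (lam j <= Re z + 1).
  apply: contra nzj => /(MP _ Mj) E; rewrite /sqnorm E; apply/eqP; exact: ip0l.
rewrite -ltNge /dist2 => h; have := sqr_ge0 (Im z); nra.
Qed.

Lemma op_shift_coef z u f j : op_shift T z u f ->
  [/\ L2 u, L2 f, ip (reF f) (psi j) = (lam j - Re z) * ip (reF u) (psi j) + Im z * ip (imF u) (psi j) &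
   ip (imF f) (psi j) = (lam j - Re z) * ip (imF u) (psi j) - Im z * ip (reF u) (psi j)].
Proof.
rewrite /op_shift => Tu; have [Lu Lg] := T_L2 Tu.
have Lf : L2 f.
  have := L2B Lg (L2Z z Lu); congr L2; apply/funext => x; by rewrite addrK.
have /L2P[sr si] := Lu; have /L2P[fr fi] := Lf.
have [] := T_coef Tu j; rewrite reFD imFD reFZ imFZ.
have z1 := sqintZ (Re z) sr; have z2 := sqintZ (Im z) si.
have z3 := sqintZ (Re z) si; have z4 := sqintZ (Im z) sr.
rewrite (ipDl fr (sqintB z1 z2) (spsi j)) (ipBl z1 z2 (spsi j)).
rewrite (ipDl fi (sqintD z3 z4) (spsi j)) (ipDl z3 z4 (spsi j)) !ipZl//.
by move=> h1 h2; split => //; [rewrite mulrBl -h1; ring|rewrite mulrBl -h2; ring].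
Qed.

(** The complex division (p + iq) / (l - z) with z = x + iy, written out: a + ib is the quotient and
    D = |l - z|^2. *)
Lemma resolvent_coef (l x y p q D : R) (a := (p * (l - x) - q * y) / D)
    (b := (q * (l - x) + p * y) / D) : D = (l - x) ^+ 2 + y ^+ 2 -> D != 0 ->
  [/\ l * a = p + (x * a - y * b), l * b = q + (x * b + y * a) &
   a ^+ 2 + b ^+ 2 = D^-1 * (p ^+ 2 + q ^+ 2)].
Proof.
rewrite /a /b => -> d0; split; field => //.
Qed.

(** In real form: (l - z)(p + iq) = 0 and l - z nonzero imply p + iq = 0. *)
Lemma resolvent_kernel (l x y p q : R) : (l - x) ^+ 2 + y ^+ 2 != 0 ->
  (l - x) * p + y * q = 0 -> (l - x) * q - y * p = 0 -> p = 0 /\ q = 0.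
Proof.
move=> d0 h1 h2; split; apply: (mulfI d0).
  transitivity ((l - x) * ((l - x) * p + y * q) - y * ((l - x) * q - y * p)); first by ring.
  by rewrite h1 h2 !mulr0 subrr.
transitivity ((l - x) * ((l - x) * q - y * p) + y * ((l - x) * p + y * q)); first by ring.
by rewrite h1 h2 !mulr0 addr0.
Qed.

Lemma op_shift_inj z u v f : (forall j, nz j -> z <> (lam j)%:C) ->
  op_shift T z u f -> op_shift T z v f -> aeeq u v.
Proof.
move=> zn Tu Tv.
have [Lu _ _ _] := op_shift_coef 0 Tu; have [Lv _ _ _] := op_shift_coef 0 Tv.
have /L2P[ur ui] := Lu; have /L2P[vr vi] := Lv.
have main j : ip (fun x => reF u x - reF v x) (psi j) = 0 /\
    ip (fun x => imF u x - imF v x) (psi j) = 0.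
  have [nzj|nzj] := boolP (nz j); last by split; apply: ip_null => //; exact: sqintB.
  have [_ _ A1 A2] := op_shift_coef j Tu; have [_ _ B1 B2] := op_shift_coef j Tv.
  rewrite !ipBl//; apply: (@resolvent_kernel (lam j) (Re z) (Im z)).
  - by rewrite gt_eqF//; exact: (dist2_gt0 (zn _ nzj)).
  - by rewrite !mulrBr addrACA -opprD -A1 -B1 subrr.
  - set l := lam j - Re z; set y := Im z.
    transitivity ((l * ip (imF u) (psi j) - y * ip (reF u) (psi j)) -
      (l * ip (imF v) (psi j) - y * ip (reF v) (psi j))); first by ring.
    by rewrite -A2 -B2 subrr.
apply: aeeqP.
  have : {ae mu, forall x, reF u x - reF v x = 0}.
    by apply: complete; [exact: sqintB|by move=> j; exact: (main j).1].
  by apply: filterS => x /eqP; rewrite subr_eq0 => /eqP.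
have : {ae mu, forall x, imF u x - imF v x = 0}.
  by apply: complete; [exact: sqintB|by move=> j; exact: (main j).2].
by apply: filterS => x /eqP; rewrite subr_eq0 => /eqP.
Qed.

(** The coefficients of u are those of f divided by lam j - z, square-summable because |lam j - z|^2
    >= e. Finite partial sums lie in the domain by [T_psi], and [T_closed] gives the limit. Real and
    imaginary parts are each bounded by the full right-hand side, whence the factor 2. *)
Lemma op_shift_surj z e f : 0 < e -> (forall j, nz j -> e <= dist2 z j) -> L2 f ->
  exists2 u, op_shift T z u f &
    n2 (reF u) + n2 (imF u) <= 2 / e * (n2 (reF f) + n2 (imF f)).
Proof.
move=> e0 eP Lf; have /L2P[fr fi] := Lf.
pose x := Re z; pose y := Im z.
pose al := coef (reF f); pose be := coef (imF f).
pose a j := (al j * (lam j - x) - be j * y) / dist2 z j.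
pose b j := (be j * (lam j - x) + al j * y) / dist2 z j.
(* On null modes the coefficients of f are 0, so [a] and [b] vanish there whatever [dist2 z j]
   is. *)
have nz0 j : ~~ nz j -> al j = 0 /\ be j = 0.
  by rewrite negbK => /eqP n0; rewrite /al /be /fourier -/(n2 _) n0 invr0 !mulr0.
have key j (nzj : nz j) : [/\ lam j * a j = al j + (x * a j - y * b j),
    lam j * b j = be j + (x * b j + y * a j) &
    a j ^+ 2 + b j ^+ 2 = (dist2 z j)^-1 * (al j ^+ 2 + be j ^+ 2)].
  apply: (@resolvent_coef (lam j) x y (al j) (be j) (dist2 z j) erefl).
  by rewrite gt_eqF// (lt_le_trans e0)// eP.
have lama j : lam j * a j = al j + (x * a j - y * b j).
  have [/key[]//|/nz0[a0 b0]] := boolP (nz j).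
  by rewrite /a /b a0 b0; ring.
have lamb j : lam j * b j = be j + (x * b j + y * a j).
  have [/key[]//|/nz0[a0 b0]] := boolP (nz j).
  by rewrite /a /b a0 b0; ring.
have ab j : (a j ^+ 2 + b j ^+ 2) * n2 (psi j) <= e^-1 * (al j ^+ 2 * n2 (psi j) + be j ^+ 2 * n2 (psi j)).
  have [nzj|] := boolP (nz j); last by rewrite negbK => /eqP ->; rewrite !mulr0 addr0 mulr0.
  have [_ _ ->] := key _ nzj; have h := eP _ nzj.
  rewrite -mulrDl mulrA ler_wpM2r ?ip_ge0// ler_wpM2r ?addr_ge0 ?sqr_ge0//.
  by rewrite lef_pV2// posrE ?(lt_le_trans e0).
set F := n2 (reF f) + n2 (imF f).
have F0 : 0 <= F by rewrite addr_ge0// ip_ge0.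
have abF k : \sum_(j < k) (a j ^+ 2 + b j ^+ 2) * n2 (psi j) <= e^-1 * F.
  apply: (le_trans (ler_sum _ (fun (j : 'I_k) _ => ab j))).
  rewrite -mulr_sumr ler_pM2l ?invr_gt0// big_split/= lerD//; exact: bessel.
have aF k : \sum_(j < k) a j ^+ 2 * n2 (psi j) <= e^-1 * F.
  apply: le_trans (abF k); apply: ler_sum => j _.
  by rewrite ler_wpM2r ?ip_ge0// lerDl sqr_ge0.
have bF k : \sum_(j < k) b j ^+ 2 * n2 (psi j) <= e^-1 * F.
  apply: le_trans (abF k); apply: ler_sum => j _.
  by rewrite ler_wpM2r ?ip_ge0// lerDr sqr_ge0.
have [u1 [su1 cu1 _ nu1]] := orthosum_cvg spsi orth aF.
have [u2 [su2 cu2 _ nu2]] := orthosum_cvg spsi orth bF.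
have so c k : sqint mu (osum c k) by exact: sqint_orthosum.
have Lu : L2 (cplx u1 u2) by exact/L2P.
exists (cplx u1 u2); last first.
  rewrite reF_cplx imF_cplx mulrAC; apply: (le_trans (lerD nu1 nu2)).
  by rewrite le_eqVlt; apply/orP; left; apply/eqP; ring.
apply: (T_closed (fun k => T_psi a b k)) => //.
- by apply: L2D => //; exact: L2Z.
- apply: L2norm_reim_cvg.
  + by move=> k; apply: L2B => //; apply/L2P; split; exact: so.
  + by under eq_fun do rewrite reFB.
  + by under eq_fun do rewrite imFB.
- apply: L2norm_reim_cvg.
  + move=> k; apply: L2B; first by apply/L2P; split; exact: so.
    by apply: L2D => //; exact: L2Z.
  (* Since lam_j a_j = al_j + x a_j - y b_j, the image of a partial sum splits into a partial sum of
     f plus z times the partial sum of u, and each of these converges; the growth of lam_j does not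
     enter. *)
  + rewrite (_ : (fun k => _) = (fun k => n2 (fun t => (osum al k t - reF f t) +
        (x * (osum a k t - u1 t) + (- y) * (osum b k t - u2 t))))).
      apply: n2_cvgD; [by move=> k; exact: sqintB| |exact: expansion|].
        by move=> k; apply: sqintD; apply: sqintZ; exact: sqintB.
      apply: n2_cvgD; [by move=> k; apply: sqintZ; exact: sqintB..| |];
        by apply: n2_cvgZ => // k; exact: sqintB.
    apply/funext => k; rewrite reFB reFD reFZ; congr (n2 _); apply/funext => t.
    rewrite (_ : reF (cplx _ _) t = osum al k t + (x * osum a k t - y * osum b k t)).
      by rewrite /reF /imF /cplx /= -/x -/y; ring.
    rewrite /reF /cplx /= /orthosum !mulr_sumr -sumrB -big_split/=.
    by apply: eq_bigr => j _; rewrite lama; ring.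
  + rewrite (_ : (fun k => _) = (fun k => n2 (fun t => (osum be k t - imF f t) +
        (x * (osum b k t - u2 t) + y * (osum a k t - u1 t))))).
      apply: n2_cvgD; [by move=> k; exact: sqintB| |exact: expansion|].
        by move=> k; apply: sqintD; apply: sqintZ; exact: sqintB.
      apply: n2_cvgD; [by move=> k; apply: sqintZ; exact: sqintB..| |];
        by apply: n2_cvgZ => // k; exact: sqintB.
    apply/funext => k; rewrite imFB imFD imFZ; congr (n2 _); apply/funext => t.
    rewrite (_ : imF (cplx _ _) t = osum be k t + (x * osum b k t + y * osum a k t)).
      by rewrite /reF /imF /cplx /= -/x -/y; ring.
    rewrite /imF /cplx /= /orthosum !mulr_sumr -!big_split/=.
    by apply: eq_bigr => j _; rewrite lamb; ring.
Qed.

Lemma resolvent_off_spectrum z : (forall j, nz j -> z <> (lam j)%:C) -> resolvent_set T z.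
Proof.
move=> zn; have [e e0 eP] := dist2_bound z.
have surj f : L2 f -> exists2 u, op_shift T z u f &
    n2 (reF u) + n2 (imF u) <= 2 / e * (n2 (reF f) + n2 (imF f)).
  by apply: op_shift_surj => // j nzj; apply: eP => //; exact: zn.
split.
- by move=> u v f; exact: op_shift_inj.
- by move=> f /surj[u Tu _]; exists u.
- exists (Num.sqrt (2 / e)) => u f Tu.
  have [Lu Lf _ _] := op_shift_coef 0 Tu.
  (* The bound is known for the solution [v] just constructed; injectivity transfers it to [u]. *)
  have [v Tv nv] := surj f Lf; have [Lv _ _ _] := op_shift_coef 0 Tv.
  have uv := op_shift_inj zn Tu Tv.
  have /L2P[ur ui] := Lu; have /L2P[vr vi] := Lv; have /L2P[fr fi] := Lf.
  rewrite (L2normE ur ui) (L2normE fr fi) -EFinM lee_fin -sqrtrM; last by rewrite divr_ge0// ltW.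
  apply: ler_wsqrtr.
  apply: le_trans nv; rewrite le_eqVlt; apply/orP; left; apply/eqP; congr (_ + _).
    apply: n2_ae; [by case: ur|by case: vr|].
    by apply: filterS uv => t; rewrite /reF => ->.
  apply: n2_ae; [by case: ui|by case: vi|].
  by apply: filterS uv => t; rewrite /imF => ->.
Qed.

Lemma T_zero : T (fun=> 0) (fun=> 0).
Proof.
have := T_psi (fun=> 0) (fun=> 0) 0; congr T; apply/funext => x;
  by rewrite /cplx /orthosum !big_ord0.
Qed.

Lemma T_psi1 j : T (cplx (psi j) (fun=> 0)) (fun x => (lam j)%:C * cplx (psi j) (fun=> 0) x).
Proof.
have E (c : nat -> R) : osum (fun i => c i * (i == j)%:R) j.+1 = fun x => c j * psi j x.
  apply/funext => x; rewrite /orthosum big_ord_recr/= eqxx mulr1 big1 ?add0r// => i _.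
  by rewrite ltn_eqF ?mulr0 ?mul0r.
have E0 (c : nat -> R) : osum (fun i => c i * 0) j.+1 = fun=> 0.
  by apply/funext => x; rewrite /orthosum big1// => i _; rewrite mulr0 mul0r.
have := T_psi (fun i => 1 * (i == j)%:R) (fun i => 1 * 0) j.+1.
rewrite E E0; under [X in T _ (cplx (orthosum _ X _) _)]eq_fun do rewrite mul1r.
rewrite E; under [X in T _ (cplx _ (orthosum _ X _))]eq_fun do rewrite mul1r.
rewrite E0; congr T; apply/funext => x; first by rewrite /cplx mul1r.
rewrite /cplx; apply/eqP; rewrite eq_complex/=; apply/andP; split; apply/eqP; ring.
Qed.

Lemma psi_eigenvalue j : nz j -> Defs.eigenvalue T (lam j)%:C.
Proof.
move=> nzj; exists (cplx (psi j) (fun=> 0)); first exact: T_psi1.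
move=> h; move/negP: nzj; apply; apply/eqP.
rewrite -(ip0l mu (fun=> 0)); apply: n2_ae => //; first by case: (spsi j).
by apply: filterS h => x [].
Qed.

(** The eigenfunction and 0 have the same image under T - z, against injectivity. *)
Lemma eigenvalue_spectrum z : Defs.eigenvalue T z -> spectrum T z.
Proof.
move=> [u Tu u0] [inj _ _]; apply: u0; apply: (inj _ _ (fun=> 0)).
  by move: Tu; rewrite /op_shift /Defs.eigenspace/=; congr T; apply/funext => x; rewrite add0r.
by rewrite /op_shift; have := T_zero; congr T; apply/funext => x; rewrite mulr0 addr0.
Qed.

Lemma diagonal_spectrum : spectrum T = [set (lam j)%:C | j in [set j | nz j]].
Proof.
apply/seteqP; split => [z sz|_ [j nzj <-]].
  apply: contrapT => zn; apply: sz; apply: resolvent_off_spectrum => j nzj E.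
  by apply: zn; exists j.
by apply: eigenvalue_spectrum; exact: psi_eigenvalue.
Qed.

(** An eigenfunction for [lam j0] has zero coefficients on the modes of every other eigenvalue, and
    [lam_oo] confines the nonzero modes of eigenvalue [lam j0] to indices below M. The indices below
    M with another eigenvalue receive the zero function. *)
Lemma psi_finite_multiplicity j0 : finite_multiplicity T (lam j0)%:C.
Proof.
have [M MP] := lam_oo (lam j0).
exists M, (fun k => if lam k == lam j0 then cplx (psi k) (fun=> 0) else fun=> 0); split.
  move=> k; case: eqP => [E|_]; first by rewrite -E; exact: T_psi1.
  by rewrite /Defs.eigenspace/=; have := T_zero; congr T; apply/funext => x; rewrite mulr0.
move=> u; rewrite /Defs.eigenspace/= => Tu.
have [Lu _] := T_L2 Tu; have /L2P[ur ui] := Lu.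
exists (fun k => coef (reF u) k +i* coef (imF u) k).
pose a (w : 'rV[R]_n -> R) k := if lam k == lam j0 then coef w k else 0.
have main w : sqint mu w -> (forall j, lam j0 * ip w (psi j) = lam j * ip w (psi j)) ->
    {ae mu, forall x, w x = osum (a w) M x}.
  move=> sw wj; have so := sqint_orthosum spsi (a w) M.
  suff : {ae mu, forall x, w x - osum (a w) M x = 0}.
    by apply: filterS => x /eqP; rewrite subr_eq0 => /eqP.
  apply: complete; first exact: sqintB.
  move=> j; have [nzj|nzj] := boolP (nz j); last by apply: ip_null => //; exact: sqintB.
  rewrite ipBl//; have [E|NE] := eqVneq (lam j) (lam j0).
    have jM : (j < M)%N.
      rewrite ltnNge; apply: contra nzj => Mj; rewrite /sqnorm (MP _ Mj) ?E//.
      by rewrite ip0l.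
    by rewrite ip_orthosum_e// /a E eqxx fourierM// subrr.
  have -> : ip w (psi j) = 0.
    have d0 : lam j0 - lam j != 0 by rewrite subr_eq0 eq_sym.
    by apply: (mulfI d0); rewrite mulrBl wj subrr mulr0.
  rewrite ip_orthosuml// big1 ?subr0// => i _; rewrite /a; case: eqP => [Ei|]; last by rewrite mul0r.
  rewrite orth ?mulr0//; apply: contra_neq NE => ij; by rewrite -ij.
have c1 j : lam j0 * ip (reF u) (psi j) = lam j * ip (reF u) (psi j).
  have [<- _] := T_coef Tu j; rewrite reFZ/= ipBl ?ipZl//; [|exact: sqintZ..]; ring.
have c2 j : lam j0 * ip (imF u) (psi j) = lam j * ip (imF u) (psi j).
  have [_ <-] := T_coef Tu j; rewrite imFZ/= ipDl ?ipZl//; [|exact: sqintZ..]; ring.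
have sumE (w : 'I_M -> R[i]) x : \sum_(k < M) w k * (if lam k == lam j0 then cplx (psi k) (fun=> 0) else fun=> 0) x =
   (\sum_(k < M) (if lam k == lam j0 then Re (w k) else 0) * psi k x) +i*
   (\sum_(k < M) (if lam k == lam j0 then Im (w k) else 0) * psi k x).
  elim/big_ind3 : _ => //; first by move=> ? ? ? ? ? ? -> ->.
  move=> k _; case: eqP => _; rewrite /cplx; case: (w k) => p q; apply/eqP;
    rewrite eq_complex/=; apply/andP; split; apply/eqP; ring.
apply: aeeqP.
  apply: filterS (main _ ur c1) => x ->; by rewrite [RHS]/reF sumE.
apply: filterS (main _ ui c2) => x ->; by rewrite [RHS]/imF sumE.
Qed.

(** Isolation comes from [dist2_bound] at z = lam j: every other eigenvalue of a nonzero mode is at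
    distance at least sqrt e. *)
Lemma diagonal_purely_discrete : purely_discrete_spectrum T.
Proof.
move=> z; rewrite diagonal_spectrum => -[j nzj <-].
split; [|exact: psi_eigenvalue|exact: psi_finite_multiplicity].
have [e e0 eP] := dist2_bound (lam j)%:C.
split; first by rewrite inE; exists j.
exists [set w : (R[i])^o | `|(lam j)%:C - w| < (Num.sqrt e)%:C].
  apply/nbhs_ballP; exists (Num.sqrt e)%:C; last by move=> w.
  by rewrite /= ltcR sqrtr_gt0.
apply/seteqP; split => [w [/= wV [i nzi wi]]|w ->]; last first.
  by split; [rewrite /= subrr normr0 ltcR sqrtr_gt0|exists j].
apply: contrapT => zw; move: wV; rewrite -wi.
have /(eP _ nzi) : (lam j)%:C <> (lam i)%:C by rewrite wi => E; exact: zw.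
rewrite /dist2/= expr0n addr0 => h.
rewrite -rmorphB/= normc_def/= expr0n addr0 ltcR.
rewrite ltNge => /negP; apply; rewrite ler_wsqrtr//.
by apply: le_trans h _; rewrite le_eqVlt; apply/orP; left; apply/eqP; ring.
Qed.

End diagonal_operator.

(** * Partial derivatives and Schwartz functions *)

Section directional.
Variables (R : realType) (V : normedModType R).
Implicit Types (f g : V -> R) (x v : V).

(** Restriction to a line makes the one-variable chain rule and the mean value theorem available for
    directional derivatives. *)
Lemma is_derive_lineP f x v (df : R) :
  is_derive x v f df <-> is_derive (0 : R) 1 (fun h : R => f (h *: v + x)) df.
Proof.
have E : (fun h : R => h^-1 *: ((f \o shift x) (h *: v) - f x)) =
    (fun h : R => h^-1 *: (((fun h : R => f (h *: v + x)) \o shift 0) (h *: 1) - f (0 *: v + x))).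
  by apply/funext => h /=; rewrite addr0 scale0r add0r [_%:A]mulr1.
split=> -[d e]; split.
- by move: d; rewrite /derivable E.
- by rewrite -e /derive E.
- by move: d; rewrite /derivable E.
- by rewrite -e /derive E.
Qed.

Lemma is_derive_compR f (g : R -> R) x v (df dg : R) :
  is_derive x v f df -> is_derive (f x) 1 g dg ->
  is_derive x v (fun y => g (f y)) (dg * df).
Proof.
move=> /is_derive_lineP df' dg'; apply/is_derive_lineP.
apply: (@is_derive1_comp _ g (fun h : R => f (h *: v + x))).
by rewrite scale0r add0r.
Qed.

End directional.

Lemma is_derive_line (R : realType) (V : normedModType R) (f : V -> R) x v (t df : R) :
  is_derive (x + t *: v) v f df ->
  is_derive t 1 (fun s : R => f (x + s *: v)) df.
Proof.
move=> /is_derive_lineP h; apply/is_derive_lineP.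
rewrite (_ : (fun h : R => f (x + (h *: 1 + t) *: v)) = (fun h : R => f (h *: v + (x + t *: v))))//.
by apply/funext => s; rewrite [_%:A]mulr1 scalerDl addrCA.
Qed.

Section partials.
Variables (R : realType) (n : nat).
Implicit Types (f g : 'rV[R]_n -> R) (x : 'rV[R]_n) (i : 'I_n).
Local Notation mu := (lebesgue_rV R n).
Local Notation e_ i := (delta_mx 0 i : 'rV[R]_n).

Lemma partialE f i x : derivable f x (e_ i) -> is_derive x (e_ i) f (partial i f x).
Proof. by move=> df; split. Qed.

Lemma is_derive_coord i j x : is_derive x (e_ i) (fun y : 'rV[R]_n => y 0 j) ((j == i)%:R : R).
Proof.
apply/is_derive_lineP.
rewrite (_ : (fun h : R => _) = ((j == i)%:R \*: (@id R) + cst (x 0 j))); last first.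
  by apply/funext => h; rewrite !mxE eqxx mulrC.
by apply: is_derive_eq; rewrite addr0 [_ *: _]mulr1.
Qed.

Lemma partialD f g i : (forall x, derivable f x (e_ i)) -> (forall x, derivable g x (e_ i)) ->
  partial i (fun x => f x + g x) = (fun x => partial i f x + partial i g x).
Proof. by move=> df dg; apply/funext => x; rewrite /partial -deriveD. Qed.

Lemma partialM f g i : (forall x, derivable f x (e_ i)) -> (forall x, derivable g x (e_ i)) ->
  partial i (fun x => f x * g x) = (fun x => partial i f x * g x + f x * partial i g x).
Proof.
move=> df dg; apply/funext => x; rewrite /partial.
by rewrite [LHS](@deriveM R _ f g x (e_ i) (df x) (dg x)) addrC [X in X + _]mulrC.
Qed.

Lemma partial_cst (c : R) i : partial i (fun _ : 'rV[R]_n => c) = fun=> 0.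
Proof. by apply/funext => x; rewrite /partial derive_cst. Qed.

Lemma continuous_fcst (c : R) : continuous (fun _ : 'rV[R]_n => c).
Proof. by move=> x; exact: cst_continuous. Qed.

Lemma continuous_fD f g : continuous f -> continuous g -> continuous (fun x => f x + g x).
Proof. by move=> cf cg x; exact: (continuousD (cf x) (cg x)). Qed.

Lemma continuous_fM f g : continuous f -> continuous g -> continuous (fun x => f x * g x).
Proof. by move=> cf cg x; exact: (continuousM (cf x) (cg x)). Qed.

Lemma l1_shift_le x i (t : R) : `|t| <= 1 -> l1 x <= l1 (x + t *: e_ i) + 1.
Proof.
move=> t1; rewrite -{1}(addrK (t *: e_ i) x) (le_trans (l1D _ _))// lerD2l.
by rewrite l1N l1Z l1_delta mulr1.
Qed.

(** Difference quotients of [f] have integral 0 by translation invariance. They converge to the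
    partial derivative and are dominated, through the mean value theorem, by the exponential decay
    of that derivative. *)
Lemma Rint_partial0 f i : continuous f -> (forall x, derivable f x (e_ i)) ->
  continuous (partial i f) -> rapid f -> rapid (partial i f) ->
  \int[mu]_x partial i f x = 0.
Proof.
move=> cf df cdf rf rdf.
have mf := continuous_measurable_rV cf.
have intf := rapid_rint mf rf.
pose t k : R := k.+1%:R^-1.
have t0 k : 0 < t k by rewrite invr_gt0 ltr0n.
have t1 k : t k <= 1 by rewrite invf_le1 ?ltr0n// ler1n.
pose s k x := (t k)^-1 * (f (x + t k *: e_ i) - f x).
have intt k : rint mu (fun x => f (x + t k *: e_ i)) by exact: (Rint_translation _ _).1.
have s0 k : \int[mu]_x s k x = 0.
  have inb := rintB (intt k) intf.
  rewrite /s (RintegralZl _ measurableT inb).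
  by rewrite (RintegralB measurableT (intt k) intf) (Rint_translation _ intf).2 subrr mulr0.
have [C dC] := rdf 1.
have C0 : 0 <= C.
  have := le_trans (normr_ge0 _) (dC 0); rewrite pmulr_lge0//; exact: expR_gt0.
(* The factor [expR 1] absorbs the displacement: the intermediate point of the mean value theorem is
   within l^1 distance 1 of x. *)
have [||||_ H] := @dct _ _ _ mu s (partial i f) (fun x => C * expR 1 * expR (- l1 x)).
- move=> k; apply: measurable_funM => //; apply: measurable_funB => //.
  exact: rint_meas (intt k).
- move=> x; have := df x; rewrite /derivable => /cvg_ex[l Hl].
  have El : partial i f x = l by rewrite /partial /derive; exact: (cvg_lim (@Rhausdorff R) Hl).
  rewrite El; move/cvgr_dnbhsP: Hl => /(_ t) H.
  rewrite (_ : s ^~ x = (fun k => (t k)^-1 *: ((f \o shift x) (t k *: e_ i) - f x))).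
    by apply: H; split; [move=> k; rewrite gt_eqF|exact: cvg_harmonic].
  by apply/funext => k; rewrite /s/= [x + _]addrC.
- apply: rintZ; exact: rint_exp_l1.
- move=> k x.
  have [c ct E] : exists2 c, c \in `](0:R), t k[%R &
     f (x + t k *: e_ i) - f (x + 0 *: e_ i) = partial i f (x + c *: e_ i) * (t k - 0).
    apply: (@MVT _ (fun s => f (x + s *: e_ i)) (fun s => partial i f (x + s *: e_ i))) => //.
      by move=> c _; apply: is_derive_line; exact: partialE.
    apply: derivable_within_continuous => c _.
    by apply: (ex_derive (is_derive := is_derive_line _)); exact: partialE.
  rewrite scale0r addr0 subr0 in E; rewrite /s E mulrC mulfK ?gt_eqF//.
  apply: le_trans (dC _) _; rewrite -mulrA ler_wpM2l// -expRD ler_expR mul1r.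
  move: ct; rewrite in_itv/= => /andP[c0 ct].
  have := @l1_shift_le x i c; rewrite gtr0_norm// => /(_ (le_trans (ltW ct) (t1 k))).
  lra.
have E0 : (fun k => \int[mu]_x s k x) = fun=> 0 by apply/funext.
by rewrite E0 in H; exact: (cvg_unique (@Rhausdorff R) H (cvg_cst 0)).
Qed.

(** A smaller class than the usual one: all derivatives decay faster than every exponential. *)
Definition schwartz f := smooth f /\ forall s : seq 'I_n, rapid (foldr (@partial R n) f s).

Lemma smooth_continuous f : smooth f -> continuous f.
Proof. by move=> /(_ [::])[]. Qed.

Lemma smooth_derivable f i x : smooth f -> derivable f x (e_ i).
Proof. by move=> /(_ [::])[_]; exact. Qed.

Lemma smooth_partial f i : smooth f -> smooth (partial i f).
Proof. by move=> sf s; have := sf (rcons s i); rewrite -cats1 foldr_cat. Qed.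

Lemma schwartz_partial f i : schwartz f -> schwartz (partial i f).
Proof.
move=> [sf rf]; split; first exact: smooth_partial.
by move=> s; have := rf (rcons s i); rewrite -cats1 foldr_cat.
Qed.

Lemma schwartz_rapid f : schwartz f -> rapid f.
Proof. by move=> [_ /(_ [::])]. Qed.

Lemma schwartz_measurable f : schwartz f -> measurable_fun setT f.
Proof. by move=> [/smooth_continuous/continuous_measurable_rV]. Qed.

Lemma schwartz_sqint f : schwartz f -> sqint mu f.
Proof.
by move=> sf; apply: rapid_sqint; [exact: schwartz_measurable|exact: schwartz_rapid].
Qed.

(** Integration by parts: the integral of a partial derivative of [f * g] vanishes. *)
Lemma ip_partial f g i : schwartz f -> schwartz g ->
  ip mu (partial i f) g = - ip mu f (partial i g).
Proof.
move=> sf sg; have [smf rf] := sf; have [smg rg] := sg.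
have df x : derivable f x (e_ i) by exact: smooth_derivable.
have dg x : derivable g x (e_ i) by exact: smooth_derivable.
have sdf := schwartz_partial i sf; have sdg := schwartz_partial i sg.
have [smdf rdf] := sdf; have [smdg rdg] := sdg.
have cf := smooth_continuous smf; have cg := smooth_continuous smg.
have cdf := smooth_continuous smdf; have cdg := smooth_continuous smdg.
have := @Rint_partial0 (fun x => f x * g x) i.
rewrite partialM// => H; apply/eqP; rewrite -addr_eq0; apply/eqP.
rewrite !ipE -RintegralD//=; [|exact: sqintM (schwartz_sqint _) (schwartz_sqint _)..].
apply: H.
- exact: continuous_fM.
- by move=> x; exact: (@derivableM R _ f g x (e_ i)).
- by apply: continuous_fD; exact: continuous_fM.
- exact: rapidM (schwartz_rapid sf) (schwartz_rapid sg).
- by apply: rapidD; apply: rapidM; exact: schwartz_rapid.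
Qed.

(** Smoothness speaks of all iterated partial derivatives; a class stable under them handles all
    orders at once. *)
Lemma smooth_coind (C : set ('rV[R]_n -> R)) :
  (forall f, C f -> [/\ continuous f, forall i x, derivable f x (e_ i) &
     forall i, C (partial i f)]) -> forall f, C f -> smooth f.
Proof.
move=> CP f Cf s; suff : C (foldr (@partial R n) f s) by move=> /CP[].
by elim: s => //= i s /CP[_ _]; exact.
Qed.

(** The multipliers of rapidly decaying functions: exponential growth is allowed, and not only
    polynomial growth. *)
Definition tempered f := exists a C, forall x, `|f x| <= C * expR (a * l1 x).

Lemma tempered_cst (c : R) : tempered (fun _ : 'rV[R]_n => c).
Proof. by exists 0, `|c| => x; rewrite mul0r expR0 mulr1. Qed.

Lemma tempered_coord i : tempered (fun x => x 0 i).
Proof.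
exists 1, 1 => x; rewrite !mul1r.
apply: le_trans (l1_coord x i) _; apply: le_trans (expR_ge1Dx _); lra.
Qed.

Lemma temperedM f g : tempered f -> tempered g -> tempered (fun x => f x * g x).
Proof.
move=> [a [C fC]] [b [D gD]]; exists (a + b), (C * D) => x.
by rewrite normrM mulrDl expRD mulrACA ler_pM.
Qed.

Lemma temperedD f g : tempered f -> tempered g -> tempered (fun x => f x + g x).
Proof.
move=> [a [C fC]] [b [D gD]]; exists (Num.max a b), (C + D) => x.
apply: le_trans (ler_normD _ _) _; rewrite mulrDl.
have pos (e E : R) (h : 'rV[R]_n -> R) : (forall x, `|h x| <= E * expR (e * l1 x)) -> 0 <= E.
  move=> /(_ 0) /(le_trans (normr_ge0 _)); rewrite pmulr_lge0//; exact: expR_gt0.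
apply: lerD.
  apply: le_trans (fC x) _; rewrite ler_wpM2l ?(pos _ _ _ fC)// ler_expR.
  by rewrite ler_wpM2r ?l1_ge0// le_max lexx.
apply: le_trans (gD x) _; rewrite ler_wpM2l ?(pos _ _ _ gD)// ler_expR.
by rewrite ler_wpM2r ?l1_ge0// le_max lexx orbT.
Qed.

(** * Algebras of smooth functions and their multiples of a fixed function *)

Section algebra.
Variables (atom : set ('rV[R]_n -> R)) (G : 'rV[R]_n -> R).

(** Two sets of atoms will be used: coordinates and bumps for the cutoffs, and coordinates alone,
    which gives the polynomial functions. *)
Inductive alg : ('rV[R]_n -> R) -> Prop :=
| alg_cst c : alg (fun=> c)
| alg_atom f : atom f -> alg f
| alg_add f g : alg f -> alg g -> alg (fun x => f x + g x)
| alg_mul f g : alg f -> alg g -> alg (fun x => f x * g x).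

(* The ideal of [alg]-multiples of [G]; it will be made of Schwartz functions. *)
Inductive ralg : ('rV[R]_n -> R) -> Prop :=
| ralg_mul f : alg f -> ralg (fun x => f x * G x)
| ralg_add f g : ralg f -> ralg g -> ralg (fun x => f x + g x).

Hypothesis atomP : forall f, atom f -> [/\ continuous f, tempered f,
  forall i x, derivable f x (e_ i) & forall i, alg (partial i f)].
Hypothesis cG : continuous G.
Hypothesis rG : rapid G.
Hypothesis dG : forall i x, derivable G x (e_ i).
(** The logarithmic derivatives of [G] lie in the algebra, which is what makes the ideal stable
    under partial derivatives. *)
Hypothesis pG : forall i, exists2 f, alg f & partial i G = (fun x => f x * G x).

Lemma algP f : alg f -> [/\ continuous f, tempered f,
  forall i x, derivable f x (e_ i) & forall i, alg (partial i f)].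
Proof.
elim=> {f} [c|f /atomP//|f g _ [cf tf df pf] _ [cg tg dg pg]|
    f g af [cf tf df pf] ag [cg tg dg pg]].
- split; [exact: continuous_fcst|exact: tempered_cst|by move=> i x; exact: derivable_cst|].
  by move=> i; rewrite partial_cst; exact: alg_cst.
- split; [exact: continuous_fD|exact: temperedD| |].
    by move=> i x; exact: (@derivableD R _ _ f g x (e_ i)).
  by move=> i; rewrite partialD//; exact: alg_add.
- split; [exact: continuous_fM|exact: temperedM| |].
    by move=> i x; exact: (@derivableM R _ f g x (e_ i)).
  by move=> i; rewrite partialM//; apply: alg_add; exact: alg_mul.
Qed.

Lemma ralg_mulr f g : alg f -> ralg g -> ralg (fun x => f x * g x).
Proof.
move=> af; elim=> {g} [g ag|g h _ rg _ rh].
  by under eq_fun do rewrite mulrA; apply: ralg_mul; exact: alg_mul.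
by under eq_fun do rewrite mulrDr; exact: ralg_add.
Qed.

Lemma ralgP f : ralg f -> [/\ continuous f, rapid f,
  forall i x, derivable f x (e_ i) & forall i, ralg (partial i f)].
Proof.
elim=> {f} [f af|f g _ [cf tf df pf] _ [cg tg dg pg]].
- have [cf tf df pf] := algP af.
  split; [exact: continuous_fM|exact: rapid_mul| |].
    by move=> i x; exact: (@derivableM R _ f G x (e_ i)).
  move=> i; rewrite partialM//; have [g ag ->] := pG i.
  apply: ralg_add; first exact: ralg_mul.
  by under eq_fun do rewrite mulrA; apply: ralg_mul; exact: alg_mul.
- split; [exact: continuous_fD|exact: rapidD| |].
    by move=> i x; exact: (@derivableD R _ _ f g x (e_ i)).
  by move=> i; rewrite partialD//; exact: ralg_add.
Qed.

Lemma ralg_schwartz f : ralg f -> schwartz f.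
Proof.
move=> rf; split; first by move: f rf; apply: smooth_coind => f /ralgP[].
move=> s; suff : ralg (foldr (@partial R n) f s) by move=> /ralgP[].
by elim: s => //= i s /ralgP[_ _ _]; exact.
Qed.

Lemma ralg_sum (I : Type) (s : seq I) (F : I -> 'rV[R]_n -> R) :
  (forall i : I, ralg (F i)) -> ralg (fun x => \sum_(i <- s) F i x).
Proof.
move=> rF; elim: s => [|i s IH].
  under eq_fun do rewrite big_nil; have -> : (fun=> 0) = (fun x => 0 * G x).
    by apply/funext => x; rewrite mul0r.
  by apply: ralg_mul; exact: alg_cst.
by under eq_fun do rewrite big_cons; exact: ralg_add.
Qed.

End algebra.

End partials.

(** * The functions p(1/t) exp(-1/t) *)

Section expbump.
Variable R : realType.
Implicit Types (p : {poly R}) (t s : R).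

(** For s >= 0 each monomial satisfies s^i <= i! exp(s), by comparison with one term of the
    exponential series. *)
Lemma horner_expRN_bounded p : exists2 C, 0 <= C & forall s, 0 <= s -> `|p.[s]| * expR (- s) <= C.
Proof.
exists (\sum_(i < size p) `|p`_i| * i`!%:R).
  by apply: sumr_ge0 => i _; rewrite mulr_ge0.
move=> s s0; rewrite horner_coef.
apply: (@le_trans _ _ (\sum_(i < size p) `|p`_i * s ^+ i| * expR (- s))).
  by rewrite -mulr_suml ler_wpM2r ?expR_ge0// ler_norm_sum.
apply: ler_sum => i _; rewrite normrM -mulrA ler_wpM2l//.
rewrite expRN ler_pdivrMr ?expR_gt0// ger0_norm ?exprn_ge0//.
case: (nat_of_ord i) => [|k].
  by rewrite expr0 fact0 mul1r; apply: le_trans (expR_ge1Dx s); rewrite lerDl.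
have := expR_ge1Dxn k s0; set E := expR s; set f : R := k.+1`!%:R.
have f0 : 0 < f by rewrite ltr0n fact_gt0.
rewrite -lerBrDl ler_pdivrMr// => h; apply: le_trans h _.
by rewrite mulrC ler_pM2l// lerBlDr lerDl.
Qed.

(** Keeping the polynomial [p] as a parameter makes the family closed under differentiation. *)
Definition expbump p t := if 0 < t then p.[t^-1] * expR (- t^-1) else 0.

Lemma expbump_bounded p : exists2 C, 0 <= C & forall t, `|expbump p t| <= C.
Proof.
have [C C0 CP] := horner_expRN_bounded p; exists C => // t.
rewrite /expbump; case: ifPn => t0; last by rewrite normr0.
by rewrite normrM [`|expR _|]gtr0_norm ?expR_gt0// CP// invr_ge0 ltW.
Qed.

Lemma expbumpXM p t : expbump ('X * p) t = t^-1 * expbump p t.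
Proof. by rewrite /expbump; case: ifPn => _; rewrite ?mulr0// hornerM hornerX mulrA. Qed.

Lemma expbump_le_lin p : exists2 C, 0 <= C & forall t, `|expbump p t| <= C * `|t|.
Proof.
have [C C0 CP] := expbump_bounded ('X * p); exists C => // t.
have := CP t; rewrite expbumpXM normrM normfV.
have [->|t0] := eqVneq t 0; first by rewrite /expbump ltxx/= !normr0 !mulr0.
by rewrite mulrC ler_pdivrMr ?normr_gt0.
Qed.

(** For t > 0 the derivative of p(1/t) exp(-1/t) is t^-2 (p - p')(1/t) exp(-1/t). *)
Definition expbump_deriv p := 'X^2 * (p - p^`()).

Lemma is_derive_expbump p t : is_derive t 1 (expbump p) (expbump (expbump_deriv p) t).
Proof.
have [t0|t0|->] := ltgtP t 0.
- rewrite /expbump [0 < t]ltNge (ltW t0)/=.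
  have H : is_derive t 1 (cst (0 : R)) (0 : R) by exact: is_derive_cst.
  apply: near_eq_is_derive H.
  near=> s; rewrite ltNge (_ : s <= 0)//; apply/ltW.
  by near: s; exact: lt_nbhsl.
- rewrite /expbump t0.
  have dV : is_derive t 1 (fun s : R => s^-1) (- t^-2).
    apply: is_derive_eq (@is_deriveV R id t 1 1 _ _) _; first by rewrite gt_eqF.
    exact: mulr1.
  have d1 := is_derive_compR dV (is_derive_poly p t^-1).
  have d2 : is_derive t 1 (fun s => expR (- s^-1)) (expR (- t^-1) * t^-2).
    have h : is_derive t 1 (fun s : R => - s^-1) (t^-2).
      by rewrite -[t^-2]opprK; exact: is_deriveN.
    exact: (is_derive_compR h (is_derive_expR _)).
  apply: (@near_eq_is_derive _ _ _ (fun t => p.[t^-1] * expR (- t^-1))).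
    near=> s; rewrite (_ : 0 < s)//.
    by near: s; exact: lt_nbhsr.
  apply: is_derive_eq (is_deriveM d1 d2) _.
  rewrite /expbump_deriv hornerM hornerXn hornerD hornerN exprVn /GRing.scale/=.
  ring.
(* At 0 the difference quotient is [expbump ('X * p)], which is bounded by a multiple of |h| and so
   tends to 0. *)
- have [C C0 CP] := expbump_le_lin ('X * p).
  have H : (fun h : R => h^-1 *: ((expbump p \o shift 0) (h *: 1) - expbump p 0)) @ 0^' --> 0.
    apply/norm_cvg0P.
    apply: (@squeeze_cvgr _ _ _ _ (cst 0) (fun h : R => C * `|h|)).
    + apply: nearW => h /=; rewrite normr_ge0/=.
      rewrite addr0 [_ *: 1]mulr1 /expbump ltxx subr0 -/(expbump p h).
      by rewrite [_ *: _](_ : _ = expbump ('X * p) h)// expbumpXM.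
    + exact: cvg_cst.
    + rewrite -[X in _ --> X](mulr0 C); apply: cvgMr.
      apply: cvg_within_filter; have := @norm_continuous R R (0 : R).
      by rewrite /continuous_at normr0.
  split; first by apply/cvg_ex; exists 0.
  by rewrite /derive [RHS]/expbump ltxx; exact: (cvg_lim (@Rhausdorff R) H).
Unshelve. all: by end_near. Qed.

End expbump.

(** * Test functions and cutoffs *)

Section test_functions.
Variables (R : realType) (n : nat).
Implicit Types (f g : 'rV[R]_n -> R) (K : set 'rV[R]_n).

Lemma continuous_l1 : continuous (@l1 R n).
Proof.
rewrite /l1; elim: (index_enum _) => [|i s IH].
  by under eq_fun do rewrite big_nil; exact: continuous_fcst.
under eq_fun do rewrite big_cons; apply: continuous_fD => // x.
apply: (@continuous_comp _ _ _ (fun y : 'rV[R]_n => y 0 i) Num.norm x).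
  exact: coord_continuous.
exact: norm_continuous.
Qed.

Lemma compact_bounded_above K f : compact K -> continuous f ->
  exists M, forall x, K x -> `|f x| <= M.
Proof.
move=> cK cf.
have : compact (f @` K).
  by apply: continuous_compact => //; exact: continuous_subspaceT.
move=> /compact_bounded; rewrite /bounded_set/= => -[M [_ MP]].
exists (M + 1) => x Kx; apply: (MP (M + 1)); first by rewrite ltrDl.
by exists x.
Qed.

Lemma compact_support_rapid K f : compact K -> continuous f ->
  (forall x, ~ K x -> f x = 0) -> rapid f.
Proof.
move=> cK cf f0 a.
have [M MP] := compact_bounded_above cK cf.
have [L LP] := compact_bounded_above cK continuous_l1.
exists (`|M| * expR (`|a| * L)) => x.
have [Kx|/f0 ->] := pselect (K x); last by rewrite normr0 mulr_ge0 ?expR_ge0// mulr_ge0 ?expR_ge0.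
apply: le_trans (MP _ Kx) _; apply: le_trans (ler_norm _) _.
rewrite -mulrA -expRD ler_peMr// -[leLHS]expR0 ler_expR.
have := LP _ Kx; rewrite ger0_norm ?l1_ge0// => h.
rewrite subr_ge0; apply: le_trans (ler_wpM2r (l1_ge0 x) (ler_norm a)) _.
by rewrite ler_wpM2l.
Qed.

Lemma partial_support K f i : closed K -> (forall x, ~ K x -> f x = 0) ->
  forall x, ~ K x -> partial i f x = 0.
Proof.
move=> cK f0 x Kx; rewrite /partial.
rewrite (@near_eq_derive _ _ _ f (cst 0)) ?derive_cst//.
have : nbhs x (~` K) by apply: open_nbhs_nbhs; split => //; exact: closed_openC.
by apply: filterS => y; exact: f0.
Qed.

Lemma compact_support_schwartz K f : compact K -> closed K -> smooth f ->
  (forall x, ~ K x -> f x = 0) -> schwartz f.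
Proof.
move=> cK clK sf f0; split => // s.
apply: (compact_support_rapid cK); first by have [] := sf s.
by elim: s => //= i s; exact: partial_support.
Qed.

Lemma Cc_smooth_schwartz (phi : 'rV[R]_n -> R[i]) : Cc_smooth phi ->
  schwartz (reF phi) /\ schwartz (imF phi).
Proof.
move=> [sr si cK].
have E x : ~ closure [set x | phi x != 0] x -> phi x = 0.
  move=> h; apply/eqP; apply: contra_notT h => h; exact: subset_closure.
have clK := @closed_closure _ [set x | phi x != 0].
by split; apply: (compact_support_schwartz cK clK) => // x /E; rewrite /reF /imF => ->.
Qed.

End test_functions.

(** * The differential operator on real functions and its closure *)

Section schrodinger_real.
Variables (R : realType) (n : nat) (A : 'M[R]_n) (h : R).
Local Notation mu := (lebesgue_rV R n).
Implicit Types (g : 'rV[R]_n -> R).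

Definition lap (f : 'rV[R]_n -> R) x := \sum_i partial i (partial i f) x.

Definition schrod (f : 'rV[R]_n -> R) x := - (h ^+ 2) * lap f x + qform A x * f x.

Lemma tempered_qform : tempered (qform A).
Proof.
rewrite /qform; have ts (I : Type) (s : seq I) (F : I -> 'rV[R]_n -> R) :
    (forall i : I, tempered (F i)) -> tempered (fun x => \sum_(i <- s) F i x).
  move=> tF; elim: s => [|i s IH].
    by under eq_fun do rewrite big_nil; exact: tempered_cst.
  by under eq_fun do rewrite big_cons; exact: temperedD.
apply: (ts _ _ (fun i x => _)) => i; apply: (ts _ _ (fun j x => _)) => j.
by do 2 (apply: temperedM; last exact: tempered_coord); exact: tempered_cst.
Qed.

Lemma measurable_qform : measurable_fun setT (qform A).
Proof.
apply: measurable_sum => i; apply: measurable_sum => j.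
by apply: measurable_funM; [apply: measurable_funM => //|]; exact: measurable_coord.
Qed.

Lemma qform_sqint (f : 'rV[R]_n -> R) : schwartz f -> sqint mu (fun x => qform A x * f x).
Proof.
move=> sf; apply: rapid_sqint.
  by apply: measurable_funM; [exact: measurable_qform|exact: schwartz_measurable].
by apply: rapid_mul; [exact: schwartz_rapid|exact: tempered_qform].
Qed.

Lemma partial2_sqint i (f : 'rV[R]_n -> R) : schwartz f -> sqint mu (partial i (partial i f)).
Proof. by move=> sf; apply: schwartz_sqint; do 2 apply: schwartz_partial. Qed.

Lemma lap_sqint (f : 'rV[R]_n -> R) : schwartz f -> sqint mu (lap f).
Proof. by move=> sf; apply: sqint_sum => i; exact: partial2_sqint. Qed.

Lemma schrod_sqint (f : 'rV[R]_n -> R) : schwartz f -> sqint mu (schrod f).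
Proof.
move=> sf; apply: sqintD; [apply: sqintZ|]; [exact: lap_sqint|exact: qform_sqint].
Qed.

Lemma lap_symmetric (f g : 'rV[R]_n -> R) : schwartz f -> schwartz g -> ip mu (lap f) g = ip mu f (lap g).
Proof.
move=> sf sg; have sg2 := schwartz_sqint sg; have sf2 := schwartz_sqint sf.
rewrite /lap ip_suml//; last by move=> i; exact: partial2_sqint.
rewrite [RHS]ipC ip_suml//; last by move=> i; exact: partial2_sqint.
apply: eq_bigr => i _.
have E1 := ip_partial i (schwartz_partial i sf) sg.
have E2 := ip_partial i (schwartz_partial i sg) sf.
exact: (etrans E1 (etrans (congr1 (@GRing.opp R) (ipC mu _ _)) (esym E2))).
Qed.

Lemma schrod_symmetric (f g : 'rV[R]_n -> R) : schwartz f -> schwartz g ->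
  ip mu (schrod f) g = ip mu f (schrod g).
Proof.
move=> sf sg; have sg2 := schwartz_sqint sg; have sf2 := schwartz_sqint sf.
have lf := lap_sqint sf; have lg := lap_sqint sg.
rewrite /schrod ipDl//; [|exact: sqintZ|exact: qform_sqint].
rewrite [RHS]ipC ipDl//; [|exact: sqintZ|exact: qform_sqint].
have E1 := ipZl (- h ^+ 2) lf sg2; have E2 := ipZl (- h ^+ 2) lg sf2.
have E3 : ip mu (lap f) g = ip mu (lap g) f := etrans (lap_symmetric sf sg) (ipC mu _ _).
have E4 : ip mu (fun x => qform A x * f x) g = ip mu (fun x => qform A x * g x) f.
  by rewrite !ipE; apply: eq_Rintegral => x _; ring.
apply: (congr2 +%R _ E4).
exact: (etrans E1 (etrans (congr1 ( *%R (- h ^+ 2)) E3) (esym E2))).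
Qed.

Lemma sum_cplx (I : Type) (s : seq I) (F G : I -> R) :
  \sum_(i <- s) (F i +i* G i) = (\sum_(i <- s) F i) +i* (\sum_(i <- s) G i).
Proof. by elim/big_rec3 : _ => // i a b c _ ->. Qed.

Lemma reF_affine (L f : 'rV[R]_n -> R[i]) c (q : 'rV[R]_n -> R) :
  reF (fun x => - c%:C * L x + (q x)%:C * f x) = (fun x => - c * reF L x + q x * reF f x).
Proof.
apply/funext => x; rewrite /reF /=; case: (L x) (f x) => ? ? [? ?] /=; ring.
Qed.

Lemma imF_affine (L f : 'rV[R]_n -> R[i]) c (q : 'rV[R]_n -> R) :
  imF (fun x => - c%:C * L x + (q x)%:C * f x) = (fun x => - c * imF L x + q x * imF f x).
Proof.
apply/funext => x; rewrite /imF /=; case: (L x) (f x) => ? ? [? ?] /=; ring.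
Qed.

Lemma laplacianE (phi : 'rV[R]_n -> R[i]) : laplacian phi = cplx (lap (reF phi)) (lap (imF phi)).
Proof. apply/funext => x; exact: sum_cplx. Qed.

Local Notation Pc := (fun (f : 'rV[R]_n -> R[i]) x => - (h ^+ 2)%:C * laplacian f x + (qform A x)%:C * f x).

Lemma reF_schrod (phi : 'rV[R]_n -> R[i]) : reF (Pc phi) = schrod (reF phi).
Proof. by rewrite reF_affine laplacianE reF_cplx. Qed.

Lemma imF_schrod (phi : 'rV[R]_n -> R[i]) : imF (Pc phi) = schrod (imF phi).
Proof. by rewrite imF_affine laplacianE imF_cplx. Qed.

Lemma Cc_L2 (phi : 'rV[R]_n -> R[i]) : Cc_smooth phi -> L2 phi /\ L2 (Pc phi).
Proof.
move=> /Cc_smooth_schwartz[sr si]; split; apply/L2P.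
  by split; exact: schwartz_sqint.
by rewrite reF_schrod imF_schrod; split; exact: schrod_sqint.
Qed.

Lemma opP_L2 u f : opP A h u f -> L2 u /\ L2 f.
Proof. by case. Qed.

(** On test functions the operator can be moved onto [psi], where it acts as [l]; both sides are
    continuous along the sequence that approximates u and f. The function [psi] need not have
    compact support. *)
Lemma opP_eigen_coef u f (psi : 'rV[R]_n -> R) (l : R) : schwartz psi ->
  schrod psi = (fun x => l * psi x) -> opP A h u f ->
  ip mu (reF f) psi = l * ip mu (reF u) psi /\ ip mu (imF f) psi = l * ip mu (imF u) psi.
Proof.
move=> sp Ep [Lu Lf [phi [Dphi cu cf]]].
have sp2 := schwartz_sqint sp.
have /L2P[ur ui] := Lu; have /L2P[fr fi] := Lf.
have sr k : schwartz (reF (phi k)) by have [] := Cc_smooth_schwartz (Dphi k).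
have si k : schwartz (imF (phi k)) by have [] := Cc_smooth_schwartz (Dphi k).
have [] := L2norm_cvg_reim _ cu; first by move=> k; apply: L2B => //; exact: (Cc_L2 (Dphi k)).1.
have [] := L2norm_cvg_reim _ cf; first by move=> k; apply: L2B => //; exact: (Cc_L2 (Dphi k)).2.
under eq_fun do rewrite reFB reF_schrod; under [X in _ -> X @ _ --> _ -> _]eq_fun do rewrite imFB imF_schrod.
move=> cfr cfi; under eq_fun do rewrite reFB; under [X in _ -> X @ _ --> _ -> _]eq_fun do rewrite imFB.
move=> cur cui.
have key (s : nat -> 'rV[R]_n -> R) w v : (forall k, schwartz (s k)) -> sqint mu w -> sqint mu v ->
    (fun k => ip mu (fun x => s k x - w x) (fun x => s k x - w x)) @ \oo --> 0 ->
    (fun k => ip mu (fun x => schrod (s k) x - v x) (fun x => schrod (s k) x - v x)) @ \oo --> 0 ->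
    ip mu v psi = l * ip mu w psi.
  move=> ss sw sv cw cv.
  have h1 := ip_cvg (fun k => schrod_sqint (ss k)) sv sp2 cv.
  have h2 := ip_cvg (fun k => schwartz_sqint (ss k)) sw sp2 cw.
  have E : (fun k => ip mu (schrod (s k)) psi) = (fun k => l * ip mu (s k) psi).
    apply/funext => k; rewrite schrod_symmetric// Ep ipC ipZl//; first by rewrite ipC.
    exact: schwartz_sqint.
  rewrite E in h1; apply: (cvg_unique (@Rhausdorff R) h1).
  exact: cvgMr.
by split; [exact: key cur cfr|exact: key cui cfi].
Qed.

(** A diagonal choice: from the test functions approximating [us k] and [fs k], take one within
    squared distance 1/(k+1) of both. *)
Lemma opP_closed us fs u f : (forall k, opP A h (us k) (fs k)) -> L2 u -> L2 f ->
  (fun k => L2norm (fun x => us k x - u x)) @ \oo --> 0%E ->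
  (fun k => L2norm (fun x => fs k x - f x)) @ \oo --> 0%E -> opP A h u f.
Proof.
move=> Tk Lu Lf cu cf; split => //.
have Lus k : L2 (us k) by have [] := opP_L2 (Tk k).
have Lfs k : L2 (fs k) by have [] := opP_L2 (Tk k).
(* This is a squared distance, so its triangle inequality carries factors 2. *)
pose dist (a b : 'rV[R]_n -> R[i]) := sqnorm mu (fun x => reF a x - reF b x) +
  sqnorm mu (fun x => imF a x - imF b x).
have distP (s : nat -> 'rV[R]_n -> R[i]) t : (forall k, L2 (s k)) -> L2 t ->
    (fun k => L2norm (fun x => s k x - t x)) @ \oo --> 0%E <-> (fun k => dist (s k) t) @ \oo --> 0.
  move=> Ls Lt; rewrite L2norm_cvg0P; last by move=> k; exact: L2B.
  rewrite (_ : (fun k => _ + _) = (fun k => dist (s k) t))//.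
  by apply/funext => k; rewrite reFB imFB.
have dist_tri a b c : L2 a -> L2 b -> L2 c -> dist a c <= 2 * dist a b + 2 * dist b c.
  move=> /L2P[ar ai] /L2P[br bi] /L2P[cr ci].
  have tri (p q r : 'rV[R]_n -> R) : sqint mu p -> sqint mu q -> sqint mu r ->
      sqnorm mu (fun x => p x - r x) <= 2 * sqnorm mu (fun x => p x - q x) + 2 * sqnorm mu (fun x => q x - r x).
    move=> sp sq sr; have := ipD_le (sqintB sp sq) (sqintB sq sr); congr (_ <= _).
    by congr (ip mu _ _); apply/funext => x; ring.
  by have := tri _ _ _ ar br cr; have := tri _ _ _ ai bi ci; rewrite /dist; lra.
have approx k : exists phi, [/\ Cc_smooth phi, dist phi (us k) <= k.+1%:R^-1 &
    dist (Pc phi) (fs k) <= k.+1%:R^-1].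
  have [_ _ [phi [Dphi cuk cfk]]] := Tk k.
  have /(distP _ _ (fun j => (Cc_L2 (Dphi j)).1) (Lus k)) h1 := cuk.
  have /(distP _ _ (fun j => (Cc_L2 (Dphi j)).2) (Lfs k)) h2 := cfk.
  have e0 : 0 < k.+1%:R^-1 :> R by rewrite invr_gt0 ltr0n.
  have H1 : \forall j \near \oo, `|dist (phi j) (us k)| <= k.+1%:R^-1.
    by apply: (cvgr0_norm_le _ h1).
  have H2 : \forall j \near \oo, `|dist (Pc (phi j)) (fs k)| <= k.+1%:R^-1.
    by apply: (cvgr0_norm_le _ h2).
  have [N _ NP] : \forall j \near \oo, dist (phi j) (us k) <= k.+1%:R^-1 /\
     dist (Pc (phi j)) (fs k) <= k.+1%:R^-1.
    near=> j; split; apply: le_trans (ler_norm _) _; near: j; [exact: H1|exact: H2].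
  by exists (phi N); have [] := NP N (leqnn N).
have [phi phiP] := choice approx.
have Dphi k : Cc_smooth (phi k) by have [] := phiP k.
have conv (s t : nat -> 'rV[R]_n -> R[i]) w : (forall k, L2 (s k)) -> (forall k, L2 (t k)) -> L2 w ->
    (forall k, dist (s k) (t k) <= k.+1%:R^-1) ->
    (fun k => L2norm (fun x => t k x - w x)) @ \oo --> 0%E ->
    (fun k => L2norm (fun x => s k x - w x)) @ \oo --> 0%E.
  move=> Ls Lt Lw st /(distP _ _ Lt Lw) ct; apply/(distP _ _ Ls Lw).
  have H : (fun k => 2 * k.+1%:R^-1 + 2 * dist (t k) w) @ \oo --> (0 : R).
    have -> : 0 = 2 * 0 + 2 * 0 :> R by rewrite !mulr0 addr0.
    apply: cvgD; apply: cvgMr => //; exact: cvg_harmonic.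
  apply: (squeeze_cvgr _ (cvg_cst 0) H); apply: nearW => k.
  rewrite addr_ge0 ?ip_ge0//=; apply: le_trans (dist_tri _ _ _ (Ls k) (Lt k) Lw) _.
  by rewrite lerD2r ler_pM2l.
exists phi; split => //.
- apply: (conv _ us) => //; first by move=> k; exact: (Cc_L2 (Dphi k)).1.
  by move=> k; have [] := phiP k.
- apply: (conv _ fs) => //; first by move=> k; exact: (Cc_L2 (Dphi k)).2.
  by move=> k; have [] := phiP k.
Unshelve. all: by end_near. Qed.

End schrodinger_real.

(** * Cutoffs and the domain of the closure *)

Section cutoff.
Variables (R : realType) (n : nat).
Local Notation mu := (lebesgue_rV R n).
Local Notation e_ i := (delta_mx 0 i : 'rV[R]_n).
Implicit Types (x : 'rV[R]_n) (i : 'I_n).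

Definition nsq x : R := \sum_i x 0 i ^+ 2.

(** Positive exactly inside the ball of radius sqrt (k+1); composed with [expbump] it gives smooth
    functions that vanish outside this ball. *)
Definition ball_gauge k x : R := 1 - nsq x / k.+1%:R.

Lemma nsq_ge0 x : 0 <= nsq x.
Proof. by apply: sumr_ge0 => i _; exact: sqr_ge0. Qed.

Lemma coord_sqr_le_nsq x i : x 0 i ^+ 2 <= nsq x.
Proof. by rewrite /nsq (bigD1 i)//= lerDl sumr_ge0// => j _; exact: sqr_ge0. Qed.

Lemma coord_le_nsq x i : `|x 0 i| <= 1 + nsq x.
Proof.
have := coord_sqr_le_nsq x i; rewrite -real_normK ?num_real//.
have := normr_ge0 (x 0 i); set a := `|_|; have := sqr_ge0 (a - 1); nra.
Qed.

Lemma is_derive_nsq i x : is_derive x (e_ i) nsq (2 * x 0 i).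
Proof.
have key (r : seq 'I_n) : is_derive x (e_ i) (fun y : 'rV[R]_n => \sum_(j <- r) y 0 j ^+ 2)
    (\sum_(j <- r) (x 0 j *: (j == i)%:R + x 0 j *: (j == i)%:R)).
  elim: r => [|j r IH].
    by under eq_fun do rewrite big_nil; rewrite big_nil; exact: is_derive_cst.
  under eq_fun do rewrite big_cons expr2; rewrite big_cons.
  have d := is_derive_coord i j x.
  exact: (is_deriveD (is_deriveM d d) IH).
apply: is_derive_eq (key (index_enum _)) _.
rewrite (bigD1 i)//= eqxx big1 ?addr0 => [|j /negPf ->]; last by rewrite /GRing.scale/= mulr0 addr0.
by rewrite /GRing.scale/= mulr1 mulr_natl mulr2n.
Qed.

Lemma continuous_nsq : continuous nsq.
Proof.
rewrite /nsq; elim: (index_enum _) => [|i s IH].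
  by under eq_fun do rewrite big_nil; exact: continuous_fcst.
under eq_fun do rewrite big_cons expr2; apply: continuous_fD => //.
by apply: continuous_fM; exact: coord_continuous.
Qed.

Lemma is_derive_ball_gauge k i x :
  is_derive x (e_ i) (ball_gauge k) (- (2 * x 0 i / k.+1%:R)).
Proof.
have d := is_derive_nsq i x.
have h := is_deriveB (is_derive_cst (1 : R) x (e_ i))
  (is_deriveM d (is_derive_cst (k.+1%:R^-1 : R) x (e_ i))).
have -> : ball_gauge k = cst (1 : R) - nsq * cst (k.+1%:R^-1 : R) by [].
apply: is_derive_eq h _.
by rewrite /cst /GRing.scale/=; ring.
Qed.

Lemma continuous_ball_gauge k : continuous (ball_gauge k).
Proof.
rewrite /ball_gauge; apply: continuous_fD; first exact: continuous_fcst.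
under eq_fun do rewrite -mulNr mulrC mulrN -mulNr.
by apply: continuous_fM; [exact: continuous_fcst|exact: continuous_nsq].
Qed.

Lemma continuous_expbump p : continuous (@expbump R p).
Proof.
move=> t; apply/differentiable_continuous; rewrite -derivable1_diffP.
by have [] := is_derive_expbump p t.
Qed.

Inductive cutoff_atom : set ('rV[R]_n -> R) :=
| atom_coord i : cutoff_atom (fun x => x 0 i)
| atom_bump p k : cutoff_atom (fun x => expbump p (ball_gauge k x)).

Local Notation calg := (alg cutoff_atom).

Lemma alg_scale c (f : 'rV[R]_n -> R) : calg f -> calg (fun x => c * f x).
Proof. by move=> af; apply: alg_mul => //; exact: alg_cst. Qed.

Lemma partial_expbump i p k : partial i (fun x => expbump p (ball_gauge k x)) =
  (fun x => - (2 / k.+1%:R) * (x 0 i * expbump (expbump_deriv p) (ball_gauge k x))).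
Proof.
apply/funext => x; rewrite /partial.
have := is_derive_compR (is_derive_ball_gauge k i x) (is_derive_expbump p (ball_gauge k x)).
move=> [_ ->]; ring.
Qed.

Lemma cutoff_atomP (f : 'rV[R]_n -> R) : cutoff_atom f -> [/\ continuous f, tempered f,
  forall i x, derivable f x (e_ i) & forall i, calg (partial i f)].
Proof.
case=> {f} [j|p k].
- split; [exact: coord_continuous|exact: tempered_coord| |].
    by move=> i x; have [] := is_derive_coord i j x.
  move=> i; rewrite (_ : partial i _ = fun=> (j == i)%:R); first exact: alg_cst.
  by apply/funext => x; rewrite /partial; have [] := is_derive_coord i j x.
- split.
  + by move=> x; apply: continuous_comp; [exact: continuous_ball_gauge|exact: continuous_expbump].
  + have [C C0 CP] := expbump_bounded p; exists 0, C => x.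
    by rewrite mul0r expR0 mulr1.
  + move=> i x.
    by have [] := is_derive_compR (is_derive_ball_gauge k i x) (is_derive_expbump p (ball_gauge k x)).
  + move=> i; rewrite partial_expbump; apply: alg_scale; apply: alg_mul; apply: alg_atom.
      exact: atom_coord.
    exact: atom_bump.
Qed.

(* The factor [expR 1] gives [chi k] the value 1 at the origin. *)
Definition chi k x : R := expR 1 * expbump 1 (ball_gauge k x).

Lemma alg_chi k : calg (chi k).
Proof. by apply: alg_scale; apply: alg_atom; exact: atom_bump. Qed.

Lemma chi_support k x : k.+1%:R < nsq x -> chi k x = 0.
Proof.
move=> h; rewrite /chi /expbump /ball_gauge ifF ?mulr0//; apply/negbTE; rewrite -leNgt.
by rewrite subr_le0 ler_pdivlMr ?ltr0n// mul1r ltW.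
Qed.

(** Every derivative of the gauge brings out a factor 1/(k+1), and the mean value theorem does the
    same for [chi k - 1]. The price is the weight 1 + |x|^2, uniform in [k]. *)
Lemma chi_bound : exists2 C, 0 <= C & forall k x,
  [/\ `|chi k x - 1| <= C / k.+1%:R * (1 + nsq x),
      forall i, `|partial i (chi k) x| <= C / k.+1%:R * (1 + nsq x) &
      forall i, `|partial i (partial i (chi k)) x| <= C / k.+1%:R * (1 + nsq x)].
Proof.
have [C1 C10 C1P] := expbump_bounded (@expbump_deriv R 1).
have [C2 C20 C2P] := expbump_bounded (expbump_deriv (@expbump_deriv R 1)).
have e0 : 0 <= expR 1 :> R by exact: expR_ge0.
(* The second derivative dictates the constant: differentiating the gauge gives -2 x_i / (k+1),
   whence the bound e / (k+1) (2 C1 + 4 C2 |x|^2). *)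
exists (expR 1 * (2 * C1 + 4 * C2)); first by rewrite mulr_ge0// addr_ge0// mulr_ge0.
move=> k x; have kp : 0 < k.+1%:R^-1 :> R by rewrite invr_gt0 ltr0n.
have k1 : k.+1%:R^-1 <= 1 :> R by rewrite invf_le1 ?ltr0n// ler1n.
have ns := nsq_ge0 x.
have Echi : chi k = (fun x => expR 1 * (fun y => expbump 1 (ball_gauge k y)) x) by [].
have [_ _ dbump _] := cutoff_atomP (atom_bump 1 k).
have [_ _ dbump1 _] := cutoff_atomP (atom_bump (expbump_deriv 1) k).
have dcoord i : forall y, derivable (fun z : 'rV[R]_n => z 0 i) y (e_ i).
  by move=> y; have [] := is_derive_coord i i y.
have P1 i : partial i (chi k) = fun y => (expR 1 * - (2 / k.+1%:R)) *
    (y 0 i * expbump (expbump_deriv 1) (ball_gauge k y)).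
  rewrite Echi partialM//.
  by rewrite partial_expbump partial_cst; apply/funext => y; ring.
have P2 i : partial i (partial i (chi k)) = fun y => (expR 1 * - (2 / k.+1%:R)) *
    (expbump (expbump_deriv 1) (ball_gauge k y) +
     y 0 i * (- (2 / k.+1%:R) * (y 0 i * expbump (expbump_deriv (expbump_deriv 1)) (ball_gauge k y)))).
  rewrite P1 partialM; last 2 first.
  - by move=> y; exact: derivable_cst.
  - by move=> y; exact: (@derivableM R _ (fun z : 'rV[R]_n => z 0 i) _ y (e_ i)).
  rewrite partial_cst partialM// partial_expbump; apply/funext => y.
  have -> : partial i (fun z : 'rV[R]_n => z 0 i) y = 1.
    by rewrite /partial; have [_ ->] := is_derive_coord i i y; rewrite eqxx.
  ring.
have k0 : 0 <= k.+1%:R^-1 :> R := ltW kp.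
split.
- pose s := nsq x / k.+1%:R; have s0 : 0 <= s by rewrite mulr_ge0// ltW.
  have [c _ cE] : exists2 c, c \in `[1 - s, 1] &
      expbump 1 1 - expbump 1 (1 - s) = expbump (@expbump_deriv R 1) c * (1 - (1 - s)).
    apply: MVT_segment; first by rewrite gerBl.
      by move=> c _; exact: is_derive_expbump.
    by apply: continuous_subspaceT; exact: continuous_expbump.
  have -> : chi k x - 1 = - (expR 1 * (expbump (expbump_deriv 1) c * s)).
    have b1 : expR 1 * expbump 1 1 = 1 :> R.
      by rewrite /expbump ltr01 hornerC mul1r invr1 -expRD subrr expR0.
    rewrite opprB addrCA subrr addr0 in cE; rewrite -cE mulrBr b1 /chi /ball_gauge -/s; ring.
  rewrite normrN normrM ger0_norm// -!mulrA ler_wpM2l// normrM [`|s|]ger0_norm//.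
  have := C1P c; have := normr_ge0 (expbump (expbump_deriv 1) c); set b := `|_| => b0 bC.
  have -> : b * s = k.+1%:R^-1 * (b * nsq x) by rewrite /s; ring.
  rewrite [in leRHS]mulrCA ler_wpM2l//.
  have : b * nsq x <= C1 * nsq x by rewrite ler_wpM2r.
  have := mulr_ge0 C10 ns; have := mulr_ge0 C20 ns; nra.
- move=> i; rewrite P1 !normrM normrN [`|expR 1|]ger0_norm// [`|2 / _|]ger0_norm ?divr_ge0//.
  rewrite -!mulrA ler_wpM2l//.
  have := C1P (ball_gauge k x); have := coord_le_nsq x i.
  have := normr_ge0 (x 0 i); have := normr_ge0 (expbump (expbump_deriv 1) (ball_gauge k x)).
  set a := `|x 0 i|; set b := `|expbump _ _| => b0 a0 h1 h2.
  rewrite [in leLHS]mulrCA [in leRHS]mulrCA ler_wpM2l//.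
  have : a * b <= (1 + nsq x) * C1 by exact: ler_pM.
  have := mulr_ge0 C10 ns; have := mulr_ge0 C20 ns; nra.
- move=> i; rewrite P2 !normrM normrN [`|expR 1|]ger0_norm// [`|2 / _|]ger0_norm ?divr_ge0//.
  rewrite -!mulrA ler_wpM2l// [in leLHS]mulrCA [in leRHS]mulrCA ler_wpM2l//.
  apply: le_trans (ler_wpM2l _ (ler_normD _ _)) _ => //.
  rewrite !normrM normrN normrM [`|k.+1%:R^-1|]gtr0_norm// [`|2|]ger0_norm//.
  have := C1P (ball_gauge k x); have := C2P (ball_gauge k x).
  have := coord_sqr_le_nsq x i; rewrite -real_normK ?num_real//.
  have := normr_ge0 (x 0 i); have := normr_ge0 (expbump (expbump_deriv 1) (ball_gauge k x)).
  have := normr_ge0 (expbump (expbump_deriv (expbump_deriv 1)) (ball_gauge k x)).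
  set a := `|x 0 i|; set b := `|expbump _ _|; set c := `|expbump (expbump_deriv 1) _| => b0 c0 a0 h1 h2 h3.
  have h4 : a ^+ 2 * b <= nsq x * C2 by apply: ler_pM => //; exact: sqr_ge0.
  have h5 : a * (2 * k.+1%:R^-1 * (a * b)) <= 2 * (nsq x * C2).
    have -> : a * (2 * k.+1%:R^-1 * (a * b)) = k.+1%:R^-1 * (2 * (a ^+ 2 * b)) by ring.
    apply: (@le_trans _ _ (1 * (2 * (a ^+ 2 * b)))).
      by rewrite ler_wpM2r// mulr_ge0// mulr_ge0// sqr_ge0.
    by rewrite mul1r ler_wpM2l.
  move: h5; set Z := a * _ => h5.
  have := mulr_ge0 C10 ns; have := mulr_ge0 C20 ns; nra.
Qed.

Section approximation.
Variables (G : 'rV[R]_n -> R) (A : 'M[R]_n) (h : R).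
Hypothesis cG : continuous G.
Hypothesis rG : rapid G.
Hypothesis dG : forall i x, derivable G x (e_ i).
Hypothesis pG : forall i, exists2 f, calg f & partial i G = (fun x => f x * G x).
Local Notation cralg := (ralg cutoff_atom G).

Lemma cralgP f : cralg f -> [/\ continuous f, rapid f,
  forall i x, derivable f x (e_ i) & forall i, cralg (partial i f)].
Proof. exact: (ralgP cutoff_atomP cG rG dG pG). Qed.

Lemma cralg_schwartz f : cralg f -> schwartz f.
Proof. exact: (ralg_schwartz cutoff_atomP cG rG dG pG). Qed.

Lemma cutoff_Cc f1 f2 k : cralg f1 -> cralg f2 ->
  Cc_smooth (cplx (fun x => chi k x * f1 x) (fun x => chi k x * f2 x)).
Proof.
move=> rf1 rf2; have s1 f : cralg f -> smooth (fun x => chi k x * f x).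
  move=> rf; suff /cralg_schwartz[] : cralg (fun x => chi k x * f x) by [].
  by apply: ralg_mulr => //; exact: alg_chi.
split; [exact: s1|exact: s1|].
pose B := [set x | nsq x <= k.+1%:R].
have clB : closed B.
  rewrite (_ : B = nsq @^-1` [set t | t <= k.+1%:R]) //.
  by apply: closed_comp; [move=> x _; exact: continuous_nsq|exact: closed_le].
have cB : compact B.
  apply: bounded_closed_compact => //.
  exists (1 + k.+1%:R); split; first exact: num_real.
  move=> M hM x Bx; apply: rV_norm_le.
    by rewrite (le_trans _ (ltW hM))// addr_ge0.
  move=> i; apply: le_trans (coord_le_nsq x i) _; apply: le_trans _ (ltW hM).
  by rewrite lerD2l.
apply: (subclosed_compact _ cB); first exact: closed_closure.
rewrite closureE; apply: smallest_sub => // x /= fx.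
rewrite /B/= leNgt; apply: contra fx => /chi_support c0.
by rewrite /cplx c0 !mul0r.
Qed.

Lemma sqnorm_vanish (g : nat -> 'rV[R]_n -> R) F C : 0 <= C ->
  (forall k, sqint mu (g k)) -> sqint mu F ->
  (forall k x, `|g k x| <= C / k.+1%:R * `|F x|) ->
  (fun k => ip mu (g k) (g k)) @ \oo --> 0.
Proof.
move=> C0 sg sF gF.
have H : (fun k => (C ^+ 2 * ip mu F F) * k.+1%:R^-1) @ \oo --> (0 : R).
  by rewrite -(mulr0 (C ^+ 2 * ip mu F F)); apply: cvgMr; exact: cvg_harmonic.
apply: (squeeze_cvgr _ (cvg_cst 0) H); apply: nearW => k; rewrite ip_ge0/=.
have k0 : 0 < k.+1%:R^-1 :> R by rewrite invr_gt0 ltr0n.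
have k1 : k.+1%:R^-1 <= 1 :> R by rewrite invf_le1 ?ltr0n// ler1n.
apply: (@le_trans _ _ ((C / k.+1%:R) ^+ 2 * ip mu F F)).
  have [_ i1] := sg k; have [_ i2] := sF.
  rewrite !ipE -RintegralZl//; apply: le_Rintegral => //.
    exact: (rintZ _ i2).
  move=> x _; rewrite -!expr2 -[leLHS]real_normK ?num_real// -[F x ^+ 2]real_normK ?num_real//.
  by rewrite -exprMn ler_pXn2r ?nnegrE// mulr_ge0// divr_ge0.
rewrite exprMn mulrAC ler_wpM2l ?mulr_ge0 ?sqr_ge0 ?ip_ge0//.
by rewrite expr2 ler_piMl// ltW.
Qed.

(** By Leibniz's rule the error is [(chi k - 1) * schrod A h f] plus terms where a derivative falls
    on [chi k]. Each carries the factor (1 + |x|^2) / (k+1), and the decay of f and its derivatives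
    absorbs the quadratic weight. *)
Lemma cutoff_cvg f : cralg f ->
  (fun k => ip mu (fun x => chi k x * f x - f x) (fun x => chi k x * f x - f x)) @ \oo --> 0 /\
  (fun k => ip mu (fun x => schrod A h (fun y => chi k y * f y) x - schrod A h f x)
      (fun x => schrod A h (fun y => chi k y * f y) x - schrod A h f x)) @ \oo --> 0.
Proof.
move=> rf; have [C C0 CP] := chi_bound.
have sf := cralg_schwartz rf; have sf2 := schwartz_sqint sf.
have rchi k : cralg (fun x => chi k x * f x) by apply: ralg_mulr => //; exact: alg_chi.
have sqchi k := schwartz_sqint (cralg_schwartz (rchi k)).
have [cf rpf df pf] := cralgP rf.
have tn : tempered (fun x : 'rV[R]_n => 1 + nsq x).
  apply: temperedD; first exact: tempered_cst.
  rewrite /nsq; elim: (index_enum _) => [|i s IH].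
    by under eq_fun do rewrite big_nil; exact: tempered_cst.
  under eq_fun do rewrite big_cons expr2; apply: temperedD => //.
  by apply: temperedM; exact: tempered_coord.
have mn : measurable_fun setT (fun x : 'rV[R]_n => 1 + nsq x).
  by apply: measurable_funD => //; exact: continuous_measurable_rV continuous_nsq.
have n1 x : 0 <= 1 + nsq x by rewrite addr_ge0// nsq_ge0.
have abs_rapid (g : 'rV[R]_n -> R) : rapid g -> rapid (fun x => `|g x|).
  by move=> rg a; have [D gD] := rg a; exists D => x; rewrite normr_id.
split.
  apply: (@sqnorm_vanish _ (fun x => (1 + nsq x) * f x) C) => //.
  - by move=> k; exact: sqintB.
  - apply: rapid_sqint; last exact: rapid_mul.
    by apply: measurable_funM => //; exact: schwartz_measurable.
  - move=> k x; rewrite -{2}[f x]mul1r -mulrBl !normrM [`|1 + _|]ger0_norm// mulrA.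
    by rewrite ler_wpM2r//; have [] := CP k x.
pose F x := (1 + nsq x) * (`|schrod A h f x| + \sum_i (`|f x| + `|partial i f x|)).
have rs : rapid (schrod A h f).
  rewrite /schrod; apply: rapidD; last by apply: rapid_mul => //; exact: tempered_qform.
  by apply: rapidZ; apply: rapid_sum => i; exact: schwartz_rapid (schwartz_partial i (schwartz_partial i sf)).
have ms : measurable_fun setT (schrod A h f) by case: (schrod_sqint A h sf).
have mp i : measurable_fun setT (partial i f) by exact: schwartz_measurable (schwartz_partial i sf).
have mf : measurable_fun setT f by exact: schwartz_measurable.
have sF : sqint mu F.
  apply: rapid_sqint.
    apply: measurable_funM => //; apply: measurable_funD; first exact: measurableT_comp.
    by apply: measurable_sum => i; apply: measurable_funD; exact: measurableT_comp.
  apply: rapid_mul => //; apply: rapidD; first exact: abs_rapid.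
  apply: rapid_sum => i; apply: rapidD; apply: abs_rapid => //.
  exact: schwartz_rapid (schwartz_partial i sf).
apply: (@sqnorm_vanish _ F (C * (1 + 2 * h ^+ 2))) => //.
- by rewrite mulr_ge0// addr_ge0// mulr_ge0// sqr_ge0.
- move=> k; apply: sqintB; last exact: (schrod_sqint A h sf).
  exact: (schrod_sqint A h (cralg_schwartz (rchi k))).
move=> k x; have [c0 c1 c2] := CP k x.
have [_ _ dchi pchi] := algP cutoff_atomP (alg_chi k).
have E i : partial i (partial i (fun y => chi k y * f y)) x =
    partial i (partial i (chi k)) x * f x + 2 * (partial i (chi k) x * partial i f x)
    + chi k x * partial i (partial i f) x.
  rewrite (partialM (dchi i) (df i)).
  have [_ _ dpchi _] := algP cutoff_atomP (pchi i).
  have [_ _ dpf _] := cralgP (pf i).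
  rewrite partialD; last 2 first.
  - by move=> y; exact: (@derivableM R _ (partial i (chi k)) f y (e_ i)).
  - by move=> y; exact: (@derivableM R _ (chi k) (partial i f) y (e_ i)).
  have E1 := congr1 (fun g => g x) (partialM (dpchi i) (df i)).
  have E2 := congr1 (fun g => g x) (partialM (dchi i) (dpf i)).
  apply: etrans (congr2 +%R E1 E2) _; rewrite /=.
  set a1 := partial i (partial i (chi k)) x; set a2 := partial i (chi k) x.
  set a3 := partial i (partial i f) x; set a4 := partial i f x.
  ring.
have -> : schrod A h (fun y => chi k y * f y) x - schrod A h f x =
    (chi k x - 1) * schrod A h f x - h ^+ 2 * \sum_i (partial i (partial i (chi k)) x * f x +
      2 * (partial i (chi k) x * partial i f x)).
  have EL : lap (fun y => chi k y * f y) x = (\sum_i (partial i (partial i (chi k)) x * f x +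
      2 * (partial i (chi k) x * partial i f x))) + chi k x * lap f x.
    by rewrite /lap mulr_sumr -big_split/=; apply: eq_bigr => i _; exact: E.
  have alg (a q c S L t : R) :
      - a * (S + c * L) + q * (c * t) - (- a * L + q * t) = (c - 1) * (- a * L + q * t) - a * S.
    by ring.
  by rewrite /schrod EL; exact: alg.
have F0 : 0 <= `|schrod A h f x| + \sum_i (`|f x| + `|partial i f x|).
  by rewrite addr_ge0// sumr_ge0// => i _; rewrite addr_ge0.
rewrite [`|F x|]ger0_norm; last by rewrite mulr_ge0.
set K := C / k.+1%:R * (1 + nsq x) in c0 c1 c2.
have K0 : 0 <= K by exact: le_trans (normr_ge0 _) c0.
set S := \sum_i (`|f x| + `|partial i f x|) in F0 *.
have S0 : 0 <= S by rewrite sumr_ge0// => i _; rewrite addr_ge0.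
have hS : `|\sum_i (partial i (partial i (chi k)) x * f x +
      2 * (partial i (chi k) x * partial i f x))| <= 2 * (K * S).
  rewrite mulrA /S mulr_sumr; apply: le_trans (ler_norm_sum _ _ _) _; apply: ler_sum => i _.
  apply: le_trans (ler_normD _ _) _; rewrite !normrM mulrDr [`|2|]ger0_norm//.
  apply: lerD; last by rewrite -mulrA ler_wpM2l// ler_wpM2r.
  rewrite ler_wpM2r//; apply: le_trans (c2 i) _; lra.
have -> : C * (1 + 2 * h ^+ 2) / k.+1%:R * F x = K * `|schrod A h f x| + h ^+ 2 * (2 * (K * S))
    + (K * S + 2 * h ^+ 2 * (K * `|schrod A h f x|)).
  by rewrite /F /K -/S; ring.
apply: le_trans (ler_normB _ _) _; rewrite (normrM (chi k x - 1)) (normrM (h ^+ 2)).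
rewrite (ger0_norm (sqr_ge0 h)).
rewrite -[leLHS]addr0; apply: lerD; last first.
  apply: addr_ge0; first exact: mulr_ge0.
  by apply: mulr_ge0; [apply: mulr_ge0 => //; exact: sqr_ge0|exact: mulr_ge0].
by apply: lerD; [rewrite ler_wpM2r|rewrite ler_wpM2l ?sqr_ge0].
Qed.

Lemma opP_ralg f1 f2 : cralg f1 -> cralg f2 ->
  opP A h (cplx f1 f2) (cplx (schrod A h f1) (schrod A h f2)).
Proof.
move=> rf1 rf2.
have sq f : cralg f -> sqint mu f by move=> rf; exact: schwartz_sqint (cralg_schwartz rf).
have ss f : cralg f -> sqint mu (schrod A h f) by move=> rf; exact: schrod_sqint (cralg_schwartz rf).
have L1 : L2 (cplx f1 f2) by apply/L2P; split; exact: sq.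
have L2' : L2 (cplx (schrod A h f1) (schrod A h f2)) by apply/L2P; split; exact: ss.
have [c1 d1] := cutoff_cvg rf1; have [c2 d2] := cutoff_cvg rf2.
split => //; exists (fun k => cplx (fun x => chi k x * f1 x) (fun x => chi k x * f2 x)).
have Cc k := cutoff_Cc k rf1 rf2.
split => //.
- apply: L2norm_reim_cvg.
  + by move=> k; apply: L2B => //; exact: (Cc_L2 A h (Cc k)).1.
  + by under eq_fun do rewrite reFB.
  + by under eq_fun do rewrite imFB.
- apply: L2norm_reim_cvg.
  + by move=> k; apply: L2B => //; exact: (Cc_L2 A h (Cc k)).2.
  + by under eq_fun do rewrite reFB reF_schrod.
  + by under eq_fun do rewrite imFB imF_schrod.
Qed.

End approximation.

End cutoff.

(** * Functions with vanishing moments *)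

(** The cubic has fixed points -1, 0 and 1, of which -1 and 1 attract the negative and the positive
    part of the interval: the sign is a limit of polynomials that stay bounded by 1. *)
Lemma sign_iterate_cvg (R : realType) (s : R) : -1 <= s <= 1 ->
  (fun m => iter m (fun t => (3 * t - t ^+ 3) / 2) s) @ \oo --> Num.sg s.
Proof.
set f := fun t : R => (3 * t - t ^+ 3) / 2.
have pos (t : R) : 0 < t <= 1 -> (fun m => iter m f t) @ \oo --> (1 : R).
  move=> /andP[t0 t1].
  (* Since 1 - f u = (1 - u) (2 - u - u^2) / 2 and the iterates stay above t, each step shrinks the
     gap to 1 by a factor at most 1 - t/2. *)
  have key m : t <= iter m f t <= 1 /\ 1 - iter m f t <= (1 - t / 2) ^+ m.
    elim: m => [|m [/andP[a b] c]] /=; first by rewrite lexx t1 expr0; split => //; lra.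
    set u := iter m f t in a b c *.
    have e1 : 1 - f u = (1 - u) * ((2 - u - u ^+ 2) / 2) by rewrite /f; field.
    have e2 : f u - u = u * (1 - u) * (1 + u) / 2 by rewrite /f; field.
    have p2 : 0 <= f u - u by rewrite e2 divr_ge0// !mulr_ge0//; lra.
    have p3 : u ^+ 2 <= 1 by rewrite expr_le1//; lra.
    have p1 : 0 <= 1 - f u by rewrite e1 mulr_ge0//; lra.
    split; first by apply/andP; split; lra.
    rewrite e1 [_ ^+ m.+1]exprS mulrC; apply: ler_pM => //; [|lra|]; have := sqr_ge0 u; lra.
  have cg : (fun m => 1 - (1 - t / 2) ^+ m) @ \oo --> (1 : R).
    rewrite -[X in _ --> X]subr0; apply: cvgB; first exact: cvg_cst.
    by apply: cvg_expr; rewrite ger0_norm; lra.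
  have nb : \forall m \near \oo, 1 - (1 - t / 2) ^+ m <= iter m f t <= 1.
    by apply: nearW => m; have [/andP[_ b] c] := key m; rewrite b andbT; lra.
  by apply: (squeeze_cvgr nb cg); exact: cvg_cst.
move=> /andP[sm sp]; have [s0|s0|->] := ltgtP s 0.
- rewrite ltr0_sg//.
  rewrite (_ : (fun m => _) = fun m => - iter m f (- s)).
    by apply: cvgN; apply: pos; lra.
  apply/funext => m; elim: m => [|m /= ->]; first by rewrite /= opprK.
  by rewrite /f; field.
- by rewrite gtr0_sg//; apply: pos; lra.
- rewrite sgr0 (_ : (fun m => _) = fun=> 0); first exact: cvg_cst.
  apply/funext => m; elim: m => [//|m /= ->].
  by rewrite /f expr0n/= mulr0 subr0 mul0r.
Qed.

(** A bound independent of [N]: the majorant for the sine series under the integral. *)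
Lemma sin_series_le (R : realType) (t : R) N : `|series (sin_coeff t) N| <= expR `|t|.
Proof.
apply: le_trans (ler_norm_sum _ _ _) _.
apply: (@le_trans _ _ (series (exp_coeff `|t|) N)).
  apply: ler_sum => k _; rewrite /sin_coeff /exp_coeff /= !normrM normfV !normrX normrN1 expr1n mulr1 !normr_nat.
  apply: ler_wpM2r; first by rewrite invr_ge0.
  by case: (odd k); rewrite ?normr1 ?normr0 ?mul1r// mul0r exprn_ge0.
apply: nondecreasing_cvgn_le.
  apply/nondecreasing_seqP => m; rewrite -[leLHS]addr0 /series/= big_nat_recr//=.
  by rewrite lerD2l exp_coeff_ge0.
exact: is_cvg_series_exp_coeff.
Qed.

(** Once |t| / (m+1) < pi, the sine has the sign of t. The sign of an unbounded variable is thus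
    reached through functions with values in [-1, 1], to which [sign_iterate_cvg] applies. *)
Lemma sg_sin_small_cvg (R : realType) (t : R) :
  (fun m => Num.sg (sin (m.+1%:R^-1 * t))) @ \oo --> Num.sg t.
Proof.
have pos (u : R) : 0 < u -> \forall m \near \oo, 0 < sin (m.+1%:R^-1 * u).
  move=> u0; have c0 : (fun m => m.+1%:R^-1 * u) @ \oo --> (0 : R).
    by rewrite -[X in _ --> X](mul0r u); apply: cvgMl; exact: cvg_harmonic.
  have : \forall m \near \oo, m.+1%:R^-1 * u < pi.
    by apply: cvgr_lt; [exact: c0|exact: pi_gt0].
  apply: filterS => m mp.
  by apply: sin_gt0_pi; rewrite mp mulr_gt0 ?invr_gt0.
have [t0|t0|->] := ltgtP t 0.
- rewrite ltr0_sg//; apply: cvg_near_cst.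
  have /pos : 0 < - t by rewrite oppr_gt0.
  apply: filterS => m; rewrite mulrN sinN oppr_gt0 => ?; exact: ltr0_sg.
- by rewrite gtr0_sg//; apply: cvg_near_cst; apply: filterS (pos _ t0) => m ?; exact: gtr0_sg.
- under eq_fun do rewrite mulr0 sin0 sgr0.
  by rewrite sgr0; exact: cvg_cst.
Qed.

Section moments.
Variables (R : realType) (n : nat) (w : 'rV[R]_n -> R).
Local Notation mu := (lebesgue_rV R n).
Local Notation poly_fun := (alg (fun f : 'rV[R]_n -> R => exists i, f = fun x => x 0 i)).
Hypothesis w_rint : forall f, measurable_fun setT f -> tempered f -> rint mu (fun x => w x * f x).
Hypothesis w_moments : forall f, poly_fun f -> \int[mu]_x (w x * f x) = 0.
Implicit Types (f g q Phi S : 'rV[R]_n -> R).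

Lemma poly_fun_tempered f : poly_fun f -> measurable_fun setT f /\ tempered f.
Proof.
elim=> {f} [c|_ [i ->]|f g _ [mf tf] _ [mg tg]|f g _ [mf tf] _ [mg tg]].
- by split; [exact: measurable_cst|exact: tempered_cst].
- by split; [exact: measurable_coord|exact: tempered_coord].
- by split; [exact: measurable_funD|exact: temperedD].
- by split; [exact: measurable_funM|exact: temperedM].
Qed.

(* The multipliers of the functions annihilated by all the moments of [w] form an
   algebra that contains the coordinates and is closed under dominated limits: it
   contains sin (c (x_i - a)) by power series, then sg (x_i - a), and therefore the
   indicator functions of the half-spaces and of all the measurable sets. *)
Definition moment_free Phi := [/\ measurable_fun setT Phi, tempered Phi &
  forall q, poly_fun q -> \int[mu]_x (w x * (q x * Phi x)) = 0].

Definition multiplier S := [/\ measurable_fun setT S, tempered S &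
  forall Phi, moment_free Phi -> moment_free (fun x => S x * Phi x)].

Lemma moment_free1 : moment_free (fun=> 1).
Proof.
split; [exact: measurable_cst|exact: tempered_cst|move=> q pq].
by under eq_Rintegral do rewrite mulr1; exact: w_moments.
Qed.

Lemma multiplier_integral S : multiplier S -> \int[mu]_x (w x * S x) = 0.
Proof.
move=> [_ _ /(_ _ moment_free1)[_ _ /(_ (fun=> 1) (alg_cst _ 1))]].
by under eq_Rintegral do rewrite mul1r mulr1.
Qed.

Lemma multiplier_poly q : poly_fun q -> multiplier q.
Proof.
move=> pq; have [mq tq] := poly_fun_tempered pq; split => // Phi [mP tP P0].
split; [exact: measurable_funM|exact: temperedM|move=> p pp].
under eq_Rintegral do rewrite [p _ * _]mulrA.
by apply: P0; exact: alg_mul.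
Qed.

Lemma multiplierM S S' : multiplier S -> multiplier S' -> multiplier (fun x => S x * S' x).
Proof.
move=> [mS tS PS] [mS' tS' PS']; split; [exact: measurable_funM|exact: temperedM|move=> Phi FP].
under eq_fun do rewrite -mulrA.
exact/PS/PS'.
Qed.

Lemma multiplierD S S' : multiplier S -> multiplier S' -> multiplier (fun x => S x + S' x).
Proof.
move=> [mS tS PS] [mS' tS' PS']; split; [exact: measurable_funD|exact: temperedD|move=> Phi FP].
have [m1 t1 P1] := PS _ FP; have [m2 t2 P2] := PS' _ FP.
have E : (fun x => (S x + S' x) * Phi x) = (fun x => S x * Phi x + S' x * Phi x).
  by apply/funext => x; rewrite mulrDl.
rewrite E; split; [exact: measurable_funD|exact: temperedD|move=> q pq].
have [mq tq] := poly_fun_tempered pq.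
under eq_Rintegral do rewrite !mulrDr.
rewrite RintegralD//; first by rewrite P1// P2// addr0.
- by apply: w_rint; [exact: measurable_funM|exact: temperedM].
- by apply: w_rint; [exact: measurable_funM|exact: temperedM].
Qed.

Lemma multiplier_cst (c : R) : multiplier (fun=> c).
Proof. exact/multiplier_poly/alg_cst. Qed.

Lemma multiplierZ (c : R) S : multiplier S -> multiplier (fun x => c * S x).
Proof. by move=> mS; apply: multiplierM => //; exact: multiplier_cst. Qed.

(** Dominated convergence: the bound on the [s k] is of exponential growth, so [w_rint] makes the
    majorant integrable, and all the integrals before the limit are 0. *)
Lemma multiplier_lim (s : nat -> 'rV[R]_n -> R) S (a C : R) : (forall k, multiplier (s k)) ->
  (forall k x, `|s k x| <= C * expR (a * l1 x)) -> (forall x, s ^~ x @ \oo --> S x) ->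
  multiplier S.
Proof.
move=> ms bs sS.
have mS : measurable_fun setT S.
  by apply: measurable_fun_cvg (fun x _ => sS x) => k; have [] := ms k.
have tS : tempered S.
  exists a, C => x; apply: (ler_cvg_to (cvg_norm (sS x)) (cvg_cst _)).
  by apply: nearW => k; exact: bs.
split => // Phi FP; have [mP tP P0] := FP.
split; [exact: measurable_funM|exact: temperedM|move=> q pq].
have [mq tq] := poly_fun_tempered pq.
pose B (x : 'rV[R]_n) : R := C * expR (a * l1 x).
have mB : measurable_fun setT B.
  apply: measurable_funM; first exact: measurable_cst.
  apply: measurableT_comp (@measurable_expR R) _.
  by apply: measurable_funM; [exact: measurable_cst|exact: measurable_l1].
have B0 x : 0 <= B x by apply: le_trans (bs 0%N x); exact: normr_ge0.
have tB : tempered B by exists a, C => x; rewrite ger0_norm ?B0.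
have iwq : rint mu (fun x => w x * (q x * (B x * Phi x))).
  apply: w_rint; first by do 2 apply: measurable_funM => //.
  by do 2 apply: temperedM => //.
have H1 k : measurable_fun setT (fun x => w x * (q x * (s k x * Phi x))).
  apply: rint_meas; apply: w_rint; have [mk tk _] := ms k.
    by do 2 apply: measurable_funM => //.
  by do 2 apply: temperedM => //.
have H2 x : (fun k => w x * (q x * (s k x * Phi x))) @ \oo --> w x * (q x * (S x * Phi x)).
  by apply: cvgMr; apply: cvgMr; apply: cvgMl; exact: sS.
have H3 : rint mu (fun x => `|w x * (q x * (B x * Phi x))|) by exact: integrable_norm iwq.
have H4 k x : `|w x * (q x * (s k x * Phi x))| <= `|w x * (q x * (B x * Phi x))|.
  rewrite !normrM ler_wpM2l// ler_wpM2l// ler_wpM2r//.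
  by rewrite -normrM [leRHS](ger0_norm (B0 x)); exact: bs.
have [_ cv] := dct H1 H2 H3 H4; apply: cvg_unique cv _ => //.
rewrite (_ : (fun k => _) = fun=> 0); first exact: cvg_cst.
by apply/funext => k; have [_ _ /(_ _ FP)[_ _]] := ms k; exact.
Qed.

Lemma multiplier_sum N (s : nat -> 'rV[R]_n -> R) : (forall k, multiplier (s k)) ->
  multiplier (fun x => \sum_(0 <= k < N) s k x).
Proof.
move=> ms; elim: N => [|N IH].
  by under eq_fun do rewrite big_nil; exact: multiplier_cst.
by under eq_fun do rewrite big_nat_recr//=; exact: multiplierD.
Qed.

Lemma multiplierX S k : multiplier S -> multiplier (fun x => S x ^+ k).
Proof.
move=> mS; elim: k => [|k IH]; first by under eq_fun do rewrite expr0; exact: multiplier_cst.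
by under eq_fun do rewrite exprS; exact: multiplierM.
Qed.

Lemma multiplier_affine i (c a : R) : multiplier (fun x => c * (x 0 i - a)).
Proof.
apply: multiplierZ; apply: multiplierD; last exact: multiplier_cst.
by apply: multiplier_poly; apply: alg_atom; exists i.
Qed.

(** The partial sums of the sine series are polynomials bounded by one exponential of [l1]; at this
    point integrability of w against polynomials alone would not suffice for the domination. *)
Lemma multiplier_sin i (c a : R) : multiplier (fun x => sin (c * (x 0 i - a))).
Proof.
apply: (@multiplier_lim (fun N x => series (sin_coeff (c * (x 0 i - a))) N) _
  `|c| (expR (`|c| * `|a|))).
- move=> N; apply: multiplier_sum => k; 
  have -> : (fun x : 'rV[R]_n => sin_coeff (c * (x 0 i - a)) k) = (fun x =>
      (odd k)%:R * (-1) ^+ k.-1./2 / k`!%:R * (c * (x 0 i - a)) ^+ k).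
    by apply/funext => x; rewrite /sin_coeff/= mulrAC.
  by apply: multiplierM; [exact: multiplier_cst|apply: multiplierX; exact: multiplier_affine].
- move=> N x; apply: le_trans (sin_series_le _ _) _.
  rewrite -expRD ler_expR normrM -mulrDr ler_wpM2l//.
  apply: le_trans (ler_normB _ _) _; rewrite addrC lerD2l; exact: l1_coord.
- by move=> x; rewrite sin.unlock; exact: is_cvg_series_sin_coeff.
Qed.

Lemma bounded_multiplier_lim (s : nat -> 'rV[R]_n -> R) S : (forall k, multiplier (s k)) ->
  (forall k x, `|s k x| <= 1) -> (forall x, s ^~ x @ \oo --> S x) -> multiplier S.
Proof.
move=> ms bs; apply: (@multiplier_lim s S 0 1) => // k x.
by rewrite mul0r expR0 mulr1; exact: bs.
Qed.

Lemma multiplier_sign_step S : multiplier S -> multiplier (fun x => (3 * S x - S x ^+ 3) / 2).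
Proof.
move=> mS; have -> : (fun x => (3 * S x - S x ^+ 3) / 2) = (fun x => 2^-1 * (3 * S x + -1 * S x ^+ 3)).
  by apply/funext => x; field.
by apply: multiplierZ; apply: multiplierD; apply: multiplierZ => //; exact: multiplierX.
Qed.

Lemma multiplier_sg S : multiplier S -> (forall x, `|S x| <= 1) ->
  multiplier (fun x => Num.sg (S x)).
Proof.
move=> mS bS; apply: (bounded_multiplier_lim
  (s := fun m x => iter m (fun t => (3 * t - t ^+ 3) / 2) (S x))).
- by elim=> [//|m IH] /=; exact: multiplier_sign_step.
- move=> m x; elim: m => [|m IH] /=; first exact: bS.
  move: (iter m _ _) IH => u; rewrite !ler_norml => /andP[u1 u2].
  (* These factorizations of 2 - (3u - u^3) and 2 + (3u - u^3) show that a step maps [-1, 1] into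
     itself. *)
  have e1 : 0 <= (1 - u) ^+ 2 * (2 + u) by rewrite mulr_ge0 ?sqr_ge0//; lra.
  have e2 : 0 <= (1 + u) ^+ 2 * (2 - u) by rewrite mulr_ge0 ?sqr_ge0//; lra.
  have E1 : (1 - u) ^+ 2 * (2 + u) = 2 - (3 * u - u ^+ 3) by ring.
  have E2 : (1 + u) ^+ 2 * (2 - u) = 2 + (3 * u - u ^+ 3) by ring.
  by apply/andP; split; lra.
- by move=> x; apply: sign_iterate_cvg; rewrite -ler_norml.
Qed.

Lemma multiplier_sg_coord i (a : R) : multiplier (fun x => Num.sg (x 0 i - a)).
Proof.
apply: (bounded_multiplier_lim (s := fun m x => Num.sg (sin (m.+1%:R^-1 * (x 0 i - a))))).
- move=> m; apply: multiplier_sg; first exact: multiplier_sin.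
  by move=> x; rewrite ler_norml sin_geN1 sin_le1.
- by move=> m x; rewrite normr_sg; case: (_ != 0).
- by move=> x; exact: sg_sin_small_cvg.
Qed.

Definition multiplier_set D := multiplier (\1_D : 'rV[R]_n -> R).

(** With s the sign of x_i - a, (s^2 + s) / 2 is 1 for s = 1 and 0 for s = 0 or s = -1. *)
Lemma multiplier_halfspace i (a : R) : multiplier_set [set x | a < x 0 i].
Proof.
rewrite /multiplier_set.
have -> : (\1_[set x : 'rV[R]_n | a < x 0 i] : 'rV[R]_n -> R) =
    (fun x => 2^-1 * (Num.sg (x 0 i - a) * Num.sg (x 0 i - a) + Num.sg (x 0 i - a))).
  apply/funext => x; rewrite indicE.
  rewrite (_ : (x \in _) = (a < x 0 i)); last by apply/idP/idP => [/set_mem|/mem_set].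
  have [p|p|p] := ltgtP a (x 0 i).
  - by rewrite gtr0_sg ?subr_gt0//=; field.
  - by rewrite ltr0_sg ?subr_lt0//=; field.
  - by rewrite p subrr sgr0/=; field.
apply: multiplierZ; apply: multiplierD; last exact: multiplier_sg_coord.
by apply: multiplierM; exact: multiplier_sg_coord.
Qed.

Lemma multiplier_setC D : multiplier_set D -> multiplier_set (~` D).
Proof.
rewrite /multiplier_set => mD.
have -> : (\1_(~` D) : 'rV[R]_n -> R) = (fun x => 1 + -1 * \1_D x).
  by apply/funext => x; rewrite !indicE in_setC; case: (x \in D) => /=; ring.
by apply: multiplierD; [exact: multiplier_cst|exact: multiplierZ].
Qed.

Lemma multiplier_setI D E : multiplier_set D -> multiplier_set E -> multiplier_set (D `&` E).
Proof.
rewrite /multiplier_set => mD mE; rewrite indicI; exact: multiplierM.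
Qed.

Lemma multiplier_bigcup (D : nat -> set 'rV[R]_n) : (forall k, multiplier_set (D k)) ->
  multiplier_set (\bigcup_k D k).
Proof.
move=> mD; pose U N := \bigcup_(k < N) D k.
have mU N : multiplier_set (U N).
  rewrite /U bigcup_mkord; elim: N => [|N IH].
    by rewrite big_ord0 /multiplier_set indic0; exact: multiplier_cst.
  rewrite big_ord_recr/= -[X in multiplier_set X]setCK setCU.
  by apply: multiplier_setC; apply: multiplier_setI; exact: multiplier_setC.
apply: (bounded_multiplier_lim (s := fun N => \1_(U N))) => //.
  by move=> N x; rewrite indicE; case: (_ \in _); rewrite ?normr1 ?normr0.
move=> x; rewrite indicE; have [xD|xD] := boolP (x \in \bigcup_k D k).
  move/set_mem : xD => [k _ xk]; apply: cvg_near_cst; near=> N.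
  rewrite indicE mem_set//; exists k => //=; near: N; exact: nbhs_infty_gt.
apply: cvg_near_cst; apply: nearW => N; rewrite indicE memNset// => -[k _ xk].
by move/negP : xD; apply; apply/mem_set; exists k.
Unshelve. all: end_near.
Qed.

(** Two nested generation arguments: the sigma-algebra on row vectors is generated by preimages of
    Borel sets under the coordinates, and the Borel sets by the rays ]a, +oo[. *)
Lemma multiplier_measurable D : measurable D -> multiplier_set D.
Proof.
have set0M : multiplier_set set0 by rewrite /multiplier_set indic0; exact: multiplier_cst.
apply: smallest_sub.
  split=> // [E ME|]; last exact: multiplier_bigcup.
  by rewrite setTD; exact: multiplier_setC.
rewrite -bigcup_seq => _ [i _ [B mB <-]]; rewrite setTI.
have {}mB : <<s @RGenOInfty.G R>> B by exact: (eq_ind _ (fun M => M B) mB _ (RGenOInfty.measurableE R)).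
move: B mB; apply: smallest_sub.
  split=> [|E ME|E ME]; rewrite /= ?preimage_set0//.
    by rewrite setTD preimage_setC; exact: multiplier_setC.
  by rewrite preimage_bigcup; exact: multiplier_bigcup.
move=> _ [a ->] /=.
rewrite (_ : _ @^-1` _ = [set x : 'rV[R]_n | a < x 0 i]); first exact: multiplier_halfspace.
by apply/seteqP; split => x /=; rewrite in_itv/= andbT.
Qed.

(** The integral of [w] over every measurable set is 0; take the set where w > 0, then the one where
    - w > 0. *)
Lemma moments_determine : {ae mu, forall x, w x = 0}.
Proof.
have iw : rint mu w.
  have := w_rint (measurable_cst (1 : R)) (tempered_cst _ 1).
  by under eq_fun do rewrite mulr1.
have mw := rint_meas iw.
have half (v : 'rV[R]_n -> R) : measurable_fun setT v -> rint mu v ->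
    (forall D, measurable D -> \int[mu]_x (v x * \1_D x) = 0) ->
    {ae mu, forall x, v x <= 0}.
  move=> mv iv v0; pose D := [set x | 0 < v x].
  have mD : measurable D.
    have := mv measurableT _ (measurable_itv `]0, +oo[); rewrite setTI.
    by congr measurable; apply/seteqP; split => x /=; rewrite in_itv/= andbT.
  have mvD : measurable_fun setT (fun x => v x * \1_D x).
    by apply: measurable_funM => //; exact: measurable_indic.
  have ivD : rint mu (fun x => v x * \1_D x).
    apply: rint_le mvD (integrable_norm iv) _ => x.
    by rewrite normrM ler_piMr// indicE; case: (_ \in _); rewrite ?normr1 ?normr0.
  have vD0 x : 0 <= v x * \1_D x.
    rewrite indicE; have [/set_mem/ltW xD|_] := boolP (x \in D); first by rewrite mulr1.
    by rewrite mulr0.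
  have I0 : (\int[mu]_x `|(v x * \1_D x)%:E| = 0)%E.
    under eq_integral => x _ do rewrite gee0_abs ?lee_fin//.
    by rewrite rint_EFin// v0.
  have m2 : measurable_fun setT (fun x => (v x * \1_D x)%:E) by exact/measurable_EFinP.
  have /(ae_eq_integral_abs mu measurableT m2) := I0.
  apply: filterS => x /(_ I) /eqP; rewrite eqe leNgt => /eqP vx; apply/negP => p.
  by move: vx; rewrite indicE mem_set// mulr1 => /eqP; rewrite gt_eqF.
have mD D : measurable D -> \int[mu]_x (w x * \1_D x) = 0.
  by move=> mD; exact/multiplier_integral/multiplier_measurable.
have h1 := half w mw iw mD.
have h2 : {ae mu, forall x, - w x <= 0}.
  apply: half; [exact: measurableT_comp|by under eq_fun do rewrite -mulN1r; exact: rintZ|].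
  move=> D mD'; under eq_Rintegral do rewrite -mulN1r -mulrA.
  rewrite RintegralZl ?mD ?mulr0//; apply: w_rint; first exact: measurable_indic.
  by have [] := multiplier_measurable mD'.
apply: filterS2 h1 h2 => x a b; lra.
Qed.

End moments.

(** * Hermite functions *)

(** The inverse of 1 plus the sum of the 1 / f k is such a bound, also over an empty index type. *)
Lemma finite_lower_bound (R : realFieldType) (n : nat) (f : 'I_n -> R) : (forall k, 0 < f k) ->
  exists2 c, 0 < c & forall k, c <= f k.
Proof.
move=> f0; have s0 : 0 < 1 + \sum_k (f k)^-1.
  by rewrite ltr_wpDr// sumr_ge0// => k _; rewrite invr_ge0 ltW.
exists (1 + \sum_k (f k)^-1)^-1; first by rewrite invr_gt0.
move=> k; rewrite invf_ple ?posrE// (bigD1 k)//= addrCA lerDl addr_ge0// sumr_ge0//.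
by move=> j _; rewrite invr_ge0 ltW.
Qed.

Lemma is_derive_prod (R : realType) (V : normedModType R) (I : eqType) (s : seq I)
    (f : I -> V -> R) (df : I -> R) (x v : V) : uniq s ->
  (forall k, is_derive x v (f k) (df k)) ->
  is_derive x v (fun y => \prod_(k <- s) f k y)
    (\sum_(l <- s) \prod_(k <- s) (if k == l then df k else f k x)).
Proof.
move=> us dfk; elim: s us => [|a s IH] /=.
  by move=> _; under eq_fun do rewrite big_nil; rewrite big_nil; exact: is_derive_cst.
move=> /andP[nas us]; under eq_fun do rewrite big_cons.
apply: is_derive_eq (is_deriveM (dfk a) (IH us)) _.
rewrite /GRing.scale/= big_cons addrC; congr (_ + _).
  rewrite big_cons eqxx mulrC; congr (_ * _); rewrite !big_seq; apply: eq_bigr => k ks.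
  by case: eqP => // E; rewrite -E ks in nas.
rewrite mulr_sumr !big_seq; apply: eq_bigr => l ls; rewrite big_cons.
by case: eqP => // E; rewrite E ls in nas.
Qed.

(** The induction step of [deriv_herm] in a generic ring: [q] and [dq] are a Hermite polynomial and
    its derivative, and [N] is 2 (m + 1). *)
Lemma herm_ring1 (S : comNzRingType) (a X q b dq : S) N :
  a * (a * (X * q) *+ 2 - b * dq + X * (a * q *+ N)) *+ 2 - b * (a * dq *+ N) =
  a * (a * (X * q) *+ 2 - b * dq) *+ (2 + N).
Proof.
have [c E] : exists c : S, forall z, z *+ N = z * c.
  by exists N%:R => z; rewrite mulr_natr.
by rewrite mulrnDr !E; ring.
Qed.

(** The computation behind [herm_ode]: b is h, c is w / h, [q] and [H] are consecutive Hermite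
    polynomials, and [M] is 2 (m + 1), so that H' = b c q M. *)
Lemma herm_ring2 (S : comNzRingType) (b c X q dq H M : S) : H = b * c * (X * q) *+ 2 - b * dq ->
  - (b * b) * (b * c * dq * M - c * (H + X * (b * c * q * M)) -
     c * (X * (b * c * q * M - c * (X * H)))) +
   b * c * (b * c) * (X * (X * H)) = b * (b * c) * (M + 1) * H.
Proof. by move=> ->; ring. Qed.

(** Serves to show that the nowhere vanishing Gaussian is not a null function. *)
Lemma lebesgue_rV_neq0 (R : realType) (m : nat) : lebesgue_rV R m setT != 0%E.
Proof.
elim: m => [|m IH] /=; first by rewrite diracT onee_neq0.
rewrite /cons_measure /pushforward preimage_setT -setXTT product_measure1E//.
rewrite mule_neq0//.
apply/eqP => L0; have := lebesgue_measure_itv (`[0, 1] : interval R).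
rewrite /= lte_fin ltr01 oppr0 adde0 (subset_measure0 _ _ _ L0)// => /esym/eqP.
by rewrite onee_eq0.
Qed.

Section hermite.
Variables (R : realType) (n : nat) (V : 'M[R]_n) (w : 'I_n -> R) (h : R).
Hypothesis VVT : V *m V^T = 1%:M.
Hypothesis VTV : V^T *m V = 1%:M.
Hypothesis w_gt0 : forall k, 0 < w k.
Hypothesis h_gt0 : 0 < h.
Local Notation mu := (lebesgue_rV R n).
Local Notation e_ i := (delta_mx 0 i : 'rV[R]_n).
Implicit Types (x : 'rV[R]_n) (i j k l : 'I_n) (p : 'I_n -> {poly R}) (q : {poly R}).

Definition normal_coord k x : R := \sum_i V k i * x 0 i.
Local Notation y := normal_coord.

Lemma orth_rows k l : \sum_i V k i * V l i = (k == l)%:R.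
Proof.
have := congr1 (fun M : 'M[R]_n => M k l) VVT; rewrite !mxE => <-.
by apply: eq_bigr => i _; rewrite mxE.
Qed.

Lemma orth_cols i j : \sum_k V k i * V k j = (i == j)%:R.
Proof.
have := congr1 (fun M : 'M[R]_n => M i j) VTV; rewrite !mxE => <-.
by apply: eq_bigr => k _; rewrite mxE.
Qed.

Lemma coord_normal x i : x 0 i = \sum_k V k i * y k x.
Proof.
under eq_bigr do rewrite mulr_sumr; rewrite exchange_big/=.
rewrite (eq_bigr (fun j => (i == j)%:R * x 0 j)) => [|j _]; last first.
  by rewrite -orth_cols mulr_suml; apply: eq_bigr => k _; rewrite mulrA.
by rewrite (bigD1 i)//= eqxx mul1r big1 ?addr0// => j /negPf; rewrite eq_sym => ->; rewrite mul0r.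
Qed.

Lemma nsq_normal x : nsq x = \sum_k y k x ^+ 2.
Proof.
rewrite /nsq (eq_bigr (fun i => \sum_k x 0 i * (V k i * y k x))) => [|i _]; last first.
  by rewrite -mulr_sumr -coord_normal expr2.
rewrite exchange_big/=; apply: eq_bigr => k _; rewrite expr2 [X in X * _]/y mulr_suml.
by apply: eq_bigr => i _; ring.
Qed.

(** The ground state of -h^2 d^2/dt^2 + w_k^2 t^2, with eigenvalue h w_k. *)
Definition gauss1 k (t : R) := expR (- (w k / (2 * h)) * t ^+ 2).

Definition gaussian x := \prod_k gauss1 k (y k x).
Local Notation G := gaussian.

Definition poly_normal p x := \prod_k (p k).[y k x].

Definition poly_gauss p x := \prod_k ((p k).[y k x] * gauss1 k (y k x)).
Local Notation F := poly_gauss.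

Lemma poly_gaussE p : F p = fun x => poly_normal p x * G x.
Proof. by apply/funext => x; rewrite /F big_split. Qed.

Definition upd p k q : 'I_n -> {poly R} := fun l => if l == k then q else p l.

(* Conjugation of d/dt by the Gaussian factor [gauss1 k] *)
Definition gderiv k q : {poly R} := q^`() - (w k / h)%:P * ('X * q).

Lemma is_derive_gauss1 k q (t : R) :
  is_derive t 1 (fun t => q.[t] * gauss1 k t) ((gderiv k q).[t] * gauss1 k t).
Proof.
have d2 : is_derive t 1 (fun t => - (w k / (2 * h)) * t ^+ 2) (- (w k / h) * t).
  apply: is_derive_eq.
  rewrite /GRing.scale/=; field; exact: lt0r_neq0.
have d3 := is_derive_compR d2 (is_derive_expR _).
apply: is_derive_eq (is_deriveM (is_derive_poly q t) d3) _.
rewrite /gderiv hornerD hornerN !hornerM hornerC hornerX /GRing.scale/= /gauss1.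
ring.
Qed.

Lemma is_derive_normal_coord i k x : is_derive x (e_ i) (y k) (V k i).
Proof.
have key (r : seq 'I_n) : is_derive x (e_ i) (fun z : 'rV[R]_n => \sum_(j <- r) V k j * z 0 j)
    (\sum_(j <- r) (V k j *: (j == i)%:R + x 0 j *: 0)).
  elim: r => [|j r IH].
    by under eq_fun do rewrite big_nil; rewrite big_nil; exact: is_derive_cst.
  under eq_fun do rewrite big_cons; rewrite big_cons.
  exact: (is_deriveD (is_deriveM (is_derive_cst (V k j : R) x (e_ i)) (is_derive_coord i j x)) IH).
apply: is_derive_eq (key (index_enum _)) _.
rewrite (bigD1 i)//= eqxx big1 ?addr0 => [|j /negPf ->]; last by rewrite /GRing.scale/= !mulr0 addr0.
by rewrite /GRing.scale/= mulr1 mulr0 addr0.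
Qed.

(** The Gaussian of coordinate k is kept and only its polynomial dropped, so that an operation on
    the k-th polynomial changes a single factor. *)
Definition rest p k x := gauss1 k (y k x) * \prod_(l | l != k) ((p l).[y l x] * gauss1 l (y l x)).

Lemma poly_gauss_upd p k q x : F (upd p k q) x = q.[y k x] * rest p k x.
Proof.
rewrite /F (bigD1 k)//= /upd eqxx -mulrA; congr (_ * (_ * _)).
by apply: eq_bigr => l /negPf ->.
Qed.

Lemma poly_gauss_rest p k x : F p x = (p k).[y k x] * rest p k x.
Proof. by rewrite /F (bigD1 k)//= -mulrA. Qed.

Lemma upd_upd p k q q' : upd (upd p k q) k q' = upd p k q'.
Proof. by apply/funext => l; rewrite /upd; case: eqP. Qed.

Lemma is_derive_poly_gauss p i x :
  is_derive x (e_ i) (F p) (\sum_l V l i * F (upd p l (gderiv l (p l))) x).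
Proof.
have d k := is_derive_compR (is_derive_normal_coord i k x) (is_derive_gauss1 k (p k) (y k x)).
apply: is_derive_eq (is_derive_prod (index_enum_uniq _) d) _.
apply: eq_bigr => l _; rewrite poly_gauss_upd (bigD1 l)//= eqxx /rest.
rewrite (eq_bigr (fun k => (p k).[y k x] * gauss1 k (y k x))) => [|k /negPf -> //].
ring.
Qed.

Lemma derivable_poly_gauss p i x : derivable (F p) x (e_ i).
Proof. by have [] := is_derive_poly_gauss p i x. Qed.

Lemma partial_poly_gauss p i :
  partial i (F p) = fun x => \sum_l V l i * F (upd p l (gderiv l (p l))) x.
Proof. by apply/funext => x; rewrite /partial; have [] := is_derive_poly_gauss p i x. Qed.

Lemma is_derive_lincomb (c : 'I_n -> R) (ps : 'I_n -> 'I_n -> {poly R}) i x :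
  is_derive x (e_ i) (fun z => \sum_l c l * F (ps l) z) (\sum_l c l * partial i (F (ps l)) x).
Proof.
elim: (index_enum _) => [|l s IH].
  by under eq_fun do rewrite big_nil; rewrite big_nil; exact: is_derive_cst.
under eq_fun do rewrite big_cons; rewrite big_cons.
have d1 := is_deriveM (is_derive_cst (c l : R) x (e_ i))
  (partialE (@derivable_poly_gauss (ps l) i x)).
apply: is_derive_eq (is_deriveD d1 IH) _.
by rewrite /GRing.scale/= mulr0 addr0.
Qed.

(** Orthonormality of the rows of [V] cancels the mixed second derivatives in the coordinates y_k,
    and each remaining one acts on a single polynomial. *)
Lemma lap_poly_gauss p x :
  lap (F p) x = \sum_k F (upd p k (gderiv k (gderiv k (p k)))) x.
Proof.
rewrite /lap.
under eq_bigr => i _.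
  rewrite partial_poly_gauss /partial.
  have [_ ->] := is_derive_lincomb (fun l => V l i) (fun l => upd p l (gderiv l (p l))) i x.
  under eq_bigr do rewrite partial_poly_gauss mulr_sumr.
  over.
rewrite exchange_big/=; apply: eq_bigr => k _.
rewrite exchange_big/= (bigD1 k)//= [X in _ + X]big1 ?addr0 => [|l lk]; last first.
  under eq_bigr do rewrite mulrA; rewrite -mulr_suml orth_rows eq_sym (negPf lk) mul0r//.
under eq_bigr do rewrite mulrA; rewrite -mulr_suml orth_rows eqxx mul1r upd_upd.
by rewrite {2}/upd eqxx.
Qed.

Lemma alg_sum_cutoff (I : Type) (s : seq I) (f : I -> 'rV[R]_n -> R) :
  (forall a : I, alg (@cutoff_atom R n) (f a)) ->
  alg (@cutoff_atom R n) (fun x => \sum_(a <- s) f a x).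
Proof.
move=> af; elim: s => [|a s IH].
  by under eq_fun do rewrite big_nil; exact: alg_cst.
by under eq_fun do rewrite big_cons; exact: alg_add.
Qed.

Lemma alg_normal_coord k : alg (@cutoff_atom R n) (y k).
Proof.
by apply: alg_sum_cutoff => i; apply: alg_scale; apply: alg_atom; exact: atom_coord.
Qed.

Lemma alg_poly_normal p : alg (@cutoff_atom R n) (poly_normal p).
Proof.
rewrite /poly_normal; elim: (index_enum _) => [|k s IH].
  by under eq_fun do rewrite big_nil; exact: alg_cst.
under eq_fun do rewrite big_cons; apply: alg_mul => //.
elim/poly_ind: (p k) => [|q c IHq].
  by under eq_fun do rewrite horner0; exact: alg_cst.
under eq_fun do rewrite hornerMXaddC.
by apply: alg_add; [apply: alg_mul => //; exact: alg_normal_coord|exact: alg_cst].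
Qed.

Lemma gaussianE : G = F (fun=> 1).
Proof. by apply/funext => x; apply: eq_bigr => k _; rewrite hornerC mul1r. Qed.

Lemma gaussian_gt0 x : 0 < G x.
Proof. by apply: prodr_gt0 => k _; exact: expR_gt0. Qed.

Lemma gaussian_derivable i x : derivable G x (e_ i).
Proof. by rewrite gaussianE; exact: derivable_poly_gauss. Qed.

Lemma gaussian_partial i :
  exists2 f, alg (@cutoff_atom R n) f & partial i G = (fun x => f x * G x).
Proof.
exists (fun x => \sum_l V l i * poly_normal (upd (fun=> 1) l (gderiv l 1)) x).
  by apply: alg_sum_cutoff => l; apply: alg_scale; exact: alg_poly_normal.
rewrite {1}gaussianE partial_poly_gauss; apply/funext => x; rewrite mulr_suml.
by apply: eq_bigr => l _; rewrite poly_gaussE mulrA.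
Qed.

Lemma gaussian_expE x : G x = expR (- \sum_k w k / (2 * h) * y k x ^+ 2).
Proof.
rewrite -sumrN expR_sum; apply: eq_bigr => k _; rewrite /gauss1 mulNr//.
Qed.

Lemma gaussian_continuous : continuous G.
Proof.
have aS : alg (@cutoff_atom R n) (fun x => - 1 * \sum_k w k / (2 * h) * y k x ^+ 2).
  apply: alg_scale; apply: alg_sum_cutoff => k; apply: alg_scale.
  by under eq_fun do rewrite expr2; apply: alg_mul; exact: alg_normal_coord.
have [cS _ _ _] := algP (@cutoff_atomP R n) aS.
rewrite (_ : G = fun x => expR (- 1 * \sum_k w k / (2 * h) * y k x ^+ 2)).
  by move=> x; apply: continuous_comp; [exact: cS|exact: continuous_expR].
by apply/funext => x; rewrite gaussian_expE mulN1r.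
Qed.

Lemma gaussian_rapid : rapid G.
Proof.
have [c c0 cP] : exists2 c, 0 < c & forall k, c <= w k / (2 * h).
  by apply: finite_lower_bound => k; rewrite divr_gt0// mulr_gt0.
(* Completing the square, a t <= a^2 / (4 c) + c t^2 in each of the n coordinates. *)
move=> a; exists (expR (n%:R * (a ^+ 2 / (4 * c)))) => x.
rewrite gtr0_norm ?gaussian_gt0// gaussian_expE -expRD ler_expR.
have h1 : c * nsq x <= \sum_k w k / (2 * h) * y k x ^+ 2.
  by rewrite nsq_normal mulr_sumr; apply: ler_sum => k _; rewrite ler_wpM2r// sqr_ge0.
have h2 : a * l1 x <= n%:R * (a ^+ 2 / (4 * c)) + c * nsq x.
  rewrite /l1 /nsq !mulr_sumr -[n in n%:R]card_ord mulr_natl -sumr_const -big_split/=.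
  apply: ler_sum => i _; rewrite -[x 0 i ^+ 2]real_normK ?num_real//.
  set t := `|_|; have c4 : 0 < 4 * c by rewrite mulr_gt0.
  rewrite -lerBlDr ler_pdivlMr//.
  have := sqr_ge0 (a - 2 * c * t); nra.
by rewrite lerNl; lra.
Qed.

Lemma poly_gauss_ralg p : ralg (@cutoff_atom R n) G (F p).
Proof. by rewrite poly_gaussE; apply: ralg_mul; exact: alg_poly_normal. Qed.

Lemma poly_gauss_schwartz p : schwartz (F p).
Proof.
exact: (cralg_schwartz gaussian_continuous gaussian_rapid gaussian_derivable gaussian_partial
  (poly_gauss_ralg p)).
Qed.

(** The derivative in the direction of the k-th row of [V]; as the rows are orthonormal, it
    differentiates y_k and no other y_l. *)
Definition dnormal k (f : 'rV[R]_n -> R) x := \sum_i V k i * partial i f x.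

Lemma dnormal_poly_gauss p k : dnormal k (F p) = F (upd p k (gderiv k (p k))).
Proof.
apply/funext => x; rewrite /dnormal.
under eq_bigr do rewrite partial_poly_gauss mulr_sumr.
rewrite exchange_big/= (bigD1 k)//= [X in _ + X]big1 ?addr0 => [|l lk]; last first.
  by under eq_bigr do rewrite mulrA; rewrite -mulr_suml orth_rows eq_sym (negPf lk) mul0r.
by under eq_bigr do rewrite mulrA; rewrite -mulr_suml orth_rows eqxx mul1r.
Qed.

Lemma ip_dnormal (f g : 'rV[R]_n -> R) k : schwartz f -> schwartz g ->
  ip mu (dnormal k f) g = - ip mu f (dnormal k g).
Proof.
move=> sf sg.
have expand (u v : 'rV[R]_n -> R) : schwartz u -> schwartz v ->
    ip mu (dnormal k u) v = \sum_i V k i * ip mu (partial i u) v.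
  move=> su sv; rewrite /dnormal ip_suml; last 2 first.
  - by move=> i; apply: sqintZ; exact: schwartz_sqint (schwartz_partial i su).
  - exact: schwartz_sqint.
  apply: eq_bigr => i _; apply: ipZl; last exact: schwartz_sqint.
  exact: schwartz_sqint (schwartz_partial i su).
apply: etrans (expand f g sf sg) _.
apply: etrans _ (congr1 -%R (etrans (esym (expand g f sg sf)) (ipC mu _ _))).
rewrite -sumrN; apply: eq_bigr => i _; rewrite -mulrN; congr (_ * _).
exact: (etrans (ip_partial i sf sg) (congr1 -%R (ipC mu _ _))).
Qed.

(** On these functions the double [gderiv] is [dnormal k] applied twice, and [dnormal k] is
    antisymmetric. This is symmetry in one normal coordinate at a time. *)
Lemma ip_gderiv2 p p' k :
  ip mu (F (upd p k (gderiv k (gderiv k (p k))))) (F p') =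
  ip mu (F p) (F (upd p' k (gderiv k (gderiv k (p' k))))).
Proof.
have E (q0 : 'I_n -> {poly R}) : F (upd q0 k (gderiv k (gderiv k (q0 k)))) = dnormal k (dnormal k (F q0)).
  have up q' : (upd q0 k q') k = q' by rewrite /upd eqxx.
  by rewrite !dnormal_poly_gauss upd_upd up.
rewrite (E p) (E p') {1}dnormal_poly_gauss.
have s1 := poly_gauss_schwartz (upd p k (gderiv k (p k))).
apply: etrans (ip_dnormal k s1 (poly_gauss_schwartz p')) _.
rewrite -dnormal_poly_gauss [dnormal k (F p')]dnormal_poly_gauss.
have s2 := poly_gauss_schwartz (upd p' k (gderiv k (p' k))).
apply: etrans (congr1 -%R (ip_dnormal k (poly_gauss_schwartz p) s2)) _.
by rewrite opprK.
Qed.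

(* Hermite polynomials for -h^2 d^2/dt^2 + w_k^2 t^2, up to normalization *)
Fixpoint herm k (m : nat) : {poly R} :=
  if m is m'.+1 then ((w k)%:P * ('X * herm k m')) *+ 2 - h%:P * (herm k m')^`() else 1.

Lemma hermS k m : herm k m.+1 = ((w k)%:P * ('X * herm k m)) *+ 2 - h%:P * (herm k m)^`().
Proof. by []. Qed.

Lemma deriv_herm k m : (herm k m.+1)^`() = ((w k)%:P * herm k m) *+ (2 * m.+1).
Proof.
elim: m => [|m IH].
  rewrite hermS derivB derivMn derivM derivC derivM derivX derivM derivC /= -polyC1 derivC.
  by rewrite deriv0 !(mul0r, mulr0, add0r, addr0, subr0, mul1r).
rewrite hermS derivB derivMn derivM derivC derivM derivX derivM derivC IH derivMn derivM derivC.
rewrite !mul0r !add0r mul1r [herm k m.+1]hermS.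
set a := (w k)%:P; set b := h%:P; set q := herm k m; set dq := q^`().
rewrite (_ : 2 * m.+2 = 2 + 2 * m.+1)%N; last by rewrite mulnS.
exact: herm_ring1.
Qed.

Lemma herm_ode k m : - (h ^+ 2)%:P * gderiv k (gderiv k (herm k m)) +
  (w k ^+ 2)%:P * ('X * ('X * herm k m)) = (h * w k * (2 * m%:R + 1))%:P * herm k m.
Proof.
have h0 := lt0r_neq0 h_gt0.
have E : (w k)%:P = h%:P * (w k / h)%:P :> {poly R} by rewrite -polyCM mulrCA divff ?mulr1.
have -> : (h * w k * (2 * m%:R + 1))%:P = h%:P * (w k)%:P * (2 * m%:R + 1) :> {poly R}.
  by rewrite !polyCM polyCD polyCM polyC1 !polyC_natr.
rewrite !expr2 !polyCM /gderiv.
set c := (w k / h)%:P in E *; set b := h%:P in E *.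
have dc : c^`() = 0 by rewrite derivC.
case: m => [|m].
  have d1 : (1 : {poly R})^`() = 0 by rewrite -polyC1 derivC.
  rewrite (_ : herm k 0 = 1)// !(derivB, derivM, derivX, d1, dc, deriv0) E; ring.
have HS := hermS k m; have dH := deriv_herm k m; rewrite E in HS dH.
move: (herm k m.+1) HS dH => H HS dH.
have ddH : (H^`())^`() = (b * c * (herm k m)^`()) *+ (2 * m.+1).
  by rewrite dH derivMn derivM derivM dc derivC !(mul0r, mulr0, add0r).
rewrite derivB ddH derivM dc mul0r add0r derivM derivX mul1r dH E.
have EM (z : {poly R}) : z *+ (2 * m.+1) = z * (2 * m.+1%:R) by rewrite -natrM mulr_natr.
rewrite !EM; exact: herm_ring2.
Qed.

Definition hermite_fun (a : {ffun 'I_n -> nat}) : 'rV[R]_n -> R := F (fun k => herm k (a k)).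
Local Notation psi := hermite_fun.

Definition energy (a : {ffun 'I_n -> nat}) : R := \sum_k h * w k * (2 * (a k)%:R + 1).

Lemma hermite_ode (a : {ffun 'I_n -> nat}) k x :
  - h ^+ 2 * F (upd (fun k => herm k (a k)) k (gderiv k (gderiv k (herm k (a k))))) x +
  w k ^+ 2 * y k x ^+ 2 * psi a x = h * w k * (2 * (a k)%:R + 1) * psi a x.
Proof.
rewrite poly_gauss_upd /psi (poly_gauss_rest _ k).
have := congr1 (fun q => q.[y k x]) (herm_ode k (a k)).
rewrite /= hornerD !hornerM !hornerN !hornerC !hornerX => E.
rewrite [RHS]mulrA -E; ring.
Qed.

Lemma schrod_hermite (A : 'M[R]_n) (a : {ffun 'I_n -> nat}) :
  (forall x, qform A x = \sum_k w k ^+ 2 * y k x ^+ 2) ->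
  schrod A h (psi a) = fun x => energy a * psi a x.
Proof.
move=> qA; apply/funext => x; rewrite /schrod lap_poly_gauss qA /energy !mulr_suml mulr_sumr.
by rewrite -big_split/=; apply: eq_bigr => k _; exact: hermite_ode.
Qed.

Definition incr (a : {ffun 'I_n -> nat}) k : {ffun 'I_n -> nat} :=
  [ffun j => if j == k then (a j).+1 else a j].

Definition decr (a : {ffun 'I_n -> nat}) k : {ffun 'I_n -> nat} :=
  [ffun j => if j == k then (a j).-1 else a j].

(** The recursion H_{m+1} = 2 w t H_m - h H_m' with H_m' = 2 m w H_{m-1}, solved for t H_m. When
    [a k = 0] the truncated predecessor leaves [a] unchanged, but its coefficient is 0. *)
Lemma hermite_three_term (a : {ffun 'I_n -> nat}) k x :
  y k x * psi a x = (2 * w k)^-1 * psi (incr a k) x + h * (a k)%:R * psi (decr a k) x.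
Proof.
have w0 : 2 * w k != 0 by rewrite mulf_neq0 ?pnatr_eq0// lt0r_neq0.
have E1 : psi (incr a k) x = (herm k (a k).+1).[y k x] * rest (fun k => herm k (a k)) k x.
  rewrite -poly_gauss_upd; apply: eq_bigr => l _; rewrite /upd ffunE.
  by case: eqP => // ->.
have E2 : psi (decr a k) x = (herm k (a k).-1).[y k x] * rest (fun k => herm k (a k)) k x.
  rewrite -poly_gauss_upd; apply: eq_bigr => l _; rewrite /upd ffunE.
  by case: eqP => // ->.
rewrite E1 E2 [psi a x](poly_gauss_rest _ k) hermS hornerD hornerN hornerMn !hornerM !hornerC hornerX.
set r := rest _ _ _; set t := y k x.
case: (a k) => [|m] /=.
  by rewrite -polyC1 derivC horner0 !hornerC mulr0 subr0 mul0r addr0 mulr2n; field; rewrite lt0r_neq0.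
rewrite -/(herm k m.+1) deriv_herm hornerMn hornerM hornerC -[_ *+ (2 * _)]mulr_natl natrM mulr2n.
by field; rewrite lt0r_neq0.
Qed.

(** In a coordinate k where [a] and [b] differ, the one-dimensional oscillators give distinct
    eigenvalues to the two functions, even if their total energies agree; symmetry of the second
    derivative along y_k concludes. *)
Lemma hermite_orth (a b : {ffun 'I_n -> nat}) : a != b -> ip mu (psi a) (psi b) = 0.
Proof.
move=> ab; have [k kab] : exists k, a k != b k.
  apply/existsP; apply: contraNT ab; rewrite negb_exists => /forallP e.
  by apply/eqP/ffunP => k; have := e k; rewrite negbK => /eqP.
have sa := schwartz_sqint (poly_gauss_schwartz (fun k => herm k (a k))).
have sb := schwartz_sqint (poly_gauss_schwartz (fun k => herm k (b k))).
have h0 : h ^+ 2 != 0 by rewrite expf_neq0// lt0r_neq0.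
pose c (d : {ffun 'I_n -> nat}) := h * w k * (2 * (d k)%:R + 1).
have key (d : {ffun 'I_n -> nat}) x :
    h ^+ 2 * F (upd (fun k => herm k (d k)) k (gderiv k (gderiv k (herm k (d k))))) x =
    w k ^+ 2 * y k x ^+ 2 * psi d x - c d * psi d x.
  by rewrite /c -hermite_ode; ring.
have s2 (d : {ffun 'I_n -> nat}) := schwartz_sqint
  (poly_gauss_schwartz (upd (fun k => herm k (d k)) k (gderiv k (gderiv k (herm k (d k)))))).
have I2 := ip_gderiv2 (fun k => herm k (a k)) (fun k => herm k (b k)) k.
have E1 := ipZl (h ^+ 2) (s2 a) sb.
have E2 := ipZl (h ^+ 2) (s2 b) sa.
have E3 : ip mu (fun x => h ^+ 2 * F (upd (fun k => herm k (a k)) k (gderiv k (gderiv k (herm k (a k))))) x) (psi b)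
   - ip mu (fun x => h ^+ 2 * F (upd (fun k => herm k (b k)) k (gderiv k (gderiv k (herm k (b k))))) x) (psi a) =
   (c b - c a) * ip mu (psi a) (psi b).
  rewrite !ipE -RintegralB//; [|exact: sqintM (sqintZ _ (s2 _)) _..].
  rewrite -RintegralZl//; last exact: sqintM.
  by apply: eq_Rintegral => x _; rewrite (key a) (key b); ring.
have E4 : ip mu (F (upd (fun k => herm k (b k)) k (gderiv k (gderiv k (herm k (b k)))))) (psi a) =
    ip mu (F (upd (fun k => herm k (a k)) k (gderiv k (gderiv k (herm k (a k)))))) (psi b).
  exact: (etrans (ipC mu _ _) (esym I2)).
rewrite E1 E2 E4 subrr in E3.
have cab : c b - c a != 0.
  rewrite /c -mulrBr mulf_neq0//; first by rewrite mulf_neq0// lt0r_neq0.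
  rewrite opprD addrACA subrr addr0 -mulrBr mulf_neq0 ?pnatr_eq0// subr_eq0 eqr_nat.
  by rewrite eq_sym.
by apply/eqP; have /esym/eqP := E3; rewrite mulf_eq0 (negPf cab).
Qed.

Lemma incrK k (a : {ffun 'I_n -> nat}) : decr (incr a k) k = a.
Proof. by apply/ffunP => j; rewrite !ffunE; case: eqP. Qed.

Lemma decrK k (a : {ffun 'I_n -> nat}) : (0 < a k)%N -> incr (decr a k) k = a.
Proof. by move=> ak; apply/ffunP => j; rewrite !ffunE; case: eqP => // ->; rewrite prednK. Qed.

Lemma hermite_schwartz (a : {ffun 'I_n -> nat}) : schwartz (psi a).
Proof. exact: poly_gauss_schwartz. Qed.

Lemma hermite_sqint (a : {ffun 'I_n -> nat}) : sqint mu (psi a).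
Proof. exact/schwartz_sqint/hermite_schwartz. Qed.

Lemma hermite0 : psi [ffun=> 0%N] = G.
Proof. by rewrite gaussianE; congr F; apply/funext => k; rewrite ffunE. Qed.

Lemma gaussian_norm_neq0 : ip mu G G != 0.
Proof.
apply/eqP => G0; have sG : sqint mu G by rewrite -hermite0; exact: hermite_sqint.
have [D [mD D0 sD]] := ip_eq0 sG G0.
suff : mu setT != 0%E.
  rewrite (_ : setT = D) ?D0 ?eqxx//; apply/seteqP; split => // x _.
  by apply: sD => /eqP; rewrite gt_eqF// gaussian_gt0.
exact: lebesgue_rV_neq0.
Qed.

(** Moving y_k across <y_k psi_a, psi_{a+1}> and expanding both sides by the three-term relation
    gives |psi_{a+1}|^2 / (2 w_k) = h (a_k + 1) |psi_a|^2. No norm has to be computed. *)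
Lemma incr_norm (a : {ffun 'I_n -> nat}) k : ip mu (psi a) (psi a) != 0 ->
  ip mu (psi (incr a k)) (psi (incr a k)) != 0.
Proof.
move=> a0; apply: contra_neq a0 => a10.
have neq (b c : {ffun 'I_n -> nat}) : b k != c k -> b != c by apply: contraNN => /eqP ->.
have exp (b c : {ffun 'I_n -> nat}) : ip mu (fun x => y k x * psi b x) (psi c) =
    (2 * w k)^-1 * ip mu (psi (incr b k)) (psi c) + h * (b k)%:R * ip mu (psi (decr b k)) (psi c).
  under eq_fun do rewrite hermite_three_term.
  rewrite ipDl; [|exact/sqintZ/hermite_sqint..|exact: hermite_sqint].
  by rewrite !ipZl//; exact: hermite_sqint.
have E1 := exp a (incr a k); have E2 := exp (incr a k) a.
have E : ip mu (fun x => y k x * psi a x) (psi (incr a k)) =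
         ip mu (fun x => y k x * psi (incr a k) x) (psi a).
  by rewrite !ipE; apply: eq_Rintegral => x _; ring.
rewrite a10 mulr0 add0r (@hermite_orth (decr a k)) ?mulr0 in E1; last first.
  by apply: neq; rewrite !ffunE eqxx; case: (a k) => // m; rewrite ltn_eqF//= ltnW.
rewrite (@hermite_orth (incr (incr a k) k)) ?mulr0 ?add0r in E2; last first.
  by apply: neq; rewrite !ffunE eqxx gtn_eqF//= ltnW.
rewrite incrK -E E1 ffunE eqxx in E2.
by move/esym/eqP : E2; rewrite mulf_eq0 mulf_eq0 pnatr_eq0 (gt_eqF h_gt0)/= => /eqP.
Qed.

Lemma hermite_norm_neq0 (a : {ffun 'I_n -> nat}) : ip mu (psi a) (psi a) != 0.
Proof.
have [m] := ubnP (\sum_k a k); elim: m a => // m IH a am.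
have [[k ak]|a0] := pselect (exists k, (0 < a k)%N).
  rewrite -(decrK ak); apply: incr_norm; apply: IH.
  rewrite ltnS in am; apply: leq_trans _ am; rewrite (bigD1 k)//= [X in (_ < X)%N](bigD1 k)//= ffunE eqxx.
  rewrite (eq_bigr a) => [|l /negPf lk]; last by rewrite ffunE lk.
  by rewrite -addSn leq_add2r prednK.
rewrite (_ : a = [ffun=> 0%N]) ?hermite0 ?gaussian_norm_neq0//.
apply/ffunP => k; rewrite ffunE; apply/eqP; rewrite -leqn0 leqNgt; apply/negP => ak.
by apply: a0; exists k.
Qed.

Inductive hermite_span : ('rV[R]_n -> R) -> Prop :=
| span_hermite a : hermite_span (psi a)
| span_zero : hermite_span (fun=> 0)
| span_add f g : hermite_span f -> hermite_span g -> hermite_span (fun x => f x + g x)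
| span_scale c f : hermite_span f -> hermite_span (fun x => c * f x).

Lemma span_sum (I : Type) (s : seq I) (f : I -> 'rV[R]_n -> R) :
  (forall i : I, hermite_span (f i)) -> hermite_span (fun x => \sum_(i <- s) f i x).
Proof.
move=> fP; elim: s => [|i s IH].
  by under eq_fun do rewrite big_nil; exact: span_zero.
by under eq_fun do rewrite big_cons; exact: span_add.
Qed.

Lemma span_normal_coord k f : hermite_span f -> hermite_span (fun x => y k x * f x).
Proof.
elim=> {f} [a||f g _ sf _ sg|c f _ sf].
- under eq_fun do rewrite hermite_three_term.
  by apply: span_add; apply: span_scale; exact: span_hermite.
- by under eq_fun do rewrite mulr0; exact: span_zero.
- by under eq_fun do rewrite mulrDr; exact: span_add.
- by under eq_fun do rewrite mulrCA; exact: span_scale.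
Qed.

Lemma span_coord i f : hermite_span f -> hermite_span (fun x => x 0 i * f x).
Proof.
move=> sf; under eq_fun do rewrite coord_normal mulr_suml.
apply: span_sum => k; under eq_fun do rewrite -mulrA.
exact/span_scale/span_normal_coord.
Qed.

Lemma span_poly f g : alg (fun f : 'rV[R]_n -> R => exists i, f = fun x => x 0 i) f ->
  hermite_span g -> hermite_span (fun x => f x * g x).
Proof.
move=> af; elim: af g => {f} [c|_ [i ->]|f f' _ sf _ sf'|f f' _ sf _ sf'] g sg.
- exact: span_scale.
- exact: span_coord.
- by under eq_fun do rewrite mulrDl; exact: span_add (sf _ sg) (sf' _ sg).
- by under eq_fun do rewrite -mulrA; exact: sf (sf' _ sg).
Qed.

Lemma span_orthogonal u f : sqint mu u -> (forall a, ip mu u (psi a) = 0) ->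
  hermite_span f -> sqint mu f /\ ip mu f u = 0.
Proof.
move=> su u0; elim=> {f} [a||f g _ [sf f0] _ [sg g0]|c f _ [sf f0]].
- by split; [exact: hermite_sqint|exact: (etrans (ipC mu _ _) (u0 a))].
- by split; [exact: sqint0|exact: ip0l].
- by split; [exact: sqintD|rewrite ipDl// f0 g0 addr0].
- by split; [exact: sqintZ|rewrite ipZl// f0 mulr0].
Qed.

(** [moments_determine] is applied to u G, whose Gaussian factor provides the integrability against
    exponential growth. The products of G with polynomials lie in the Hermite span, so the moments
    of u G vanish. *)
Lemma hermite_complete u : sqint mu u -> (forall a, ip mu u (psi a) = 0) ->
  {ae mu, forall x, u x = 0}.
Proof.
move=> su u0.
have : {ae mu, forall x, u x * G x = 0}.
  apply: moments_determine => [f mf tf|f pf].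
    under eq_fun do rewrite -mulrA.
    have mG : measurable_fun setT G by rewrite -hermite0; exact: schwartz_measurable (hermite_schwartz _).
    apply: sqintM => //; apply: rapid_sqint; first exact: measurable_funM.
    by under eq_fun do rewrite mulrC; apply: rapid_mul => //; exact: gaussian_rapid.
  have /(span_orthogonal su u0)[_ <-] : hermite_span (fun x => f x * G x).
    by apply: span_poly => //; rewrite -hermite0; exact: span_hermite.
  by rewrite ipE; apply: eq_Rintegral => x _; ring.
by apply: filterS => x /eqP; rewrite mulf_eq0 (gt_eqF (gaussian_gt0 x)) orbF => /eqP.
Qed.

End hermite.

(** * The spectrum of the oscillator *)

Section schrod_linear.
Variables (R : realType) (n : nat) (A : 'M[R]_n) (h : R).
Implicit Types (f g : 'rV[R]_n -> R).

Lemma schrodD f g : smooth f -> smooth g ->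
  schrod A h (fun x => f x + g x) = (fun x => schrod A h f x + schrod A h g x).
Proof.
move=> sf sg; apply/funext => x; rewrite /schrod.
have E : lap (fun x => f x + g x) x = lap f x + lap g x.
  rewrite /lap -big_split; apply: eq_bigr => i _ /=.
  rewrite (partialD (fun z => smooth_derivable sf) (fun z => smooth_derivable sg)).
  by rewrite (partialD (fun z => smooth_derivable (smooth_partial i sf))
                       (fun z => smooth_derivable (smooth_partial i sg))).
by rewrite E !mulrDr addrACA.
Qed.

Lemma partialZ (c : R) f i : smooth f -> partial i (fun x => c * f x) = (fun x => c * partial i f x).
Proof.
move=> sf.
rewrite (partialM (fun z => derivable_cst (c : R) z _) (fun z => smooth_derivable sf)).
by rewrite partial_cst; apply/funext => x; rewrite mul0r add0r.
Qed.

Lemma schrodZ (c : R) f : smooth f -> schrod A h (fun x => c * f x) = (fun x => c * schrod A h f x).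
Proof.
move=> sf; apply/funext => x; rewrite /schrod.
have E : lap (fun x => c * f x) x = c * lap f x.
  rewrite /lap mulr_sumr; apply: eq_bigr => i _.
  by rewrite (partialZ c i sf) (partialZ c i (smooth_partial i sf)).
by rewrite E; ring.
Qed.

End schrod_linear.

Lemma qform_diag (R : realType) n (A V : 'M[R]_n) (d : 'rV[R]_n) :
  V^T *m V = 1%:M -> V *m A = diag_mx d *m V ->
  forall x, qform A x = \sum_k d 0 k * normal_coord V k x ^+ 2.
Proof.
move=> VTV VA x; have AE i j : A i j = \sum_k V k i * (d 0 k * V k j).
  have -> : A = V^T *m (diag_mx d *m V) by rewrite -VA mulmxA VTV mul1mx.
  by rewrite mxE; apply: eq_bigr => k _; rewrite mul_diag_mx !mxE.
rewrite /qform (eq_bigr (fun i => \sum_k d 0 k * (V k i * x 0 i) * normal_coord V k x)); last first.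
  move=> i _; under eq_bigr do rewrite AE !mulr_suml.
  rewrite exchange_big/=; apply: eq_bigr => k _; rewrite /normal_coord mulr_sumr.
  by apply: eq_bigr => j _; ring.
rewrite exchange_big/=; apply: eq_bigr => k _.
by rewrite -mulr_suml -mulr_sumr expr2 mulrA.
Qed.

(** The k-th eigenvalue is the value of the form at the k-th row of [V], which is nonzero. *)
Lemma pos_def_diag (R : realType) n (A V : 'M[R]_n) (d : 'rV[R]_n) :
  V *m V^T = 1%:M -> V^T *m V = 1%:M -> V *m A = diag_mx d *m V -> pos_def A ->
  forall k, 0 < d 0 k.
Proof.
move=> VVT VTV VA pA k.
have yE l : normal_coord V l (row k V) = (l == k)%:R.
  by rewrite -(orth_rows VVT); apply: eq_bigr => i _; rewrite !mxE.
have r0 : row k V != 0.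
  apply/eqP => r0; have := yE k; rewrite r0 /normal_coord eqxx big1 => [/eqP|i _].
    by rewrite eq_sym oner_eq0.
  by rewrite mxE mulr0.
have := pA _ r0; rewrite (qform_diag VTV VA) (bigD1 k)//= yE eqxx expr1n mulr1.
by rewrite big1 ?addr0// => l /negPf lk; rewrite yE lk expr0n mulr0.
Qed.

Section oscillator.
Variables (R : realType) (n : nat) (A V : 'M[R]_n) (w : 'I_n -> R).
Hypothesis VVT : V *m V^T = 1%:M.
Hypothesis VTV : V^T *m V = 1%:M.
Hypothesis w_gt0 : forall k, 0 < w k.
Hypothesis qA : forall x, qform A x = \sum_k w k ^+ 2 * normal_coord V k x ^+ 2.
Local Notation mu := (lebesgue_rV R n).
Local Notation midx := {ffun 'I_n -> nat}.

(** Eigenfunctions are to be enumerated by [nat]; a number is decoded to the multi-index of which it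
    is the code, if there is one. *)
Definition multi_index (j : nat) : option midx := pickle_inv j.

Lemma multi_index_pickle (a : midx) : multi_index (pickle a) = Some a.
Proof. exact: pickleK_inv. Qed.

Lemma multi_indexE j (a : midx) : multi_index j = Some a -> j = pickle a.
Proof. by rewrite /multi_index => ja; have := @pickle_invK midx j; rewrite ja. Qed.

(** The sequence of the theorem, taken at h = 1. It must be total, so a code of no multi-index
    repeats the ground state energy, which adds no value to the set. *)
Definition level (j : nat) : R := energy w 1 (odflt [ffun=> 0%N] (multi_index j)).

Section fixed_h.
Variable h : R.
Hypothesis h_gt0 : 0 < h.
Local Notation G := (gaussian V w h).
Local Notation cralg := (ralg (@cutoff_atom R n) G).

(* The eigenfunctions enumerated by [nat]: the codes of no multi-index get the zero function. *)
Definition mode (j : nat) : 'rV[R]_n -> R :=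
  if multi_index j is Some a then hermite_fun V w h a else fun=> 0.

(** The default 0 goes with the zero function, which satisfies the eigenvalue equation for every
    value. *)
Definition mode_energy (j : nat) : R :=
  if multi_index j is Some a then energy w h a else 0.

Let cG : continuous G := @gaussian_continuous R n V w h.
Let rG : rapid G := gaussian_rapid VTV w_gt0 h_gt0.
Let dG i x : derivable G x (delta_mx 0 i) := @gaussian_derivable R n V w h h_gt0 i x.
Let pG := gaussian_partial V w h_gt0.

Lemma mode_ralg j : cralg (mode j).
Proof.
rewrite /mode; case: (multi_index j) => [a|]; first exact: poly_gauss_ralg.
have -> : (fun _ : 'rV[R]_n => 0 : R) = (fun x => 0 * G x) by apply/funext => x; rewrite mul0r.
exact/ralg_mul/alg_cst.
Qed.

Lemma mode_schwartz j : schwartz (mode j).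
Proof. exact: (cralg_schwartz cG rG dG pG (mode_ralg j)). Qed.

Lemma orthosum_ralg a k : cralg (orthosum mode a k).
Proof.
apply: ralg_sum => j; apply: ralg_mulr; last exact: mode_ralg.
exact: alg_cst.
Qed.

Lemma schrod_mode j : schrod A h (mode j) = fun x => mode_energy j * mode j x.
Proof.
have := mode_schwartz j; rewrite /mode /mode_energy.
case: (multi_index j) => [a _|[s0 _]]; first exact: (schrod_hermite VVT h_gt0 a qA).
rewrite [in LHS](_ : (fun=> 0) = (fun x : 'rV[R]_n => 0 * (fun=> 0) x)); last first.
  by apply/funext => x; rewrite mul0r.
by rewrite (schrodZ A h 0 s0); apply/funext => x; rewrite !mul0r.
Qed.

Lemma schrod_orthosum a k :
  schrod A h (orthosum mode a k) = orthosum mode (fun j => mode_energy j * a j) k.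
Proof.
elim: k => [|k IH].
  have [s0 _] : schwartz (orthosum mode a 0).
    exact: (cralg_schwartz cG rG dG pG (orthosum_ralg a 0)).
  have E c : orthosum mode c 0 = (fun x => 0 * orthosum mode a 0 x).
    by apply/funext => x; rewrite /orthosum big_ord0 mul0r.
  apply: etrans (congr1 (schrod A h) (E a)) _; rewrite (schrodZ A h 0 s0).
  by apply/funext => x; rewrite mul0r /orthosum big_ord0.
have E c : orthosum mode c k.+1 = (fun x => orthosum mode c k x + c k * mode k x).
  by apply/funext => x; rewrite /orthosum big_ord_recr.
have [s1 _] : schwartz (orthosum mode a k).
  exact: (cralg_schwartz cG rG dG pG (orthosum_ralg a k)).
have [s2 _] := mode_schwartz k.
have [s3 _] : schwartz (fun x => a k * mode k x).
  by apply: (cralg_schwartz cG rG dG pG); apply: ralg_mulr (alg_cst _ _) (mode_ralg k).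
rewrite E (schrodD A h s1 s3) IH (E (fun j => _)) (schrodZ A h (a k) s2) schrod_mode.
by apply/funext => x; ring.
Qed.

Lemma mode_sqint j : sqint mu (mode j).
Proof. exact/schwartz_sqint/mode_schwartz. Qed.

Lemma mode_orth (i j : nat) : i != j -> ip mu (mode i) (mode j) = 0.
Proof.
rewrite /mode; case ei: (multi_index i) => [a|]; last by move=> _; exact: ip0l.
case ej: (multi_index j) => [b|]; last by move=> _; rewrite ipC; exact: ip0l.
move=> ij; apply: (hermite_orth VVT VTV w_gt0 h_gt0).
by apply: contraNN ij => /eqP ab; rewrite (multi_indexE ei) (multi_indexE ej) ab.
Qed.

Lemma mode_complete u : sqint mu u -> (forall j, ip mu u (mode j) = 0) ->
  {ae mu, forall x, u x = 0}.
Proof.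
move=> su u0; apply: (hermite_complete VTV w_gt0 h_gt0 su) => a.
by have := u0 (pickle a); rewrite /mode multi_index_pickle.
Qed.

(** If every h w_k is at least c > 0, energy at most L forces a_k <= L / c for all k. This leaves
    finitely many multi-indices, whose codes have a maximum. *)
Lemma energy_finite (L : R) :
  exists M : nat, forall a : midx, energy w h a <= L -> (pickle a < M)%N.
Proof.
have [c c0 cP] : exists2 c, 0 < c & forall k, c <= h * w k.
  by apply: finite_lower_bound => k; rewrite mulr_gt0.
pose B := Num.bound (L / c).
pose emb (f : {ffun 'I_n -> 'I_B}) : midx := [ffun k => f k : nat].
exists (\max_f pickle (emb f)).+1 => a aL; rewrite ltnS.
have aB k : (a k < B)%N.
  have e0 l : 0 <= h * w l * (2 * (a l)%:R + 1).
    by rewrite mulr_ge0 ?addr_ge0 ?mulr_ge0 ?ler0n ?ltW.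
  have ck : c * (a k)%:R <= L.
    apply: le_trans aL; rewrite /energy (bigD1 k)//= -[leLHS]addr0.
    apply: lerD; last by apply: sumr_ge0 => l _; exact: e0.
    apply: ler_pM => //; [exact: ltW|have := ler0n R (a k); lra].
  have L0 : 0 <= L by apply: le_trans ck; apply: mulr_ge0; [exact: ltW|exact: ler0n].
  rewrite -(ltr_nat R); apply: le_lt_trans (archi_boundP _); last by rewrite divr_ge0// ltW.
  by rewrite ler_pdivlMr// mulrC.
have -> : a = emb [ffun k => Ordinal (aB k)] by apply/ffunP => k; rewrite !ffunE.
exact: leq_bigmax.
Qed.

Lemma mode_energy_oo (L : R) : exists M, forall j, (M <= j)%N -> mode_energy j <= L -> mode j = fun=> 0.
Proof.
have [M MP] := energy_finite L; exists M => j Mj; rewrite /mode_energy /mode.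
case ej: (multi_index j) => [a|//] aL; have := MP _ aL.
by rewrite -(multi_indexE ej) ltnNge Mj.
Qed.

Let T_L2 u f : opP A h u f -> L2 u /\ L2 f := @opP_L2 R n A h u f.

Let T_coef u f : opP A h u f -> forall j,
  ip mu (reF f) (mode j) = mode_energy j * ip mu (reF u) (mode j) /\
  ip mu (imF f) (mode j) = mode_energy j * ip mu (imF u) (mode j).
Proof. by move=> Tuf j; exact: (opP_eigen_coef (mode_schwartz j) (schrod_mode j) Tuf). Qed.

Let T_mode (a b : nat -> R) k : opP A h (cplx (orthosum mode a k) (orthosum mode b k))
  (cplx (orthosum mode (fun j => mode_energy j * a j) k)
        (orthosum mode (fun j => mode_energy j * b j) k)).
Proof.
rewrite -!schrod_orthosum.
exact: (opP_ralg A h cG rG dG pG (orthosum_ralg a k) (orthosum_ralg b k)).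
Qed.

Lemma opP_discrete : purely_discrete_spectrum (opP A h).
Proof.
exact: (diagonal_purely_discrete mode_sqint mode_orth mode_complete mode_energy_oo
  T_L2 T_coef T_mode (@opP_closed R n A h)).
Qed.

Lemma energy_scale (a : midx) : energy w h a = h * energy w 1 a.
Proof. by rewrite /energy mulr_sumr; apply: eq_bigr => k _; ring. Qed.

Lemma opP_spectrum : spectrum (opP A h) = [set (h * level j)%:C | j in [set: nat]].
Proof.
rewrite (diagonal_spectrum mode_sqint mode_orth mode_complete mode_energy_oo
  T_L2 T_coef T_mode (@opP_closed R n A h)).
apply/seteqP; split => [_ [j + <-]|_ [j _ <-]].
  rewrite /= /sqnorm /mode /mode_energy.
  case ej: (multi_index j) => [a|] mj; last by rewrite ip0l eqxx in mj.
  by exists j => //; rewrite /level ej energy_scale.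
(* If j codes no multi-index, [level j] is the energy of the zero multi-index; the code of that one
   is the index with a nonzero mode. *)
pose a := odflt [ffun=> 0%N] (multi_index j).
exists (pickle a) => /=; last by rewrite /mode_energy multi_index_pickle energy_scale.
by rewrite /sqnorm /mode multi_index_pickle; exact: (hermite_norm_neq0 VVT VTV w_gt0 h_gt0).
Qed.

End fixed_h.

Lemma opK_opP : opK A = opP A 1.
Proof.
rewrite /opK /opP; congr operator_closure; apply/funext => f; apply/funext => x.
by rewrite expr1n mulN1r.
Qed.

End oscillator.

Theorem mainTheorem6 (R : realType) (n : nat) (n_ge1 : (1 <= n)%N)
    (A : 'M[R]_n) (A_sym : A^T = A) (A_pos : pos_def A) :
  exists e : nat -> R,
    spectrum (opK A) = [set (e j)%:C | j in [set: nat]] /\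
    forall h0 h : R, 0 < h0 -> 0 < h <= h0 ->
      purely_discrete_spectrum (opP A h) /\
      spectrum (opP A h) = [set (h * e j)%:C | j in [set: nat]].
Proof.
have [V [d [VVT VTV VA]]] := symmetric_diag A_sym.
have d_gt0 := pos_def_diag VVT VTV VA A_pos.
pose w k := Num.sqrt (d 0 k).
have w_gt0 k : 0 < w k by rewrite sqrtr_gt0.
have qA x : qform A x = \sum_k w k ^+ 2 * normal_coord V k x ^+ 2.
  by rewrite (qform_diag VTV VA); apply: eq_bigr => k _; rewrite sqr_sqrtr// ltW.
(* [level w] depends only on the square roots of the eigenvalues of A, so one sequence serves all h;
   K is the case h = 1. *)
exists (level w); split.
  rewrite opK_opP (opP_spectrum VVT VTV w_gt0 qA ltr01).
  by apply: eq_imagel => j _; rewrite mul1r.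
move=> h0 h _ /andP[h_gt0 _]; split.
  exact: (opP_discrete VVT VTV w_gt0 qA h_gt0).
exact: (opP_spectrum VVT VTV w_gt0 qA h_gt0).
Qed.
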